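(* Let $P,Q\ge 2$ be integers with $\gcd(P,Q)=1$. Then the (non-trivial) torus knot $T(P,Q)$ is realised by an edge in the canonical layered one-vertex triangulation $\mathcal{T}=\operatorname{LST}(p,q)\cup\operatorname{LST}(r,s)$ of the three-sphere $\mathbb{S}^3$, where $P=p+q$ and $Q=r+s$. Here canonical means that $p,q,r,s$ are the positive integers with $p+q=P$, $r+s=Q$ and $|ps-qr|=1$, which are uniquely determined up to swapping $(p,q,r,s)\leftrightarrow(q,p,s,r)$.
   Context: Triangulation: a (generalised) triangulation of a closed 3-manifold is a realisation of it as a quotient of finitely many tetrahedra by affine identifications of their 2-faces in pairs; faces, edges or vertices of the same tetrahedron may be identified, but no edge is identified with itself in reverse. It is one-vertex if the quotient has exactly one vertex; then every edge is a simple closed curve. Torus knot: for coprime integers $a,b$, $T(a,b)$ is the knot in $\mathbb{S}^3$ lying on a standardly embedded (unknotted) torus and winding $a$ times in meridional and $b$ times in longitudinal direction. It is non-trivial exactly when $|a|,|b|\ge 2$. An edge $e$ of a one-vertex triangulation $\mathcal T$ of $\mathbb{S}^3$ represents (realises) a knot $K$ if some homeomorphism from the underlying space of $\mathcal T$ to $\mathbb{S}^3$ takes $e$ to $K$. Layering: let a solid torus be triangulated so that its boundary is a one-vertex torus (two triangles, three edges). Layering over a boundary edge $e$ means attaching a new tetrahedron by gluing two of its faces to the two boundary triangles so that the common edge of these two faces is matched with $e$. The result is again a solid torus with one-vertex boundary, in which $e$ has been replaced on the boundary by the other diagonal of the quadrilateral formed by the two boundary triangles. Layered solid tori: for coprime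 integers $p,q\ge 1$, $\operatorname{LST}(p,q)=\operatorname{LST}(q,p)$ is the minimally layered solid torus whose three boundary edges (the $p$-edge, the $q$-edge, the $(p+q)$-edge) are met $p$, $q$, $p+q$ times, respectively, by the boundary of the meridian disk. It is defined recursively. $\operatorname{LST}(1,1)$ is the degenerate solid torus with $0$ tetrahedra: the one-triangle Möbius band (triangle $(0,1,2)$ with edge $01$ identified with edge $12$ via $0\mapsto 1,\ 1\mapsto 2$), regarded as a thin solid torus. Its boundary consists of the two sides of the triangle; the edge $02$ is the 2-edge, and the identified edge $01=12$ is counted twice, as the two 1-edges of the boundary. $\operatorname{LST}(1,2)$ is a single tetrahedron $(0,1,2,3)$ with face $(0,1,2)$ glued to $(1,2,3)$ by $0\mapsto1,\ 1\mapsto2,\ 2\mapsto3$ (equivalently, layering over a 1-edge of $\operatorname{LST}(1,1)$). In general, for $p<q$, $\operatorname{LST}(p,q)$ is obtained from $\operatorname{LST}(p,q-p)$ by layering one tetrahedron over the boundary $(q-p)$-edge. So the number of tetrahedra of $\operatorname{LST}(p,q)$ is the number of steps of the subtraction-form Euclidean algorithm from $(p,q)$ down to $(1,1)$. Gluing: $\operatorname{LST}(p,q)\cup\operatorname{LST}(r,s)$ is obtained by gluing the two layered solid tori along their boundary triangulations so that the $p$-edge is glued to the $r$-edge, the $q$-edge to the $s$-edge and the $(p+q)$-edge to the $(r+s)$-edge. If one of the two is $\operatorname{LST}(1,1)$, this means folding the boundary of the other along its edge of largest weight, i.e. identifying its two boundary triangles with each other. A layered triangulation of $\mathbb{S}^3$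 is a triangulation of this form whose underlying manifold is $\mathbb{S}^3$. *)

(* Defs.v *)
From HB Require Import structures.
From Stdlib Require Import Relation_Operators Relation_Definitions.
From mathcomp Require Import all_boot all_order all_algebra generic_quotient.
From mathcomp Require Import all_classical all_reals all_analysis.

Set Implicit Arguments.
Unset Strict Implicit.
Unset Printing Implicit Defensive.

Import Order.TTheory GRing.Theory Num.Theory.
Import numFieldNormedType.Exports.
Local Open Scope classical_set_scope.
Local Open Scope ring_scope.
Local Open Scope quotient_scope.

(* [(t, (a, b, c))] is the triangle with ordered vertices [a], [b], [c] of the
   tetrahedron number [t]; the pairing [(F, G)] stands for the affine map from
   [F] to [G] that respects the two vertex orderings. *)
Definition face : Type := nat * ('I_4 * 'I_4 * 'I_4).
Definition pairing : Type := face * face.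

Record gluing := Gluing { ntets : nat; pairings : seq pairing }.

Definition corners (F : face) : seq 'I_4 :=
  let: (_, (a, b, c)) := F in [:: a; b; c].

Definition glued_faces (T : gluing) : seq face :=
  flatten [seq [:: pq.1; pq.2] | pq <- pairings T].

(* Every triangle of every tetrahedron (the one opposite to [f], for each
   vertex [f]) occurs exactly once in the list of pairings. *)
Definition closed_gluing (T : gluing) : Prop :=
  (forall F, F \in glued_faces T -> (F.1 < ntets T)%N /\ uniq (corners F)) /\
  (forall t (f : 'I_4), (t < ntets T)%N ->
     count (fun F => (F.1 == t) && (f \notin corners F)) (glued_faces T) = 1%N).

Section Tetrahedra.
Context (R : realType).

Definition simplex3 : set 'rV[R]_4 :=
  [set x | (forall j, 0 <= x ord0 j) /\ \sum_j x ord0 j = 1].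

(* The disjoint union of [n] tetrahedra, with the topology of [sigT_topology]. *)
Definition tets (n : nat) : Type := {_ : 'I_n & set_type simplex3}.
HB.instance Definition _ n := Topological.on (tets n).

Context {n : nat}.
Implicit Type u : tets n.

Definition coord u (j : 'I_4) : R := set_val (tagged u) ord0 j.

(* [u] lies in the face of tetrahedron [t] spanned by the vertices in [A]. *)
Definition in_cell (t : 'I_n) (A : {set 'I_4}) u : Prop :=
  tag u = t /\ forall j, j \notin A -> coord u j = 0.

(* [u] has barycentric coordinates [l0], [l1], [l2] in the triangle [F]; as [u]
   is in the tetrahedron, these are nonnegative and have sum 1 whenever the
   corners of [F] are distinct. *)
Definition on_face (F : face) (l0 l1 l2 : R) u : Prop :=
  let: (t, (a, b, c)) := F in
  tag u = t :> nat /\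
  forall j, coord u j = l0 * (j == a)%:R + l1 * (j == b)%:R + l2 * (j == c)%:R.

End Tetrahedra.
Arguments simplex3 R : clear implicits.

Section UnderlyingSpace.
Context (R : realType) (T : gluing).

Definition glued (u v : tets R (ntets T)) : Prop :=
  exists F G l0 l1 l2,
    [/\ (F, G) \in pairings T, on_face F l0 l1 l2 u & on_face G l0 l1 l2 v].

Definition identified : rel (tets R (ntets T)) :=
  fun u v => `[< clos_refl_sym_trans _ glued u v >].

Lemma identified_refl : reflexive identified.
Proof. by move=> u; apply/asboolP; exact: rst_refl. Qed.

Lemma identified_sym : symmetric identified.
Proof. by move=> u v; apply/asboolP/asboolP => ?; exact: rst_sym. Qed.

Lemma identified_trans : transitive identified.
Proof.
by move=> v u w /asboolP ? /asboolP ?; apply/asboolP; exact: (rst_trans _ _ _ v).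
Qed.

Canonical identified_equiv :=
  EquivRel identified identified_refl identified_sym identified_trans.

Definition underlying_space : Type := quotient_topology {eq_quot identified}.
HB.instance Definition _ := Topological.on underlying_space.
HB.instance Definition _ := Quotient.on underlying_space.

Definition quot (u : tets R (ntets T)) : underlying_space :=
  \pi_underlying_space u.

Definition vertex (x : underlying_space) : Prop :=
  exists t a, quot @` in_cell t [set a]%SET = [set x].

Definition edge (e : set underlying_space) : Prop :=
  exists t a b, a != b /\ e = quot @` in_cell t [set a; b]%SET.

Definition one_vertex : Prop := exists x, vertex = [set x].

(* [u] and [v] below are mirror images of each other in the edge [ab]. *)
Definition edge_reversed (t : 'I_(ntets T)) (a b : 'I_4) : Prop :=
  forall u v, in_cell t [set a; b]%SET u -> in_cell t [set a; b]%SET v ->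
    coord u a = coord v b -> quot u = quot v.

Definition triangulation : Prop :=
  closed_gluing T /\ forall t a b, a != b -> ~ edge_reversed t a b.

End UnderlyingSpace.

Definition homeomorphism (X Y : topologicalType) (h : X -> Y) : Prop :=
  exists g : Y -> X, [/\ cancel h g, cancel g h, continuous h & continuous g].

Section Knots.
Context (R : realType).

Definition sphere3 : set 'rV[R]_4 := [set x | \sum_j x ord0 j ^+ 2 = 1].

(* The curve [t |-> (e^(iat), e^(ibt)) / sqrt 2] on the Clifford torus, where
   (x0, x1, x2, x3) is read as (x0 + i x1, x2 + i x3). *)
Definition torus_curve (a b : int) (t : R) : 'rV[R]_4 :=
  \row_j (nth 0 [:: cos (a%:~R * t); sin (a%:~R * t);
                    cos (b%:~R * t); sin (b%:~R * t)] j / Num.sqrt 2).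

Definition torus_knot (a b : int) : set (set_type sphere3) :=
  [set x | exists t, set_val x = torus_curve a b t].

Definition triangulates_S3 (T : gluing) : Prop :=
  triangulation R T /\
  exists h : underlying_space R T -> set_type sphere3, homeomorphism h.

Definition realises (T : gluing) (e : set (underlying_space R T))
    (K : set (set_type sphere3)) : Prop :=
  exists h : underlying_space R T -> set_type sphere3,
    homeomorphism h /\ h @` e = K.

End Knots.
Arguments sphere3 R : clear implicits.
Arguments torus_knot R a b : clear implicits.

(* A layered solid torus. In [Solid n ps X Y] there are [n] tetrahedra with face
   pairings [ps], and the boundary consists of the triangles [X] and [Y].
   The corners of [X] = (x0, x1, x2) are ordered such that the edges opposite to
   x0, x1, x2 are the p-edge, the q-edge and the (p+q)-edge, in this order, and
   likewise for [Y] = (y0, y1, y2).  In a one-vertex torus the edge from x_i to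
   x_j is then the edge from y_j to y_i.
   [Moebius] is LST(1,1); the two sides of its triangle (0,1,2) have to be
   labelled (0,2,1) and (2,0,1), since an edge 01 of one side continues in the
   edge 12 of the other one. *)
Inductive layered_torus :=
  | Moebius
  | Solid (n : nat) (ps : seq pairing) (X Y : face).

Definition swap01 (F : face) : face :=
  let: (t, (a, b, c)) := F in (t, (b, a, c)).

(* Glues [F] and [G] to the boundary triangles.  For [Moebius] the corners of
   [F] are put on 0, 2, 1 and those of [G] on 2, 0, 1, so that the two triangles
   are folded together. *)
Definition attach (L : layered_torus) (F G : face) : seq pairing :=
  match L with
  | Moebius => [:: (F, swap01 G)]
  | Solid _ _ X Y => [:: (X, F); (Y, G)]
  end.

Definition tets_of (L : layered_torus) : nat :=
  if L is Solid n _ _ _ then n else 0.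

Definition pairings_of (L : layered_torus) : seq pairing :=
  if L is Solid _ ps _ _ then ps else [::].

Local Notation v0 := (@Ordinal 4 0 isT).
Local Notation v1 := (@Ordinal 4 1 isT).
Local Notation v2 := (@Ordinal 4 2 isT).
Local Notation v3 := (@Ordinal 4 3 isT).

(* From LST(p,q) to LST(p,p+q): the edge 12 of the new tetrahedron (0,1,2,3) is
   layered over the q-edge; 03 becomes the new (p+(p+q))-edge, and the former
   (p+q)-edge is 02 = 13.  On [Moebius] the only pairing is (2,0,1) -> (3,1,2),
   which is the map 0 -> 1, 1 -> 2, 2 -> 3 defining LST(1,2). *)
Definition layer (L : layered_torus) : layered_torus :=
  let n := tets_of L in
  Solid n.+1
    (pairings_of L ++ attach L (n, (v2, v0, v1)) (n, (v1, v3, v2)))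
    (n, (v0, v3, v2)) (n, (v3, v0, v1)).

(* Exchanges the p-edge and the q-edge. *)
Definition swap_pq (L : layered_torus) : layered_torus :=
  if L is Solid n ps X Y then Solid n ps (swap01 X) (swap01 Y) else Moebius.

(* For [q < p], LST(p,q) = LST(q,p) comes from LST(q,p-q) = LST(p-q,q). For
   [p = q] the only coprime pair is (1,1). *)
Fixpoint LST_rec (fuel p q : nat) : layered_torus :=
  if fuel is k.+1 then
    if (p < q)%N then layer (LST_rec k p (q - p))
    else if (q < p)%N then swap_pq (layer (swap_pq (LST_rec k (p - q) q)))
    else Moebius
  else Moebius.

Definition LST (p q : nat) : layered_torus := LST_rec (p + q) p q.

Definition shift_face (n : nat) (F : face) : face := ((n + F.1)%N, F.2).

Definition shift (n : nat) (L : layered_torus) : layered_torus :=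
  if L is Solid m ps X Y then
    Solid m [seq (shift_face n P.1, shift_face n P.2) | P <- ps]
      (shift_face n X) (shift_face n Y)
  else Moebius.

(* Edges of equal label are matched.  There are two ways to do so, which differ
   by the involution exchanging the two boundary triangles; it extends to the
   layered solid torus, exchanging 0 with 3 and 1 with 2 in every tetrahedron,
   so the choice does not matter up to isomorphism.
   The case of two Möbius bands does not give a triangulation; it does not
   occur for canonical parameters. *)
Definition lst_union (L M : layered_torus) : gluing :=
  let M' := shift (tets_of L) M in
  Gluing (tets_of L + tets_of M)
    (pairings_of L ++ pairings_of M' ++
     match L, M' with
     | _, Solid _ _ X Y => attach L X Y
     | Solid _ _ X Y, Moebius => attach Moebius X Y
     | Moebius, Moebius => [::]
     end).

Definition canonical_parameters (P Q p q r s : nat) : Prop :=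
  [/\ (0 < p)%N, (0 < q)%N, (0 < r)%N & (0 < s)%N] /\
  [/\ (p + q = P)%N, (r + s = Q)%N & `|(p * s)%:Z - (q * r)%:Z| = 1].

(* Main.v *)
(* A layered solid torus is mapped explicitly onto D^2 x S^1, in such a way that its two
   boundary triangles are the two triangles of R^2/Z^2 cut out by the lattice vectors (al,p),
   (be,q) and their sum, mapped linearly. The universal cover of LST(1,2) is a triangular prism
   whose vertices lie on a helix, which gives the map in that case. A further tetrahedron
   projects onto the boundary torus, with fibres parallel to v0 - v1 - v2 + v3; pushing the old
   solid torus inwards by the length of the fibre makes room for it. Two solid tori are then
   mapped onto the two halves of the join of two circles. If one of them is the Moebius band,
   the boundary of the other one is folded by
     (z, w) |-> (w + |z| u^P conj w, 2 z), where u = z/|z| and P is the largest weight,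
   followed by normalisation. In both cases the (p+q)-edge becomes a linear curve on the Clifford
   torus. Since the tetrahedra are compact, it suffices that the resulting map to the sphere is
   continuous and surjective and identifies exactly the glued points. *)

Require Import Defs.
From Stdlib Require Import Relation_Operators.
From mathcomp Require Import all_boot all_order all_algebra.
From mathcomp Require Import all_classical all_reals all_analysis.
From mathcomp Require Import zify ring lra.

Set Implicit Arguments.
Unset Strict Implicit.
Unset Printing Implicit Defensive.

Import Order.TTheory GRing.Theory Num.Theory.
Import numFieldNormedType.Exports.
Local Open Scope classical_set_scope.
Local Open Scope ring_scope.

(** The first components [al], [be] of the boundary slopes are not determined by the solid torus:
    twisting D^2 x S^1 along a meridian disk adds multiples of p and q to them. They are kept free,
    subject only to [al * q - be * p] being 1 or -1. This lets the Euclidean recursion replace [be]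
    by [be - al], and it lets the two sides of a union be matched: LST(p,q) is modelled with first
    components r, s and LST(r,s) with first components p, q. The gluing then merely exchanges the
    two angles, so that the meridian of one side is the longitude of the other, and the condition
    |ps - qr| = 1 is exactly the determinant condition. The (p+q)-edge has class (r+s, p+q), which
    is why it traces T(P,Q). Next to a Moebius band, r = s = 1 gives [al = be = 1]. A homeomorphism
    with the sphere says nothing about edges glued to themselves in reverse. To exclude these, the
    induction also records the slope of every edge, and whether the edge stays on the boundary
    torus. Angles live in R/Z, and the meridional one is undefined on the core; equality and
    continuity are phrased so as to tolerate both. *)

Local Notation v0 := (@Ordinal 4 0 isT).
Local Notation v1 := (@Ordinal 4 1 isT).
Local Notation v2 := (@Ordinal 4 2 isT).
Local Notation v3 := (@Ordinal 4 3 isT).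

(** * Trigonometry in units of one turn *)

Section TurnTrigonometry.
Context (R : realType).
Implicit Types a b t : R.

Definition cosT t : R := cos (pi *+ 2 * t).
Definition sinT t : R := sin (pi *+ 2 * t).

Definition eqm a b := a - b \is a Num.int.

Lemma eqm_refl a : eqm a a.
Proof. by rewrite /eqm subrr rpred0. Qed.

Lemma eqm_sym a b : eqm a b -> eqm b a.
Proof. by rewrite /eqm -rpredN opprB. Qed.

Lemma eqm_trans b a t : eqm a b -> eqm b t -> eqm a t.
Proof. by rewrite /eqm => ab bt; rewrite -(subrKA b) rpredD. Qed.

Lemma eqmD a b a' b' : eqm a b -> eqm a' b' -> eqm (a + a') (b + b').
Proof. by rewrite /eqm => ab ab'; rewrite opprD addrACA rpredD. Qed.

Lemma eqmN a b : eqm a b -> eqm (- a) (- b).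
Proof. by rewrite /eqm -rpredN opprD. Qed.

Lemma eqmMz (k : int) a b : eqm a b -> eqm (k%:~R * a) (k%:~R * b).
Proof. by rewrite /eqm -mulrBr => ab; rewrite rpredM // intr_int. Qed.

Lemma eqm_int (k : int) a b : a = b + k%:~R -> eqm a b.
Proof. by move=> ->; rewrite /eqm [b + _]addrC addrK intr_int. Qed.

Lemma cosTN t : cosT (- t) = cosT t.
Proof. by rewrite /cosT mulrN cosN. Qed.

Lemma sinTN t : sinT (- t) = - sinT t.
Proof. by rewrite /sinT mulrN sinN. Qed.

Lemma cosTD a b : cosT (a + b) = cosT a * cosT b - sinT a * sinT b.
Proof. by rewrite /cosT mulrDr cosD. Qed.

Lemma sinTD a b : sinT (a + b) = sinT a * cosT b + cosT a * sinT b.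
Proof. by rewrite /sinT mulrDr sinD. Qed.

Lemma cosT2DsinT2 t : cosT t ^+ 2 + sinT t ^+ 2 = 1.
Proof. exact: cos2Dsin2. Qed.

Lemma cosT_nat n t : cosT (t + n%:R) = cosT t.
Proof. by rewrite /cosT mulrDr mulr_natr (periodicn (@cosD2pi R)). Qed.

Lemma sinT_nat n t : sinT (t + n%:R) = sinT t.
Proof. by rewrite /sinT mulrDr mulr_natr (periodicn (@sinD2pi R)). Qed.

Lemma cosT_eqm a b : eqm a b -> cosT a = cosT b.
Proof.
rewrite /eqm intrE => /orP[]; last rewrite opprB.
  by case/natrP => n /eqP; rewrite subr_eq => /eqP ->; rewrite addrC cosT_nat.
by case/natrP => n /eqP; rewrite subr_eq => /eqP ->; rewrite addrC cosT_nat.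
Qed.

Lemma sinT_eqm a b : eqm a b -> sinT a = sinT b.
Proof.
rewrite /eqm intrE => /orP[]; last rewrite opprB.
  by case/natrP => n /eqP; rewrite subr_eq => /eqP ->; rewrite addrC sinT_nat.
by case/natrP => n /eqP; rewrite subr_eq => /eqP ->; rewrite addrC sinT_nat.
Qed.

Lemma cosT0 : cosT 0 = 1.
Proof. by rewrite /cosT mulr0 cos0. Qed.

Lemma sinT0 : sinT 0 = 0.
Proof. by rewrite /sinT mulr0 sin0. Qed.

Lemma in_half t : 0 <= t -> t <= 1/2 -> pi *+ 2 * t \in `[0, pi].
Proof.
move=> t0 t1; have p0 := @pi_gt0 R; rewrite in_itv /= mulr_ge0 ?(mulrn_wge0 _ (ltW p0)) //=.
rewrite -mulr_natr -mulrA -[leRHS]mulr1 ler_pM2l //; lra.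
Qed.

Lemma cosT_lt a b : 0 <= a -> a < b -> b <= 1/2 -> cosT b < cosT a.
Proof.
move=> a0 ab b1; have b0 : 0 <= b by lra.
have a1 : a <= 1/2 by lra.
by rewrite /cosT ltr_cos ?in_half // ltr_pM2l // (mulrn_wgt0 _ (@pi_gt0 R)).
Qed.

(** The fractional part [d] has the same cosine. Monotonicity excludes 0 < d <= 1/2, and the
    reflection of [d] to 1 - d excludes the rest of the interval. *)
Lemma cosT_eq1 t : cosT t = 1 -> t \is a Num.int.
Proof.
move=> t1; pose d := t - (Num.floor t)%:~R.
have dt : eqm d t by rewrite /eqm /d addrAC subrr add0r rpredN intr_int.
have d0 : 0 <= d by rewrite subr_ge0 ge_floor // num_real.
have d1 : d < 1 by have := floorD1_gt t; rewrite /d intrD; lra.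
have cd : cosT d = 1 by rewrite (cosT_eqm dt).
suff -> : t = (Num.floor t)%:~R by rewrite intr_int.
apply/eqP; rewrite -subr_eq0 -/d; apply/eqP.
have [d0'|] := ltP 0 d; last by lra.
have [dh|dh] := leP d (1/2).
  by have := cosT_lt (lexx 0) d0' dh; rewrite cosT0 cd ltxx.
have : cosT (1 - d) < cosT 0 by apply: cosT_lt; lra.
have -> : cosT (1 - d) = 1; last by rewrite cosT0 ltxx.
by rewrite -cosTN opprB -[RHS]cd; apply: cosT_eqm; rewrite /eqm addrAC subrr add0r rpredN rpred1.
Qed.

Lemma eqmP a b : cosT a = cosT b -> sinT a = sinT b -> eqm a b.
Proof.
move=> ca sa; apply: cosT_eq1; rewrite cosTD cosTN sinTN ca sa.
by rewrite mulrN opprK -!expr2 cosT2DsinT2.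
Qed.

Lemma turn_exists a b : a ^+ 2 + b ^+ 2 = 1 -> exists t, cosT t = a /\ sinT t = b.
Proof.
move=> ab1; have a1 : -1 <= a <= 1.
  rewrite -ler_norml -(@ler_pXn2r _ 2) ?nnegrE // expr1n real_normK ?num_real //.
  by rewrite -ab1 lerDl sqr_ge0.
have p0 := @pi_gt0 R; have p2 : pi *+ 2 != 0 :> R by rewrite mulrn_eq0 /= gt_eqF.
pose u := acos a / (pi *+ 2).
have cu : cosT u = a by rewrite /cosT mulrC divfK // acosK // in_itv.
have su : 0 <= sinT u.
  rewrite /sinT mulrC divfK // sin_ge0_pi // acos_ge0 //=; exact: acos_lepi.
have := cosT2DsinT2 u; rewrite cu -ab1 => /addrI /eqP.
rewrite eqf_sqr => /orP[/eqP <-|/eqP s]; first by exists u.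
by exists (- u); rewrite cosTN sinTN cu s opprK.
Qed.

(* Plays the role of the distance of [t] to the nearest integer, but is visibly continuous in
   e^(2 pi i t). *)
Definition phi t : R := (1 - cosT t) / 4.

Lemma phiN t : phi (- t) = phi t. Proof. by rewrite /phi cosTN. Qed.

Lemma phi_eqm a b : eqm a b -> phi a = phi b.
Proof. by move=> ab; rewrite /phi (cosT_eqm ab). Qed.

Lemma phi0 : phi 0 = 0. Proof. by rewrite /phi cosT0 subrr mul0r. Qed.

Lemma phi_1B t : phi (1 - t) = phi t.
Proof. by rewrite -phiN; apply: phi_eqm; rewrite /eqm opprB addrAC subrr add0r rpredN rpred1. Qed.

Lemma phi_ge0 t : 0 <= phi t.
Proof. by rewrite /phi divr_ge0 // subr_ge0 cos_le1. Qed.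

Lemma phi_le t : phi t <= 1/2.
Proof. have := cos_geN1 (pi *+ 2 * t); rewrite /phi /cosT; lra. Qed.

Lemma phi_lt a b : 0 <= a -> a < b -> b <= 1/2 -> phi a < phi b.
Proof. by move=> a0 ab b1; have := cosT_lt a0 ab b1; rewrite /phi; lra. Qed.

(** [phi] increases up to 1/2 and is symmetric about 1/2, so only the distance to the nearest
    integer counts, and b in [a, 1 - a] is at least as far away as a. *)
Lemma phi_le_sym a b : 0 <= a -> a <= b -> b <= 1 - a -> phi a <= phi b.
Proof.
move=> a0 ab b1; have [/eqP <-//|/eqP nab] := boolP (a == b).
have [bh|bh] := leP b (1/2); first by apply/ltW/phi_lt => //; lra.
rewrite -(phi_1B b); have [/eqP <-//|/eqP nab'] := boolP (a == 1 - b).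
by apply/ltW/phi_lt; lra.
Qed.

Lemma phi_lt_sym a b : 0 <= a -> a < b -> b < 1 - a -> phi a < phi b.
Proof.
move=> a0 ab b1; have [bh|bh] := leP b (1/2); first by apply/phi_lt => //; lra.
by rewrite -(phi_1B b); apply/phi_lt; lra.
Qed.

Lemma phi_inj a b : 0 <= a -> 0 <= b -> a <= 1/2 -> b <= 1/2 -> phi a = phi b -> a = b.
Proof.
move=> a0 b0 a1 b1 ab; have [h|h|//] := ltgtP a b.
  by have := phi_lt a0 h b1; rewrite ab ltxx.
by have := phi_lt b0 h a1; rewrite ab ltxx.
Qed.

Lemma phi_surj t : 0 <= t -> t <= 1/2 -> exists s, [/\ 0 <= s, s <= 1/2 & phi s = t].
Proof.
move=> t0 t1; have p0 := @pi_gt0 R; have p2 : 0 < pi *+ 2 :> R by rewrite mulrn_wgt0.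
have h : -1 <= 1 - 4 * t <= 1 by apply/andP; split; lra.
exists (acos (1 - 4 * t) / (pi *+ 2)); split.
- by rewrite divr_ge0 ?acos_ge0 // ltW.
- rewrite ler_pdivrMr // (_ : 1/2 * (pi *+ 2) = pi) ?acos_lepi //.
  by move: (pi : R) => q; lra.
- by rewrite /phi /cosT [X in cos X]mulrC divfK ?gt_eqF // acosK ?in_itv //; lra.
Qed.

Lemma eqm_unit_eq a b : 0 < a -> a < 1 -> 0 < b -> b < 1 -> eqm a b -> a = b.
Proof.
move=> a0 a1 b0 b1 /intrP[k abk].
have k1 : (k < 1)%R by rewrite -(ltr_int R) -abk; lra.
have k2 : (-1 < k)%R by rewrite -(ltr_int R) -abk; lra.
have k0 : k = 0 by lia.
by apply/eqP; rewrite -subr_eq0 abk k0.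
Qed.

End TurnTrigonometry.

(** * Quotients of compact spaces *)

Lemma compact_set_type (X : topologicalType) (A : set X) :
  compact A -> compact [set: set_type A].
Proof.
move=> cA F FF _.
have [] := cA (set_val @ F).
- by apply: (@filterS _ F _ setT) => [x _|]; [exact: set_valP | exact: filterT].
move=> p [Ap cp]; exists (SigSub (mem_set Ap)); split=> // B C FB [_ [[W oW <-] Wp] WC].
have [] := cp (set_val @` B) W.
- by apply: (@filterS _ F _ B) => [x Bx|//]; exists x.
- by apply: open_nbhs_nbhs; split.
by move=> _ [[x Bx <-] Wx]; exists x; split=> //; apply: WC.
Qed.

Lemma hausdorff_set_type (X : topologicalType) (A : set X) :
  hausdorff_space X -> hausdorff_space (set_type A).
Proof.
move=> hX x y cxy; apply: val_inj; apply: hX => B C xB yC.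
have [] := cxy (set_val @^-1` B) (set_val @^-1` C).
- exact: (@initial_continuous _ _ (@set_val _ A)).
- exact: (@initial_continuous _ _ (@set_val _ A)).
by move=> z [Bz Cz]; exists (set_val z).
Qed.

Lemma continuous_row (X : topologicalType) (R : realType) n (f : X -> 'rV[R]_n) :
  (forall j, continuous (fun x => f x ord0 j)) -> continuous f.
Proof.
move=> cf x B [P Px PB].
have : \forall z \near x, forall j, P ord0 j (f z ord0 j).
  by apply: filter_forall => j; apply: cf; exact: Px.
by apply: filterS => z Pz; apply: PB => i j; rewrite ord1; exact: Pz.
Qed.

Lemma continuous_coord (R : realType) (j : 'I_4) :
  continuous (fun s : set_type (simplex3 R) => set_val s ord0 j).
Proof.
move=> s; apply: (@continuous_comp _ _ _ (@set_val _ (simplex3 R)) (fun M => M ord0 j)).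
  exact: initial_continuous.
exact: coord_continuous.
Qed.

Lemma compact_simplex3 (R : realType) : compact (simplex3 R).
Proof.
apply: (@subclosed_compact _ _ [set v : 'rV[R]_4 | forall j, v ord0 j \in `[0, 1]]).
- have -> : simplex3 R = \bigcap_(j in [set: 'I_4]) [set x : 'rV[R]_4 | 0 <= x ord0 j]
      `&` [set x : 'rV[R]_4 | \sum_j x ord0 j = 1].
    by apply/seteqP; split=> x [x0 x1]; split=> // j; [move=> _|]; exact: x0.
  apply: closedI; first apply: closed_bigI => j _.
    have /continuous_closedP cj : continuous (fun x : 'rV[R]_4 => x ord0 j).
      exact: coord_continuous.
    exact: (cj _ (@closed_ge R 0)).
  have /continuous_closedP cs : continuous (fun x : 'rV[R]_4 => \sum_j x ord0 j).
    by apply: continuous_big => [|j _]; [exact: add_continuous | exact: coord_continuous].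
  exact: (cs _ (@closed_eq R 1)).
- by apply: (@rV_compact _  _ (fun=> `[(0 : R), 1]%classic)) => _; apply: segment_compact.
move=> x [x0 x1] j; rewrite /= in_itv /= x0 /= -x1 (bigD1 j) //= lerDl.
by apply: sumr_ge0 => i _.
Qed.

(** Continuity of the inverse is the point: a closed set of the quotient pulls back to a closed,
    hence compact, set in the disjoint union of tetrahedra, whose image under [f] is compact and
    therefore closed in the Hausdorff space [Y]. *)
Lemma quotient_homeomorphism (R : realType) (T : gluing) (Y : topologicalType)
    (f : tets R (ntets T) -> Y) :
  hausdorff_space Y -> continuous f -> (forall y, exists u, f u = y) ->
  (forall u v, f u = f v <-> identified u v) ->
  exists2 h : underlying_space R T -> Y, homeomorphism h & forall u, h (quot u) = f u.
Proof.
move=> hY cf sf fE.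
have fr u : f (repr (quot u : underlying_space R T)) = f u.
  by apply/fE/eqmodP; rewrite reprK.
have /choice [g gE] : forall y, exists x : underlying_space R T, f (repr x) = y.
  by move=> y; have [u <-] := sf y; exists (quot u); exact: fr.
exists (f \o repr) => [|u]; last exact: fr.
exists g; split.
- move=> x; rewrite -[RHS]reprK -[LHS]reprK; apply/eqmodP/fE; rewrite gE //.
- exact: gE.
- apply: repr_comp_continuous => // a b /eqP /eqmodP ab; apply/eqP; exact/fE.
apply/continuous_closedP => C cC.
have -> : g @^-1` C = f @` (@quot R T @^-1` C).
  apply/seteqP; split=> [y Cy|_ [u Cu <-]].
    by exists (repr (g y)); rewrite /= /quot ?reprK // gE.
  rewrite /preimage /= (_ : g (f u) = quot u) //.
  rewrite -[LHS]reprK; apply/eqmodP/fE; exact: gE.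
apply: compact_closed => //; apply: continuous_compact.
  exact: continuous_subspaceT.
apply: (@subclosed_compact _ _ setT) => //.
  have cq : continuous (@quot R T) by exact: pi_continuous.
  by move/continuous_closedP: cq; apply.
apply: sigT_compact; first exact: finite_finset.
by move=> _; apply: compact_set_type; exact: compact_simplex3.
Qed.

(** * Continuity in polar coordinates *)

Section PolarContinuity.
Context (R : realType) (X : topologicalType).
Implicit Types (r x y g : X -> R) (z : X).

(** Needed at the core of a solid torus: [g] depends on an angle that has no limit there, but the
    product is squeezed to 0 because [g] is bounded. *)
Lemma continuous_fun_norm_bounded r g z (M : R) :
  (forall w, `|g w| <= M) -> {for z, continuous r} ->
  (r z != 0 -> {for z, continuous g}) -> {for z, continuous (fun w => r w * g w)}.
Proof.
move=> gM cr cg; have [rz0|] := eqVneq (r z) 0; last by move=> /cg; exact: continuousM.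
have M0 : 0 <= M by apply: le_trans (gM z).
rewrite /prop_for /continuous_at rz0 mul0r.
have c0 : `|r w| * M @[w --> z] --> 0.
  rewrite -(mul0r M) -(normr0 R) -rz0; apply: cvgM; last exact: cvg_cst.
  exact: cvg_norm.
apply: (@squeeze_cvgr _ _ _ _ (fun w => - (`|r w| * M)) (fun w => `|r w| * M)).
- apply: nearW => w; rewrite -ler_norml normrM; exact: ler_wpM2l.
- by rewrite -oppr0; exact: cvgN.
- exact: c0.
Qed.

Lemma continuous_cosT (f : X -> R) z : {for z, continuous f} ->
  {for z, continuous (fun w => cosT (f w))}.
Proof.
move=> cf; apply: (@continuous_comp _ _ _ (fun w => pi *+ 2 * f w) (@cos R)).
  by apply: continuousM => //; exact: cst_continuous.
exact: continuous_cos.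
Qed.

Lemma continuous_sinT (f : X -> R) z : {for z, continuous f} ->
  {for z, continuous (fun w => sinT (f w))}.
Proof.
move=> cf; apply: (@continuous_comp _ _ _ (fun w => pi *+ 2 * f w) (@sin R)).
  by apply: continuousM => //; exact: cst_continuous.
exact: continuous_sin.
Qed.

(** Continuity as a map to R/Z; [x] itself may jump by integers. *)
Definition turn_continuous x z :=
  {for z, continuous (fun w => cosT (x w))} /\
  {for z, continuous (fun w => sinT (x w))}.

Lemma turn_continuousD x y z : turn_continuous x z -> turn_continuous y z ->
  turn_continuous (fun w => x w + y w) z.
Proof.
move=> [cx sx] [cy sy]; split.
  rewrite (_ : (fun w => _) = fun w => cosT (x w) * cosT (y w) - sinT (x w) * sinT (y w)).
    by apply: continuousB; apply: continuousM.
  by apply/funext => w; rewrite cosTD.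
rewrite (_ : (fun w => _) = fun w => sinT (x w) * cosT (y w) + cosT (x w) * sinT (y w)).
  by apply: continuousD; apply: continuousM.
by apply/funext => w; rewrite sinTD.
Qed.

Lemma turn_continuousN x z : turn_continuous x z -> turn_continuous (fun w => - x w) z.
Proof.
move=> [cx sx]; split.
  by rewrite (_ : (fun w => _) = fun w => cosT (x w)) //; apply/funext => w; rewrite cosTN.
rewrite (_ : (fun w => _) = fun w => - sinT (x w)); first exact: continuousN.
by apply/funext => w; rewrite sinTN.
Qed.

(** Only integral multiples are well defined on R/Z, so the argument is by repeated addition rather
    than by continuity of multiplication. *)
Lemma turn_continuousMz x z (k : int) : turn_continuous x z ->
  turn_continuous (fun w => k%:~R * x w) z.
Proof.
move=> cx; have cn n : turn_continuous (fun w => n%:R * x w) z.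
  elim: n => [|n IH].
    rewrite (_ : (fun w => _) = fun=> 0); first by split; exact: cst_continuous.
    by apply/funext => w; rewrite mul0r.
  rewrite (_ : (fun w => _) = fun w => n%:R * x w + x w); first exact: turn_continuousD.
  by apply/funext => w; rewrite -natr1 mulrDl mul1r.
case: k => n; first exact: cn.
rewrite (_ : (fun w => _) = fun w => - (n.+1%:R * x w)); first exact/turn_continuousN/cn.
by apply/funext => w; rewrite NegzE rmorphN mulNr.
Qed.

(** Continuity as a map to D^2 x S^1. The disk is described by its Cartesian coordinates, so nothing
    is demanded of [x] where [r] vanishes. *)
Definition polar_continuous r x y :=
  [/\ continuous r, continuous (fun w => r w * cosT (x w)),
      continuous (fun w => r w * sinT (x w)) &
      forall z, turn_continuous y z].

Lemma polar_turn_continuous r x y z : polar_continuous r x y -> r z != 0 ->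
  turn_continuous x z.
Proof.
move=> [cr cc cs _] rz.
have near_r : \forall w \near z, r w != 0.
  by apply: cvgr_neq0 rz; exact: cr.
have div g : {for z, continuous (fun w => r w * g w)} -> {for z, continuous g}.
  move=> crg; have : {for z, continuous (fun w => (r w * g w) / r w)}.
    by apply: continuousM => //; apply: continuousV => //; exact: cr.
  rewrite /prop_for /continuous_at mulrC mulKf //; apply: cvg_trans.
  apply: near_eq_cvg; near=> w; rewrite mulrC mulKf //; near: w; exact: near_r.
by split; apply: div; [exact: cc | exact: cs].
Unshelve. all: by end_near. Qed.

Lemma polar_combination r x y z (k l : int) : polar_continuous r x y -> r z != 0 ->
  turn_continuous (fun w => k%:~R * x w + l%:~R * y w) z.
Proof.
move=> pc rz; apply: turn_continuousD; apply: turn_continuousMz.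
  exact: polar_turn_continuous pc rz.
by case: pc.
Qed.

End PolarContinuity.

(** * Models of layered solid tori *)

Lemma I4_ind (Q : 'I_4 -> Prop) : Q v0 -> Q v1 -> Q v2 -> Q v3 -> forall j, Q j.
Proof.
move=> Q0 Q1 Q2 Q3 [[|[|[|[|//]]]] h].
- by rewrite (_ : Ordinal h = v0) //; apply: val_inj.
- by rewrite (_ : Ordinal h = v1) //; apply: val_inj.
- by rewrite (_ : Ordinal h = v2) //; apply: val_inj.
- by rewrite (_ : Ordinal h = v3) //; apply: val_inj.
Qed.

Section Points.
Context (R : realType).

(** A plain number as index makes the points of a small gluing literally points of a larger one, so
    a model needs no transport when a tetrahedron is added; the range of the index becomes a
    hypothesis. *)
Definition point_of_tets : Type := nat * set_type (simplex3 R).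
Local Notation pt := point_of_tets.
Implicit Types (u v w : pt) (F G X Y : face) (ps : seq pairing).

Definition bc u (j : 'I_4) : R := set_val u.2 ord0 j.

Definition pon_face F (l0 l1 l2 : R) u : Prop :=
  let: (t, (a, b, c)) := F in
  u.1 = t /\
  forall j, bc u j = l0 * (j == a)%:R + l1 * (j == b)%:R + l2 * (j == c)%:R.

Definition pglued ps u v : Prop :=
  exists F G l0 l1 l2,
    [/\ (F, G) \in ps, pon_face F l0 l1 l2 u & pon_face G l0 l1 l2 v].

Definition pident ps : pt -> pt -> Prop := clos_refl_sym_trans _ (pglued ps).

Lemma bc_ge0 u j : 0 <= bc u j.
Proof. by have [h _] := set_valP u.2; exact: h. Qed.

Lemma bc_sum u : bc u v0 + bc u v1 + bc u v2 + bc u v3 = 1.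
Proof.
have [_] := set_valP u.2; rewrite !big_ord_recl big_ord0 addr0 !addrA => <-.
by congr (_ + _ + _ + _); congr (fun_of_matrix _ _ _); apply: val_inj.
Qed.

Lemma pt_ext u v : u.1 = v.1 -> (forall j, bc u j = bc v j) -> u = v.
Proof.
case: u v => [t s] [t' s'] /= -> e; congr (_, _); apply: val_inj.
by apply/rowP => j; have := e j.
Qed.

Lemma pt_exists t (f : 'I_4 -> R) : (forall j, 0 <= f j) ->
  f v0 + f v1 + f v2 + f v3 = 1 -> exists u, u.1 = t /\ forall j, bc u j = f j.
Proof.
move=> f0 f1; have h : simplex3 R (\row_j f j).
  split=> [j|]; first by rewrite mxE.
  rewrite -f1 !big_ord_recl big_ord0 addr0 !addrA !mxE.
  by congr (_ + _ + _ + _); congr (f _); apply: val_inj.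
exists (t, SigSub (mem_set h)); split=> // j.
by rewrite /bc /set_val /= mxE.
Qed.

Lemma pt_exists4 t (a b c d : R) : 0 <= a -> 0 <= b -> 0 <= c -> 0 <= d ->
  a + b + c + d = 1 ->
  exists u, [/\ u.1 = t, bc u v0 = a, bc u v1 = b, bc u v2 = c & bc u v3 = d].
Proof.
move=> a0 b0 c0 d0 s.
have [||u [ut uE]] := @pt_exists t (fun j => nth 0 [:: a; b; c; d] j).
- by apply: I4_ind.
- by [].
by exists u; rewrite !uE.
Qed.

Lemma pon_face_exists F (l0 l1 l2 : R) : 0 <= l0 -> 0 <= l1 -> 0 <= l2 ->
  l0 + l1 + l2 = 1 -> exists u, pon_face F l0 l1 l2 u.
Proof.
case: F => t [[a b] c] p0 p1 p2 s.
apply: pt_exists => [j|]; first by rewrite !addr_ge0 // mulr_ge0.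
pose S (x : 'I_4) : R := (v0 == x)%:R + (v1 == x)%:R + (v2 == x)%:R + (v3 == x)%:R.
have e x : S x = 1 by move: x; apply: I4_ind; rewrite /S /= ?addr0 ?add0r.
transitivity (l0 * S a + l1 * S b + l2 * S c); first by rewrite /S; ring.
by rewrite !e !mulr1.
Qed.

Lemma pident_sub ps ps' u v : {subset ps <= ps'} -> pident ps u v -> pident ps' u v.
Proof.
move=> sub; elim=> {u v} [u v|u|u v _ IH|u v w _ IH1 _ IH2].
- move=> [F [G [l0 [l1 [l2 [/sub h h1 h2]]]]]]; apply: rst_step.
  by exists F, G, l0, l1, l2.
- exact: rst_refl.
- exact: rst_sym.
- exact: rst_trans IH1 IH2.
Qed.

Lemma pident_step F G (l0 l1 l2 : R) ps u v : (F, G) \in ps -> pon_face F l0 l1 l2 u ->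
  pon_face G l0 l1 l2 v -> pident ps u v.
Proof. by move=> h hu hv; apply: rst_step; exists F, G, l0, l1, l2. Qed.

(* [r], [x], [y] stand for the point (r e^(2 pi i x), e^(2 pi i y)) of the solid
   torus, so that [x] is irrelevant where [r = 0]. *)
Definition same_point (r x y : pt -> R) u v : Prop :=
  [/\ r u = r v, eqm (y u) (y v) & r u = 0 \/ eqm (x u) (x v)].

Lemma same_point_sym r x y u v : same_point r x y u v -> same_point r x y v u.
Proof. by move=> [rE /eqm_sym yE [r0|/eqm_sym xE]]; split; rewrite -?rE; auto. Qed.

Lemma same_point_trans r x y v u w :
  same_point r x y u v -> same_point r x y v w -> same_point r x y u w.
Proof.
move=> [r1 y1 x1] [r2 y2 x2]; split; rewrite ?r1 //; first exact: eqm_trans y1 y2.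
by case: x1 => [h|x1]; [left; rewrite -r1|case: x2 => [|x2]; auto; right; exact: eqm_trans x1 x2].
Qed.

(** Data against reversed edges. The nonzero number [d2] of turns along the core suffices for a
    union of two solid tori. The fold also identifies distinct boundary points, but only ones with
    equal [x]; hence the alternative: either the edge has a boundary slope, whose first component is
    nonzero where the fold is used, or its interior avoids the boundary torus. *)
Definition edge_model (al p be q : int) (r x y : pt -> R) t (a b : 'I_4) : Prop :=
  exists d1 d2 : int, [/\ d2 != 0,
    (d1, d2) \in [:: (al, p); (be, q); (al + be, p + q);
                     (- al, - p); (- be, - q); (- (al + be), - (p + q))] \/
    (forall u, u.1 = t -> bc u a + bc u b = 1 -> 0 < bc u a -> 0 < bc u b -> r u < 1) &
    forall u, u.1 = t -> bc u a + bc u b = 1 ->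
      eqm (x u) (bc u b * d1%:~R) /\ eqm (y u) (bc u b * d2%:~R)].

Lemma edge_model_sym al p be q r x y t a b :
  edge_model al p be q r x y t a b -> edge_model al p be q r x y t b a.
Proof.
move=> [d1 [d2 [d20 h1 h2]]]; exists (- d1), (- d2); split; first by rewrite oppr_eq0.
  case: h1 => [h1|h1]; [left|right] => [|u ut ab b0 a0].
    by move: h1; rewrite !inE => /orP[|/orP[|/orP[|/orP[|/orP[]]]]] /eqP[-> ->];
      rewrite ?opprK eqxx ?orbT.
  by apply: h1 => //; rewrite addrC.
move=> u ut ab; have [|h3 h4] := h2 u ut; first by rewrite addrC.
have e : bc u b = 1 - bc u a by lra.
split; [apply: eqm_trans h3 _ | apply: eqm_trans h4 _]; rewrite e.
  by apply: (@eqm_int _ d1); rewrite rmorphN; ring.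
by apply: (@eqm_int _ d2); rewrite rmorphN; ring.
Qed.

(* (al, p), (be, q) and their sum are the classes of the p-edge, the q-edge and the
   (p+q)-edge in the boundary torus, the first coordinate counting turns of the
   meridian disk and the second one turns of the core. *)
Record solid_model (n : nat) ps X Y (al p be q : int) (r x y : pt -> R) : Prop := {
  model_cont : forall t, (t < n)%N -> polar_continuous
    (fun s => r (t, s)) (fun s => x (t, s)) (fun s => y (t, s));
  model_range : forall u, (u.1 < n)%N -> 0 <= r u <= 1;
  model_faces : [/\ (X.1 < n)%N, (Y.1 < n)%N &
    forall P, P \in ps -> (P.1.1 < n)%N /\ (P.2.1 < n)%N];
  model_glue : forall u v, pglued ps u v -> same_point r x y u v;
  model_inj : forall u v, (u.1 < n)%N -> (v.1 < n)%N -> same_point r x y u v ->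
    pident ps u v;
  model_surj : forall r0 x0 y0 : R, 0 <= r0 <= 1 -> exists u,
    [/\ (u.1 < n)%N, r u = r0, eqm (y u) y0 & r0 = 0 \/ eqm (x u) x0];
  model_X : forall (l0 l1 l2 : R) u, pon_face X l0 l1 l2 u ->
    [/\ r u = 1, eqm (x u) (l2 * be%:~R + l1 * (al + be)%:~R) &
        eqm (y u) (l2 * q%:~R + l1 * (p + q)%:~R)];
  model_Y : forall (l0 l1 l2 : R) u, pon_face Y l0 l1 l2 u ->
    [/\ r u = 1, eqm (x u) (- (l2 * be%:~R + l1 * (al + be)%:~R)) &
        eqm (y u) (- (l2 * q%:~R + l1 * (p + q)%:~R))];
  model_vertex : forall u j, (u.1 < n)%N -> bc u j = 1 -> r u = 1;
  model_edge : forall t a b, (t < n)%N -> a != b -> edge_model al p be q r x y t a b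
}.

(** The Moebius band is degenerate and no solid torus as a space; it enters only through the first
    layering and through the fold. *)
Definition has_model L (al p be q : int) : Prop :=
  if L is Solid n ps X Y then exists r x y, solid_model n ps X Y al p be q r x y
  else False.

End Points.

(** * Layering a tetrahedron *)

Section PhiMin.
Context (R : realType).
Implicit Types a b c d : R.

(** Here a, b, c, d are the barycentric coordinates of the layered tetrahedron. The left side is the
    depth given to a point, the right side the depth of the pushed-in old boundary below it. The
    smaller of b, c is at most each of b + d, c + d and their complements to 1. *)
Lemma phi_min_le a b c d : 0 <= a -> 0 <= b -> 0 <= c -> 0 <= d -> a + b + c + d = 1 ->
  phi (Num.min b c) <= Num.min (phi (b + d)) (phi (c + d)).
Proof.
by move=> *; rewrite le_min; case: (leP b c) => ?; apply/andP; split; apply: phi_le_sym; lra.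
Qed.

(** This is the agreement on the two glued faces. For d = 0 nothing is left to show; for a = 0 the
    sums are 1 - c and 1 - b, and [phi] is symmetric. *)
Lemma phi_min_eq a b c d : 0 <= a -> 0 <= b -> 0 <= c -> 0 <= d -> a + b + c + d = 1 ->
  a = 0 \/ d = 0 -> phi (Num.min b c) = Num.min (phi (b + d)) (phi (c + d)).
Proof.
move=> a0 b0 c0 d0 s ad; apply/le_anti; rewrite (phi_min_le a0) //=.
case: ad => [a0'|->]; last by rewrite !addr0; case: (leP b c) => ?; rewrite ge_min lexx ?orbT.
have -> : b + d = 1 - c by lra.
have -> : c + d = 1 - b by lra.
by rewrite !phi_1B; case: (leP b c) => ?; rewrite ge_min lexx ?orbT.
Qed.

Lemma phi_min_lt a b c d : 0 < a -> 0 <= b -> 0 <= c -> 0 < d -> a + b + c + d = 1 ->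
  phi (Num.min b c) < Num.min (phi (b + d)) (phi (c + d)).
Proof.
by move=> *; rewrite lt_min; case: (leP b c) => ?; apply/andP; split; apply: phi_lt_sym; lra.
Qed.

(* The point a (al,p) + b (al+be,p+q) of the boundary torus is pushed inwards by
   min(phi a, phi b), see [ell_comb]; this vanishes on the edges (al,p) and (al+be,p+q), which
   the layered tetrahedron keeps on the boundary. *)
Definition ell (al p be q : int) (x y : R) : R :=
  Num.min (phi ((p + q)%:~R * x - (al + be)%:~R * y)) (phi (al%:~R * y - p%:~R * x)).

Lemma ell_ge0 al p be q x y : 0 <= ell al p be q x y.
Proof. by rewrite /ell le_min !phi_ge0. Qed.

Lemma ell_le al p be q x y : ell al p be q x y <= 1/2.
Proof. by rewrite /ell ge_min phi_le. Qed.

Lemma ell_eqm al p be q x y x' y' : eqm x x' -> eqm y y' ->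
  ell al p be q x y = ell al p be q x' y'.
Proof.
move=> xx yy; congr (Num.min _ _); apply: phi_eqm; apply: eqmD; try apply: eqmN; exact: eqmMz.
Qed.

Lemma ellN al p be q x y : ell al p be q (- x) (- y) = ell al p be q x y.
Proof.
by congr (Num.min _ _); rewrite -[RHS]phiN; congr phi; ring.
Qed.

(** The two linear forms in [ell] are the coordinates a and b multiplied by the determinant; its
    sign is invisible to the even function [phi]. *)
Lemma ell_comb al p be q a b : al * q - be * p = 1 \/ al * q - be * p = -1 ->
  ell al p be q (a * al%:~R + b * (al + be)%:~R) (a * p%:~R + b * (p + q)%:~R) =
  Num.min (phi a) (phi b).
Proof.
move=> D.
have D' : al%:~R * q%:~R - be%:~R * p%:~R = 1 :> R \/ al%:~R * q%:~R - be%:~R * p%:~R = -1 :> R.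
  by case: D => D; [left|right]; rewrite -!rmorphM -rmorphB D ?rmorphN.
rewrite /ell; congr (Num.min _ _).
  have -> : (p + q)%:~R * (a * al%:~R + b * (al + be)%:~R) -
     (al + be)%:~R * (a * p%:~R + b * (p + q)%:~R) =
     a * (al%:~R * q%:~R - be%:~R * p%:~R) by ring.
  by case: D' => ->; rewrite ?mulr1 ?mulrN1 ?phiN.
have -> : al%:~R * (a * p%:~R + b * (p + q)%:~R) - p%:~R * (a * al%:~R + b * (al + be)%:~R) =
   b * (al%:~R * q%:~R - be%:~R * p%:~R) by ring.
by case: D' => ->; rewrite ?mulr1 ?mulrN1 ?phiN.
Qed.

End PhiMin.

Section Layer.
Context (R : realType) (n : nat) (ps : seq pairing) (X Y : face) (al p be q : int).
Context (r x y : point_of_tets R -> R).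
Hypotheses (p0 : 0 < p) (q0 : 0 < q).
Hypothesis D : al * q - be * p = 1 \/ al * q - be * p = -1.
Hypothesis M : solid_model n ps X Y al p be q r x y.
Local Notation pt := (point_of_tets R).

Let F : face := (n, (v2, v0, v1)).
Let G : face := (n, (v1, v3, v2)).
Let ps' : seq pairing := ps ++ [:: (X, F); (Y, G)].

Let el u := ell al p be q (x u) (y u).
(* Layering reverses the orientation convention of [solid_model], hence the signs of the old
   coordinates. *)
Definition layer_r (u : pt) : R :=
  if (u.1 < n)%N then r u * (1 - el u) else 1 - phi (Num.min (bc u v1) (bc u v2)).
(** The new vertices 0, 1, 2, 3 sit over the lattice points 0, (al,p), (al+be,p+q) and the sum of
    the last two, so edge 12 has direction (be,q). The two sums of barycentric coordinates are the
    coordinates in that basis, constant along the fibres. The depth in [layer_r] vanishes on the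
    faces opposite 1 and 2, the new boundary. *)
Definition layer_x (u : pt) : R :=
  if (u.1 < n)%N then - x u
  else (bc u v1 + bc u v3) * al%:~R + (bc u v2 + bc u v3) * (al + be)%:~R.
Definition layer_y (u : pt) : R :=
  if (u.1 < n)%N then - y u
  else (bc u v1 + bc u v3) * p%:~R + (bc u v2 + bc u v3) * (p + q)%:~R.
Local Notation r' := layer_r.
Local Notation x' := layer_x.
Local Notation y' := layer_y.

Lemma layer_ell_new u : u.1 = n -> ell al p be q (x' u) (y' u) =
  Num.min (phi (bc u v1 + bc u v3)) (phi (bc u v2 + bc u v3)).
Proof. by move=> un; rewrite /layer_x /layer_y un ltnn ell_comb. Qed.

Lemma layer_r_new u : u.1 = n -> r' u = 1 - phi (Num.min (bc u v1) (bc u v2)).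
Proof. by rewrite /layer_r => ->; rewrite ltnn. Qed.

Lemma layer_r_new_eq u : u.1 = n -> bc u v0 = 0 \/ bc u v3 = 0 ->
  r' u = 1 - ell al p be q (x' u) (y' u).
Proof.
move=> un h; rewrite layer_ell_new // layer_r_new // (@phi_min_eq _ (bc u v0) _ _ (bc u v3)) ?bc_ge0 //.
by rewrite bc_sum.
Qed.

Lemma layer_r_new_gt u : u.1 = n -> 0 < bc u v0 -> 0 < bc u v3 ->
  1 - ell al p be q (x' u) (y' u) < r' u.
Proof.
move=> un h0 h3; rewrite layer_ell_new // layer_r_new // ltrD2l ltrN2.
by apply: (@phi_min_lt _ (bc u v0)); rewrite ?bc_ge0 // bc_sum.
Qed.

(** The factor [1 - el] depends on the two angles only and is at least 1/2, so rescaling by it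
    creates no new coincidences and keeps the core. *)
Lemma same_point_old u v : (u.1 < n)%N -> (v.1 < n)%N ->
  same_point r' x' y' u v <-> same_point r x y u v.
Proof.
move=> un vn; rewrite /same_point /layer_r /layer_x /layer_y un vn.
have ep w : 0 < 1 - el w by rewrite subr_gt0 (le_lt_trans (ell_le _ _ _ _ _ _)) //; lra.
split=> -[rE yE xE].
  have {}yE : eqm (y u) (y v) by move: (eqmN yE); rewrite !opprK.
  have [ru|ru] := eqVneq (r u) 0.
    split=> //; last by left.
    by move: rE; rewrite ru mul0r => /esym/eqP; rewrite mulf_eq0 (gt_eqF (ep v)) orbF => /eqP ->.
  case: xE => [/eqP|xE]; first by rewrite mulf_eq0 (negPf ru) (gt_eqF (ep u)).
  have {}xE : eqm (x u) (x v) by move: (eqmN xE); rewrite !opprK.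
  have ee : el u = el v by exact: ell_eqm.
  split=> //; last by right.
  by move: rE; rewrite ee => /mulIf; apply; rewrite gt_eqF.
case: xE => [ru|xE].
  by split; [rewrite -rE ru !mul0r | exact: eqmN | left; rewrite ru mul0r].
have ee : el u = el v by exact: ell_eqm.
by split; [rewrite rE ee | exact: eqmN | right; exact: eqmN].
Qed.

Lemma layer_faces_X (l0 l1 l2 : R) u v : pon_face X l0 l1 l2 u -> pon_face F l0 l1 l2 v ->
  same_point r' x' y' u v.
Proof.
move=> uX [/= vn vE]; have [ru xu yu] := model_X M uX.
have un : (u.1 < n)%N.
  by have [Xn _ _] := model_faces M; case: (X) uX Xn => t [[a b] c] [-> _].
have := vE v0; have := vE v1; have := vE v2; have := vE v3.
rewrite /= !(mulr0, mulr1, addr0, add0r) => e3 e2 e1 e0.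
have s := bc_sum v; rewrite e0 e1 e2 e3 in s.
have xE : eqm (x' u) (x' v).
  rewrite /layer_x un vn ltnn; apply: eqm_trans (eqmN xu) _.
  rewrite e1 e2 e3 (_ : l0 = 1 - l1 - l2); last by lra.
  (* The origin corner of [X] is glued to vertex 2, so the two lifts differ by the lattice point of
     that vertex. For [Y] it will be vertex 1, over (al,p). *)
  by apply: (@eqm_int _ (- (al + be))); rewrite rmorphN; ring.
have yE : eqm (y' u) (y' v).
  rewrite /layer_y un vn ltnn; apply: eqm_trans (eqmN yu) _.
  rewrite e1 e2 e3 (_ : l0 = 1 - l1 - l2); last by lra.
  by apply: (@eqm_int _ (- (p + q))); rewrite rmorphN; ring.
split=> //; last by right.
rewrite (layer_r_new_eq vn); last by right.
rewrite -(ell_eqm _ _ _ _ xE yE) /layer_x /layer_y /layer_r un.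
by rewrite ellN ru mul1r.
Qed.

Lemma layer_faces_Y (l0 l1 l2 : R) u v : pon_face Y l0 l1 l2 u -> pon_face G l0 l1 l2 v ->
  same_point r' x' y' u v.
Proof.
move=> uX [/= vn vE]; have [ru xu yu] := model_Y M uX.
have un : (u.1 < n)%N.
  by have [_ Xn _] := model_faces M; case: (Y) uX Xn => t [[a b] c] [-> _].
have := vE v0; have := vE v1; have := vE v2; have := vE v3.
rewrite /= !(mulr0, mulr1, addr0, add0r) => e3 e2 e1 e0.
have s := bc_sum v; rewrite e0 e1 e2 e3 in s.
have xE : eqm (x' u) (x' v).
  rewrite /layer_x un vn ltnn; apply: eqm_trans (eqmN xu) _.
  rewrite e1 e2 e3 (_ : l0 = 1 - l1 - l2); last by lra.
  by apply: (@eqm_int _ (- al)); rewrite rmorphN; ring.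
have yE : eqm (y' u) (y' v).
  rewrite /layer_y un vn ltnn; apply: eqm_trans (eqmN yu) _.
  rewrite e1 e2 e3 (_ : l0 = 1 - l1 - l2); last by lra.
  by apply: (@eqm_int _ (- p)); rewrite rmorphN; ring.
split=> //; last by right.
rewrite (layer_r_new_eq vn); last by left.
rewrite -(ell_eqm _ _ _ _ xE yE) /layer_x /layer_y /layer_r un.
by rewrite ellN ru mul1r.
Qed.

Lemma glued_old (u v : pt) : pglued ps u v -> (u.1 < n)%N /\ (v.1 < n)%N.
Proof.
move=> [[t [[a b] c]] [[t' [[a' b'] c']] [l0 [l1 [l2 [h [-> _] [-> _]]]]]]].
by have [_ _ /(_ _ h)] := model_faces M.
Qed.

Lemma layer_glue (u v : pt) : pglued ps' u v -> same_point r' x' y' u v.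
Proof.
move=> [F' [G' [l0 [l1 [l2 [h uF vG]]]]]]; move: h; rewrite mem_cat !inE => /or3P[h|/eqP[? ?]|/eqP[? ?]].
- have uv : pglued ps u v by exists F', G', l0, l1, l2.
  by have [un vn] := glued_old uv; apply/same_point_old => //; exact: model_glue M _ _ uv.
- by subst; exact: layer_faces_X vG.
- by subst; exact: layer_faces_Y vG.
Qed.

(** The faces opposite 0 and 3 are glued to the old boundary, so such a point can be traded for an
    old one; only points with both coordinates positive are genuinely new. *)
Lemma layer_lower (u : pt) : u.1 = n -> bc u v0 = 0 \/ bc u v3 = 0 ->
  exists v, [/\ (v.1 < n)%N, pident ps' v u & same_point r' x' y' v u].
Proof.
move=> un h; have s := bc_sum u; have [Xn Yn _] := model_faces M.
case: h => h.
  have [||||v vY] := @pon_face_exists R Y (bc u v1) (bc u v3) (bc u v2); rewrite ?bc_ge0 //.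
    by lra.
  have uG : pon_face G (bc u v1) (bc u v3) (bc u v2) u.
    by split=> //; apply: I4_ind; rewrite /= !(mulr0, mulr1, addr0, add0r).
  exists v; split; last exact: layer_faces_Y vY uG.
    by case: (Y) vY Yn => t [[a b] c] [-> _].
  by apply: pident_step vY uG; rewrite mem_cat !inE eqxx !orbT.
have [||||v vX] := @pon_face_exists R X (bc u v2) (bc u v0) (bc u v1); rewrite ?bc_ge0 //.
  by lra.
have uF : pon_face F (bc u v2) (bc u v0) (bc u v1) u.
  by split=> //; apply: I4_ind; rewrite /= !(mulr0, mulr1, addr0, add0r).
exists v; split; last exact: layer_faces_X vX uF.
  by case: (X) vX Xn => t [[a b] c] [-> _].
by apply: pident_step vX uF; rewrite mem_cat !inE eqxx !orbT.
Qed.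

Lemma layer_x_old (u : pt) : (u.1 < n)%N -> x' u = - x u.
Proof. by rewrite /layer_x => ->. Qed.

Lemma layer_y_old (u : pt) : (u.1 < n)%N -> y' u = - y u.
Proof. by rewrite /layer_y => ->. Qed.

Lemma layer_r_old_le (u : pt) : (u.1 < n)%N -> r' u <= 1 - ell al p be q (x' u) (y' u).
Proof.
move=> un; rewrite layer_x_old // layer_y_old // ellN /layer_r un.
have /andP[_ r1] := model_range M un; rewrite -[leRHS]mul1r ler_wpM2r //.
by rewrite subr_ge0 (le_trans (ell_le _ _ _ _ _ _)) //; lra.
Qed.

Lemma layer_r_new_gt0 (u : pt) : u.1 = n -> 0 < r' u.
Proof. by move=> un; rewrite layer_r_new //; have := phi_le (Num.min (bc u v1) (bc u v2)); lra. Qed.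

(** The basis matrix has an integral inverse, and congruences survive multiplication by integers.
    The determinant, being 1 or -1, is its own inverse, which treats both signs at once. *)
Lemma det_int_eqm (a a' b b' : R) :
  eqm (a * al%:~R + b * (al + be)%:~R) (a' * al%:~R + b' * (al + be)%:~R) ->
  eqm (a * p%:~R + b * (p + q)%:~R) (a' * p%:~R + b' * (p + q)%:~R) ->
  eqm a a' /\ eqm b b'.
Proof.
set x1 := a * _ + _; set x2 := a' * _ + _; set y1 := a * p%:~R + _; set y2 := a' * p%:~R + _.
move=> xE yE.
have DD : (al * q - be * p)%:~R * (al * q - be * p)%:~R = 1 :> R.
  by case: D => ->; rewrite -intrM.
have aE : (al * q - be * p)%:~R * ((p + q)%:~R * x1 + (- (al + be))%:~R * y1) = a.
  by rewrite -[RHS]mul1r -[X in _ = X * _]DD /x1 /y1; ring.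
have aE' : (al * q - be * p)%:~R * ((p + q)%:~R * x2 + (- (al + be))%:~R * y2) = a'.
  by rewrite -[RHS]mul1r -[X in _ = X * _]DD /x2 /y2; ring.
have bE : (al * q - be * p)%:~R * (al%:~R * y1 + (- p)%:~R * x1) = b.
  by rewrite -[RHS]mul1r -[X in _ = X * _]DD /x1 /y1; ring.
have bE' : (al * q - be * p)%:~R * (al%:~R * y2 + (- p)%:~R * x2) = b'.
  by rewrite -[RHS]mul1r -[X in _ = X * _]DD /x2 /y2; ring.
by split; [rewrite -aE -aE' | rewrite -bE -bE']; apply/eqmMz/eqmD; exact: eqmMz.
Qed.

Lemma det_int_ex (x0 y0 : R) : exists a b : R,
  x0 = a * al%:~R + b * (al + be)%:~R /\ y0 = a * p%:~R + b * (p + q)%:~R.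
Proof.
have DD : (al * q - be * p)%:~R * (al * q - be * p)%:~R = 1 :> R.
  by case: D => ->; rewrite -intrM.
exists ((al * q - be * p)%:~R * ((p + q)%:~R * x0 - (al + be)%:~R * y0)).
exists ((al * q - be * p)%:~R * (al%:~R * y0 - p%:~R * x0)).
by split; rewrite -[LHS]mul1r -[X in X * _ = _]DD; ring.
Qed.

(** Old points have radius at most 1 - [ell], genuinely new ones strictly more, so the two kinds
    never meet. For two new points the lattice coordinates lie strictly between 0 and 1, so
    congruence is equality; they have the same fibre, and on it the smaller of the coordinates 1 and
    2, read off from the radius, fixes the point. *)
Lemma layer_inj (u v : pt) : (u.1 < n.+1)%N -> (v.1 < n.+1)%N ->
  same_point r' x' y' u v -> pident ps' u v.
Proof.
have lower w : (w.1 < n.+1)%N ->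
    (exists w', [/\ (w'.1 < n)%N, pident ps' w' w & same_point r' x' y' w' w]) \/
    [/\ w.1 = n, 0 < bc w v0 & 0 < bc w v3].
  rewrite ltnS leq_eqVlt => /orP[/eqP wn|wn]; last first.
    left; exists w; split=> //; first exact: rst_refl.
    by split=> //; [exact: eqm_refl | right; exact: eqm_refl].
  have [h0|h0] := eqVneq (bc w v0) 0; first by left; apply: layer_lower; auto.
  have [h3|h3] := eqVneq (bc w v3) 0; first by left; apply: layer_lower; auto.
  by right; split=> //; rewrite lt_neqAle eq_sym ?h0 ?h3 bc_ge0.
have old_upper w w' : (w'.1 < n)%N -> w.1 = n -> 0 < bc w v0 -> 0 < bc w v3 ->
    same_point r' x' y' w' w -> False.
  move=> w'n wn h0 h3 [rE yE [r0|xE]]; have rw := layer_r_new_gt0 wn.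
    by move: rw; rewrite -rE r0 ltxx.
  have := layer_r_old_le w'n; rewrite (ell_eqm _ _ _ _ xE yE) rE.
  by rewrite leNgt layer_r_new_gt.
move=> un vn uv.
have [[u' [u'n uu' su]]|[un' u0 u3]] := lower u un;
  have [[v' [v'n vv' sv]]|[vn' v0' v3']] := lower v vn.
- apply: (rst_trans _ _ _ u'); first exact: rst_sym.
  apply: (rst_trans _ _ _ v'); last by [].
  apply: (@pident_sub _ ps) => [P|]; first by rewrite mem_cat => ->.
  apply: (model_inj M) => //; apply/same_point_old => //.
  apply: same_point_trans su _; apply: same_point_trans uv _; exact: same_point_sym.
- by case: (old_upper v u') => //; apply: same_point_trans su uv.
- by case: (old_upper u v') => //; apply: same_point_trans sv _; exact: same_point_sym.
have [rE yE [r0|xE]] := uv; first by have := layer_r_new_gt0 un'; rewrite r0 ltxx.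
have su := bc_sum u; have sv := bc_sum v.
have [u10 u20] := (bc_ge0 u v1, bc_ge0 u v2); have [v10 v20] := (bc_ge0 v v1, bc_ge0 v v2).
have [aE bE] : eqm (bc u v1 + bc u v3) (bc v v1 + bc v v3) /\
               eqm (bc u v2 + bc u v3) (bc v v2 + bc v v3).
  by apply: det_int_eqm; move: xE yE; rewrite /layer_x /layer_y un' vn' ltnn.
have {}aE := eqm_unit_eq _ _ _ _ aE; have {}bE := eqm_unit_eq _ _ _ _ bE.
have {}aE : bc u v1 + bc u v3 = bc v v1 + bc v v3 by apply: aE; lra.
have {}bE : bc u v2 + bc u v3 = bc v v2 + bc v v3 by apply: bE; lra.
move: rE; rewrite !layer_r_new // => /(congr1 (fun t => 1 - t)); rewrite !subKr => mE.
have {}mE : Num.min (bc u v1) (bc u v2) = Num.min (bc v v1) (bc v v2).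
  (* [phi] is injective only up to 1/2; the smaller of two numbers with sum at most 1 stays in that
     range. *)
  have min_half w : Num.min (bc w v1) (bc w v2) <= 1/2.
    have := bc_sum w; have := bc_ge0 w v0; have := bc_ge0 w v3.
    by case: (leP (bc w v1) (bc w v2)) => ? ? ? ?; lra.
  by apply: phi_inj mE; rewrite ?min_half ?le_min ?bc_ge0.
have -> : u = v; last exact: rst_refl.
have e1 : bc u v1 = bc v v1 by move: mE; case: (leP (bc u v1)) => ?; case: (leP (bc v v1)) => ?; lra.
by apply: pt_ext; [rewrite un' vn' | apply: I4_ind; lra].
Qed.

(** The radius 1 - [ell] separates the cases: below it, undoing the rescaling gives an old point;
    above it, the lattice coordinates reduced to [0,1) select a fibre of the new tetrahedron and the
    prescribed depth a point on it. *)
Lemma layer_surj (r0 x0 y0 : R) : 0 <= r0 <= 1 -> exists u : pt,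
  [/\ (u.1 < n.+1)%N, r' u = r0, eqm (y' u) y0 & r0 = 0 \/ eqm (x' u) x0].
Proof.
move=> /andP[r00 r01]; pose e := ell al p be q x0 y0.
have e1 : e <= 1/2 by exact: ell_le.
have [re|re] := leP r0 (1 - e).
  have h : 0 <= r0 / (1 - e) <= 1 by rewrite divr_ge0 ?ler_pdivrMr ?mul1r ?re //; lra.
  have [u [un ru yu xu]] := model_surj M (- x0) (- y0) h.
  exists u; rewrite /layer_r un layer_x_old // layer_y_old //.
  have ey : eqm (- y u) y0 by rewrite -(opprK y0); exact: eqmN.
  case: xu => [r0'|xu].
    have r0'' : r0 = 0.
      by apply/eqP; move/eqP: r0'; rewrite mulf_eq0 invr_eq0 => /orP[//|/eqP]; lra.
    by split=> //; [exact: ltnW | rewrite ru r0' mul0r r0'' | left].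
  split=> //; [exact: ltnW | | by right; rewrite -(opprK x0); exact: eqmN].
  rewrite ru /el (ell_eqm _ _ _ _ xu yu) ellN -/e divfK //; lra.
have [a0 [b0 [xE yE]]] := det_int_ex x0 y0.
pose a := a0 - (Num.floor a0)%:~R; pose b := b0 - (Num.floor b0)%:~R.
have a_0 : 0 <= a by rewrite subr_ge0 ge_floor // num_real.
have b_0 : 0 <= b by rewrite subr_ge0 ge_floor // num_real.
have a_1 : a < 1 by have := floorD1_gt a0; rewrite /a intrD; lra.
have b_1 : b < 1 by have := floorD1_gt b0; rewrite /b intrD; lra.
have xE' : eqm (a * al%:~R + b * (al + be)%:~R) x0.
  apply: (@eqm_int _ (- (Num.floor a0 * al + Num.floor b0 * (al + be)))).
  by rewrite xE /a /b; ring.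
have yE' : eqm (a * p%:~R + b * (p + q)%:~R) y0.
  apply: (@eqm_int _ (- (Num.floor a0 * p + Num.floor b0 * (p + q)))).
  by rewrite yE /a /b; ring.
have eE : e = Num.min (phi a) (phi b) by rewrite /e -(ell_eqm _ _ _ _ xE' yE') ell_comb.
have [||s [s0 s1 sE]] := @phi_surj R (1 - r0); [lra|lra|].
have : phi s < e by lra.
rewrite eE lt_min => /andP[sa sb].
have bound c : 0 <= c -> c < 1 -> phi s < phi c -> s <= c /\ s <= 1 - c.
  move=> c0 c1 sc; split; rewrite leNgt; apply/negP => cs.
    by move: sc; rewrite ltNge phi_le_sym //; lra.
  by move: sc; rewrite ltNge -(phi_1B c) phi_le_sym //; lra.
have [sa1 sa2] := bound a a_0 a_1 sa; have [sb1 sb2] := bound b b_0 b_1 sb.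
(* The one of the coordinates 1, 2 that belongs to the smaller of a, b must equal s, which
   determines the other three. They are nonnegative since a and b lie in [s, 1 - s]. *)
have [u [un u1 u2 u3 um]] : exists u : pt, [/\ u.1 = n, bc u v1 = a - bc u v3, bc u v2 = b - bc u v3, bc u v3 = Num.min a b - s &
    Num.min (bc u v1) (bc u v2) = s].
  case: (leP a b) => ab.
    have [|||||u [un u0 u1 u2 u3]] := @pt_exists4 R n (1 - b - s) s (s + (b - a)) (a - s); try lra.
    by exists u; rewrite u1 u2 u3; split; rewrite ?min_l //; lra.
  have [|||||u [un u0 u1 u2 u3]] := @pt_exists4 R n (1 - a - s) (s + (a - b)) s (b - s); try lra.
  by exists u; rewrite u1 u2 u3; split; rewrite ?min_r //; lra.
exists u; split; first by rewrite un.
- by rewrite layer_r_new // um sE; lra.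
- by rewrite /layer_y un ltnn u1 u2 !subrK.
- by right; rewrite /layer_x un ltnn u1 u2 !subrK.
Qed.

End Layer.

Section LayerModel.
Context (R : realType) (n : nat) (ps : seq pairing) (X Y : face) (al p be q : int).
Context (r x y : point_of_tets R -> R).
Hypotheses (p0 : 0 < p) (q0 : 0 < q).
Hypothesis D : al * q - be * p = 1 \/ al * q - be * p = -1.
Hypothesis M : solid_model n ps X Y al p be q r x y.
Local Notation pt := (point_of_tets R).

Local Notation r' := (layer_r n al p be q r x y).
Local Notation x' := (layer_x n al be x).
Local Notation y' := (layer_y n p q y).

(** [ell] may jump at the core, where [x] is undefined, but it is bounded and multiplied by [r].
    Away from the core it is continuous because its linear forms have integral coefficients. *)
Lemma layer_cont_old t : (t < n)%N -> polar_continuous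
  (fun s => r' (t, s)) (fun s => x' (t, s)) (fun s => y' (t, s)).
Proof.
move=> tn; have pc := model_cont M tn.
pose rt s := r (t, s); pose xt s := x (t, s); pose yt s := y (t, s).
pose et s := 1 - ell al p be q (xt s) (yt s).
have et1 s : `|et s| <= 1.
  rewrite ger0_norm /et; last by have := ell_le al p be q (xt s) (yt s); lra.
  by have := ell_ge0 al p be q (xt s) (yt s); lra.
have cet s : rt s != 0 -> {for s, continuous et}.
  have phic (f : set_type (simplex3 R) -> R) : turn_continuous f s ->
      {for s, continuous (fun w => phi (f w))}.
    move=> [fc _]; apply: continuousM; last exact: cst_continuous.
    by apply: continuousB => //; exact: cst_continuous.
  move=> rs; apply: continuousB; first exact: cst_continuous.
  apply: continuous_min; apply: phic.
    have := polar_combination (p + q) (- (al + be)) pc rs.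
    rewrite (_ : (fun w => _) = (fun s0 => (p + q)%:~R * xt s0 - (al + be)%:~R * yt s0)) //.
    by apply/funext => w; rewrite rmorphN mulNr.
  have := polar_combination (- p) al pc rs.
  rewrite (_ : (fun w => _) = (fun s0 => al%:~R * yt s0 - p%:~R * xt s0)) //.
  by apply/funext => w; rewrite rmorphN mulNr addrC.
have rE s : r' (t, s) = rt s * et s by rewrite /layer_r /= tn.
have xE s : x' (t, s) = - xt s by rewrite /layer_x /= tn.
have yE s : y' (t, s) = - yt s by rewrite /layer_y /= tn.
have [cr _ _ cy] := pc.
have bnd g s : (forall w, `|g w| <= 1) -> (rt s != 0 -> {for s, continuous g}) ->
    {for s, continuous (fun w => rt w * (et w * g w))}.
  move=> g1 cg; apply: (@continuous_fun_norm_bounded _ _ _ _ _ 1) => [w||rs].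
  - by rewrite normrM -[leRHS]mulr1 ler_pM.
  - exact: cr.
  - by apply: continuousM; [exact: cet | exact: cg].
split.
- move=> s; rewrite (_ : (fun w => _) = fun w => rt w * et w); last by apply/funext => w; rewrite rE.
  by apply: (@continuous_fun_norm_bounded _ _ _ _ _ 1) => //; [exact: cr | exact: cet].
- move=> s; rewrite (_ : (fun w => _) = fun w => rt w * (et w * cosT (xt w))).
    apply: bnd => [w|rs]; first exact: cos_max.
    by have [] := polar_turn_continuous pc rs.
  by apply/funext => w; rewrite rE xE cosTN mulrA.
- move=> s; rewrite (_ : (fun w => _) = fun w => rt w * (et w * - sinT (xt w))).
    apply: bnd => [w|rs]; first by rewrite normrN; exact: sin_max.
    by apply: continuousN; have [] := polar_turn_continuous pc rs.
  by apply/funext => w; rewrite rE xE sinTN mulrA.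
- move=> s; rewrite (_ : (fun w => _) = fun w => - yt w); last by apply/funext => w; rewrite yE.
  by apply: turn_continuousN; exact: cy.
Qed.

Lemma layer_cont_new : polar_continuous
  (fun s => r' (n, s)) (fun s => x' (n, s)) (fun s => y' (n, s)).
Proof.
have cb j : continuous (fun s => bc (n, s) j : R) by exact: continuous_coord.
have ct (f : set_type (simplex3 R) -> R) s : {for s, continuous f} -> turn_continuous f s.
  by move=> cf; split; [exact: continuous_cosT | exact: continuous_sinT].
have clin (c d : R) : continuous (fun s => (bc (n, s) v1 + bc (n, s) v3) * c +
    (bc (n, s) v2 + bc (n, s) v3) * d).
  have cab i j : continuous (fun s : set_type (simplex3 R) => bc (n, s) i + bc (n, s) j : R).
    by move=> s; exact: (cvgD (cb i s) (cb j s)).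
  by move=> s; exact: (cvgD (cvgM (cab _ _ s) (cvg_cst c)) (cvgM (cab _ _ s) (cvg_cst d))).
have cx s : turn_continuous (fun s => x' (n, s)) s.
  rewrite (_ : (fun w => _) = fun s => (bc (n, s) v1 + bc (n, s) v3) * al%:~R +
    (bc (n, s) v2 + bc (n, s) v3) * (al + be)%:~R); first by apply: ct; exact: clin.
  by apply/funext => w; rewrite /layer_x /= ltnn.
have cy s : turn_continuous (fun s => y' (n, s)) s.
  rewrite (_ : (fun w => _) = fun s => (bc (n, s) v1 + bc (n, s) v3) * p%:~R +
    (bc (n, s) v2 + bc (n, s) v3) * (p + q)%:~R); first by apply: ct; exact: clin.
  by apply/funext => w; rewrite /layer_y /= ltnn.
have cr : continuous (fun s => r' (n, s)).
  rewrite (_ : (fun w => _) = fun s => 1 - phi (Num.min (bc (n, s) v1) (bc (n, s) v2))); last first.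
    by apply/funext => w; rewrite /layer_r /= ltnn.
  have cp s : {for s, continuous (fun s : set_type (simplex3 R) => phi (Num.min (bc (n, s) v1) (bc (n, s) v2)))}.
    apply: continuousM; last exact: cst_continuous.
    apply: continuousB; first exact: cst_continuous.
    apply: (@continuous_cosT _ _ (fun s : set_type (simplex3 R) => Num.min (bc (n, s) v1) (bc (n, s) v2))).
    exact: (@continuous_min _ _ (fun s => bc (n, s) v1) (fun s => bc (n, s) v2) s (cb v1 s) (cb v2 s)).
  by move=> s; exact: (cvgB (cvg_cst _) (cp s)).
by split=> // s; have [cc cs] := cx s; [exact: (cvgM (cr s) cc) | exact: (cvgM (cr s) cs)].
Qed.

Lemma layer_X (l0 l1 l2 : R) (u : pt) : pon_face (n, (v0, v3, v2)) l0 l1 l2 u ->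
  [/\ r' u = 1, eqm (x' u) (l2 * (al + be)%:~R + l1 * (al + (al + be))%:~R) &
      eqm (y' u) (l2 * (p + q)%:~R + l1 * (p + (p + q))%:~R)].
Proof.
move=> [/= un uE]; have := uE v1; have := uE v2; have := uE v3.
rewrite /= !(mulr0, mulr1, addr0, add0r) => e3 e2 e1.
have u2 := bc_ge0 u v2; rewrite e2 in u2.
split.
- by rewrite layer_r_new // e1 e2 min_l // phi0 subr0.
- rewrite /layer_x un ltnn e1 e2 e3 add0r; apply: (@eqm_int _ 0).
  by ring.
- rewrite /layer_y un ltnn e1 e2 e3 add0r; apply: (@eqm_int _ 0).
  by ring.
Qed.

Lemma layer_Y (l0 l1 l2 : R) (u : pt) : pon_face (n, (v3, v0, v1)) l0 l1 l2 u ->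
  [/\ r' u = 1, eqm (x' u) (- (l2 * (al + be)%:~R + l1 * (al + (al + be))%:~R)) &
      eqm (y' u) (- (l2 * (p + q)%:~R + l1 * (p + (p + q))%:~R))].
Proof.
move=> [/= un uE]; have := uE v0; have := uE v1; have := uE v2; have := uE v3.
rewrite /= !(mulr0, mulr1, addr0, add0r) => e3 e2 e1 e0.
have s := bc_sum u; rewrite e0 e1 e2 e3 in s.
have u1 := bc_ge0 u v1; rewrite e1 in u1.
have s' : l0 = 1 - l1 - l2 by lra.
split.
- by rewrite layer_r_new // e1 e2 min_r // phi0 subr0.
- rewrite /layer_x un ltnn e1 e2 e3 s'; apply: (@eqm_int _ (al + (al + be))).
  by ring.
- rewrite /layer_y un ltnn e1 e2 e3 s'; apply: (@eqm_int _ (p + (p + q))).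
  by ring.
Qed.

Lemma layer_vertex (u : pt) j : (u.1 < n.+1)%N -> bc u j = 1 -> r' u = 1.
Proof.
move=> un uj; have [un'|nu] := ltnP u.1 n; last first.
  rewrite layer_r_new; last by apply/eqP; rewrite eqn_leq nu -ltnS un.
  have -> : Num.min (bc u v1) (bc u v2) = 0; last by rewrite phi0 subr0.
  have s := bc_sum u; have h0 := bc_ge0 u v0; have h1 := bc_ge0 u v1.
  have h2 := bc_ge0 u v2; have h3 := bc_ge0 u v3.
  by move: j uj; apply: I4_ind => uj; case: (leP (bc u v1) (bc u v2)) => ?; lra.
(* Any edge ending at the vertex shows that both angles are integral there, and [ell] vanishes at
   the origin. *)
have [i ij] : exists i, i != j.
  by have [->|j0] := eqVneq j v0; [exists v1 | exists v0; rewrite eq_sym].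
have [d1 [d2 [_ _ /(_ u erefl)]]] := model_edge M un' ij.
have ui : bc u i = 0.
  have s := bc_sum u; have h0 := bc_ge0 u v0; have h1 := bc_ge0 u v1.
  have h2 := bc_ge0 u v2; have h3 := bc_ge0 u v3.
  by move: j i ij uj; apply: I4_ind; apply: I4_ind => // _ uj; lra.
rewrite ui uj add0r !mul1r => /(_ erefl)[xu yu].
have x0 : eqm (x u) 0 by apply: eqm_trans xu _; rewrite /eqm subr0 intr_int.
have y0 : eqm (y u) 0 by apply: eqm_trans yu _; rewrite /eqm subr0 intr_int.
rewrite /layer_r un' (model_vertex M un' uj) mul1r (ell_eqm _ _ _ _ x0 y0).
by rewrite /ell !mulr0 !subr0 phi0 minxx subr0.
Qed.

(** Only the q-edge gets buried: (be,q) is the difference of (al+be,p+q) and (al,p), so both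
    arguments of [phi] along it are the edge parameter up to sign, and the depth is positive inside.
    The other two slopes remain boundary slopes. The signs follow the negated old coordinates. *)
Lemma layer_edge_old t a b : (t < n)%N -> a != b ->
  edge_model al p (al + be) (p + q) r' x' y' t a b.
Proof.
move=> tn ab; have [d1 [d2 [d20 h1 h2]]] := model_edge M tn ab.
exists (- d1), (- d2); split; first by rewrite oppr_eq0.
  case: h1 => [h1|h1]; last first.
    right=> u ut uab ua ub; rewrite /layer_r ut tn.
    have un : (u.1 < n)%N by rewrite ut.
    have /andP[r0 _] := model_range M un; have r1 := h1 u ut uab ua ub.
    apply: le_lt_trans r1; rewrite -[leRHS]mulr1 ler_wpM2l //.
    by have := ell_ge0 al p be q (x u) (y u); lra.
  have interior : (d1, d2) = (be, q) \/ (d1, d2) = (- be, - q) ->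
      forall u, u.1 = t -> bc u a + bc u b = 1 -> 0 < bc u a -> 0 < bc u b -> r' u < 1.
    move=> dE u ut uab ua ub; rewrite /layer_r ut tn.
    have un : (u.1 < n)%N by rewrite ut.
    have /andP[r0 r1] := model_range M un.
    have [xu yu] := h2 u ut uab.
    suff : 0 < ell al p be q (x u) (y u) by nra.
    pose s := bc u b.
    have s0 : phi 0 < phi s by apply: phi_lt_sym; rewrite /s; lra.
    have eE : ell al p be q (x u) (y u) = phi s.
      rewrite (ell_eqm _ _ _ _ xu yu) -/s.
      case: dE => -[-> ->].
        have := @ell_comb R al p be q (- s) s D.
        rewrite (_ : - s * _ + _ = s * be%:~R); last by ring.
        rewrite (_ : - s * _ + _ = s * q%:~R); last by ring.
        by rewrite phiN minxx.
      have := @ell_comb R al p be q s (- s) D.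
      rewrite (_ : s * _ + _ = s * (- be)%:~R); last by ring.
      rewrite (_ : s * _ + _ = s * (- q)%:~R); last by ring.
      by rewrite phiN minxx.
    by rewrite eE -phi0.
  move: h1; rewrite !inE => /orP[|/orP[|/orP[|/orP[|/orP[]]]]] /eqP dE.
  - by left; move: dE => [-> ->]; rewrite eqxx ?orbT.
  - by right; apply: interior; left.
  - by left; move: dE => [-> ->]; rewrite eqxx ?orbT.
  - by left; move: dE => [-> ->]; rewrite !opprK eqxx ?orbT.
  - by right; apply: interior; right.
  - by left; move: dE => [-> ->]; rewrite !opprK eqxx ?orbT.
move=> u ut uab; have [xu yu] := h2 u ut uab.
have un : (u.1 < n)%N by rewrite ut.
by rewrite layer_x_old // layer_y_old // !rmorphN !mulrN; split; exact: eqmN.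
Qed.

Lemma layer_edge_new a b : a != b -> edge_model al p (al + be) (p + q) r' x' y' n a b.
Proof.
(* (k1,k2) is the lattice point under the starting vertex. The exceptional edge 12 is the one lying
   on the buried q-edge, with positive depth in its interior. *)
have lin (a' b' : 'I_4) (d1 d2 k1 k2 : int) : d2 != 0 ->
  (d1, d2) \in [:: (al, p); (al + be, p + q); (al + (al + be), p + (p + q))] \/
  (a', b') = (v1, v2) ->
  (forall u : pt, bc u a' + bc u b' = 1 ->
    (bc u v1 + bc u v3) * al%:~R + (bc u v2 + bc u v3) * (al + be)%:~R = bc u b' * d1%:~R + k1%:~R /\
    (bc u v1 + bc u v3) * p%:~R + (bc u v2 + bc u v3) * (p + q)%:~R = bc u b' * d2%:~R + k2%:~R) ->
  edge_model al p (al + be) (p + q) r' x' y' n a' b'.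
  move=> d20 h1 h2; exists d1, d2; split=> //.
    case: h1 => [h1|[-> ->]]; [left|right].
      by move: h1; rewrite !inE => /orP[|/orP[]] ->; rewrite ?orbT.
    move=> u un _ u1 u2; rewrite layer_r_new //.
    have m0 : 0 < Num.min (bc u v1) (bc u v2) by rewrite lt_min u1.
    have m1 : Num.min (bc u v1) (bc u v2) < 1 - 0.
      have s := bc_sum u; have := bc_ge0 u v0; have := bc_ge0 u v3.
      by case: (leP (bc u v1) (bc u v2)) => ? ? ?; lra.
    by have := phi_lt_sym (lexx 0) m0 m1; rewrite phi0; lra.
  move=> u un uab; rewrite /layer_x /layer_y un ltnn; have [-> ->] := h2 u uab.
  by split; [apply: (@eqm_int _ k1) | apply: (@eqm_int _ k2)].
have z (u : pt) : [/\ 0 <= bc u v0, 0 <= bc u v1, 0 <= bc u v2 & 0 <= bc u v3].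
  by rewrite !bc_ge0.
have e01 : edge_model al p (al + be) (p + q) r' x' y' n v0 v1.
  apply: (lin _ _ al p 0 0); [lia | by left; rewrite !inE eqxx ?orbT |].
  move=> u uab; have s := bc_sum u; have [z0 z1 z2 z3] := z u.
  have -> : bc u v2 = 0 by lra.
  have -> : bc u v3 = 0 by lra.
  by split; ring.
have e02 : edge_model al p (al + be) (p + q) r' x' y' n v0 v2.
  apply: (lin _ _ (al + be) (p + q) 0 0); [lia | by left; rewrite !inE eqxx ?orbT |].
  move=> u uab; have s := bc_sum u; have [z0 z1 z2 z3] := z u.
  have -> : bc u v1 = 0 by lra.
  have -> : bc u v3 = 0 by lra.
  by split; ring.
have e03 : edge_model al p (al + be) (p + q) r' x' y' n v0 v3.
  apply: (lin _ _ (al + (al + be)) (p + (p + q)) 0 0); [lia | by left; rewrite !inE eqxx ?orbT |].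
  move=> u uab; have s := bc_sum u; have [z0 z1 z2 z3] := z u.
  have -> : bc u v1 = 0 by lra.
  have -> : bc u v2 = 0 by lra.
  by split; ring.
have e12 : edge_model al p (al + be) (p + q) r' x' y' n v1 v2.
  apply: (lin _ _ be q al p); [lia | by right |].
  move=> u uab; have s := bc_sum u; have [z0 z1 z2 z3] := z u.
  have -> : bc u v1 = 1 - bc u v2 by lra.
  have -> : bc u v3 = 0 by lra.
  by split; ring.
have e13 : edge_model al p (al + be) (p + q) r' x' y' n v1 v3.
  apply: (lin _ _ (al + be) (p + q) al p); [lia | by left; rewrite !inE eqxx ?orbT |].
  move=> u uab; have s := bc_sum u; have [z0 z1 z2 z3] := z u.
  have -> : bc u v1 = 1 - bc u v3 by lra.
  have -> : bc u v2 = 0 by lra.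
  by split; ring.
have e23 : edge_model al p (al + be) (p + q) r' x' y' n v2 v3.
  apply: (lin _ _ al p (al + be) (p + q)); [lia | by left; rewrite !inE eqxx ?orbT |].
  move=> u uab; have s := bc_sum u; have [z0 z1 z2 z3] := z u.
  have -> : bc u v2 = 1 - bc u v3 by lra.
  have -> : bc u v1 = 0 by lra.
  by split; ring.
by move: a b; apply: I4_ind; apply: I4_ind => // _; apply: edge_model_sym.
Qed.

Lemma layer_model : has_model R (layer (Solid n ps X Y)) al p (al + be) (p + q).
Proof.
have [Xn Yn psn] := model_faces M.
exists r', x', y'; split=> /=.
- move=> t; rewrite ltnS leq_eqVlt => /orP[/eqP ->|]; [exact: layer_cont_new | exact: layer_cont_old].
- move=> u; rewrite ltnS leq_eqVlt => /orP[/eqP un|un]; last first.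
    have := model_range M un; have := ell_ge0 al p be q (x u) (y u).
    by have := ell_le al p be q (x u) (y u); rewrite /layer_r un => ? ? /andP[? ?]; apply/andP; split; nra.
  rewrite layer_r_new //; have := phi_ge0 (Num.min (bc u v1) (bc u v2)).
  by have := phi_le (Num.min (bc u v1) (bc u v2)) => ? ?; apply/andP; split; lra.
- split=> // P; rewrite mem_cat => /orP[/psn[h1 h2]|]; first by split; exact: ltnW.
  by rewrite !inE => /orP[] /eqP -> /=; split=> //; exact: ltnW.
- exact: layer_glue.
- exact: layer_inj.
- move=> r0 x0 y0; exact: (layer_surj D M).
- exact: layer_X.
- exact: layer_Y.
- exact: layer_vertex.
- move=> t a b; rewrite ltnS leq_eqVlt => /orP[/eqP ->|]; [exact: layer_edge_new | exact: layer_edge_old].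
Qed.

End LayerModel.

(** * The solid torus LST(1,2) *)

Section SwapModel.
Context (R : realType).
Local Notation pt := (point_of_tets R).

Lemma pon_face_swap01 F (l0 l1 l2 : R) (u : pt) :
  pon_face (swap01 F) l0 l1 l2 u -> pon_face F l1 l0 l2 u.
Proof.
by case: F => t [[a b] c] [ut uE]; split=> // j; rewrite uE; congr (_ + _); rewrite addrC.
Qed.

Lemma pon_face_sum F (l0 l1 l2 : R) (u : pt) : pon_face F l0 l1 l2 u -> l0 + l1 + l2 = 1.
Proof.
case: F => t [[a b] c] [ut uE]; rewrite -(bc_sum u) !uE.
pose S (i : 'I_4) : R := (@Ordinal 4 0 isT == i)%:R + (@Ordinal 4 1 isT == i)%:R +
  (@Ordinal 4 2 isT == i)%:R + (@Ordinal 4 3 isT == i)%:R.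
have e i : S i = 1 by move: i; apply: I4_ind; rewrite /S /= ?addr0 ?add0r.
transitivity (l0 * S a + l1 * S b + l2 * S c); last by rewrite /S; ring.
by rewrite !e !mulr1.
Qed.

(** Exchanging the first two corners reverses the (p+q)-edge. The central symmetry of the torus
    reverses it back; after it the corners are off only by the lattice vector (al+be,p+q). *)
Lemma swap_model L al p be q : has_model R L al p be q -> has_model R (swap_pq L) be q al p.
Proof.
case: L => // n ps X Y [r [x [y M]]].
have sE u v : same_point r (fun w => - x w) (fun w => - y w) u v <-> same_point r x y u v.
  split=> -[rE yE xE]; split=> //.
  - by move: (eqmN yE); rewrite !opprK.
  - by case: xE => [|/eqmN]; rewrite ?opprK; auto.
  - exact: eqmN.
  - by case: xE => [|/eqmN]; auto.
exists r, (fun w => - x w), (fun w => - y w); split.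
- move=> t tn; have [cr cc cs cy] := model_cont M tn; split=> //.
  + by rewrite (_ : (fun w => _) = (fun w => r (t, w) * cosT (x (t, w)))) //; apply/funext => w; rewrite cosTN.
  + rewrite (_ : (fun w => _) = (fun w => - (r (t, w) * sinT (x (t, w))))).
      by move=> s; exact: (cvgN (cs s)).
    by apply/funext => w; rewrite sinTN mulrN.
  + by move=> s; apply: turn_continuousN.
- exact: model_range M.
- by have [Xn Yn psn] := model_faces M; split=> //; [case: (X) Xn => ? [[]] | case: (Y) Yn => ? [[]]].
- by move=> u v uv; apply/sE/(model_glue M).
- by move=> u v un vn /sE; apply: (model_inj M).
- move=> r0 x0 y0 /(model_surj M (- x0) (- y0))[u [un ru yu xu]]; exists u; split=> //.
    by rewrite -(opprK y0); exact: eqmN.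
  by case: xu => [|xu]; [left | right; rewrite -(opprK x0); exact: eqmN].
- move=> l0 l1 l2 u /pon_face_swap01 h; have [ru xu yu] := model_X M h.
  have s := pon_face_sum h; have l0E : l0 = 1 - l1 - l2 by lra.
  split=> //; [apply: eqm_trans (eqmN xu) _ | apply: eqm_trans (eqmN yu) _]; rewrite l0E.
    by apply: (@eqm_int _ (- (al + be))); ring.
  by apply: (@eqm_int _ (- (p + q))); ring.
- move=> l0 l1 l2 u /pon_face_swap01 h; have [ru xu yu] := model_Y M h.
  have s := pon_face_sum h; have l0E : l0 = 1 - l1 - l2 by lra.
  split=> //; [apply: eqm_trans (eqmN xu) _ | apply: eqm_trans (eqmN yu) _]; rewrite l0E.
    by apply: (@eqm_int _ (al + be)); ring.
  by apply: (@eqm_int _ (p + q)); ring.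
- exact: model_vertex M.
- move=> t a b tn ab; have [d1 [d2 [d20 h1 h2]]] := model_edge M tn ab.
  exists (- d1), (- d2); split; first by rewrite oppr_eq0.
    case: h1 => [h1|h1]; [left | by right].
    by move: h1; rewrite !inE (addrC be) (addrC q) => /orP[|/orP[|/orP[|/orP[|/orP[]]]]] /eqP[-> ->];
      rewrite ?opprK eqxx ?orbT.
  move=> u ut uab; have [xu yu] := h2 u ut uab.
  by rewrite !rmorphN !mulrN; split; exact: eqmN.
Qed.

End SwapModel.

(** * The perimeter of a triangle as a circle *)

Section TriangleAngle.
Context (R : realType).
Implicit Types h k : R.

(* The perimeter of a triangle with barycentric coordinates h0, h1, h2, run through at
   unit speed; vertex number i is at i/3. *)
Definition tri_turn h0 h1 h2 : R :=
  if h2 == 0 then h1 / 3 else if h0 == 0 then 1 / 3 + h2 / 3 else 2 / 3 + h0 / 3.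

Lemma tri_turn2 h0 h1 h2 : h2 = 0 -> tri_turn h0 h1 h2 = h1 / 3.
Proof. by move=> ->; rewrite /tri_turn eqxx. Qed.

Lemma tri_turn0 h0 h1 h2 : h0 = 0 -> h0 + h1 + h2 = 1 -> tri_turn h0 h1 h2 = 1 / 3 + h2 / 3.
Proof. by move=> -> s; rewrite /tri_turn; case: eqVneq => ?; rewrite ?eqxx; lra. Qed.

Lemma tri_turn1 h0 h1 h2 : h1 = 0 -> h0 + h1 + h2 = 1 ->
  eqm (tri_turn h0 h1 h2) (2 / 3 + h0 / 3).
Proof.
move=> h10 s; rewrite /tri_turn; case: eqVneq => h20.
  by apply: (@eqm_int _ (-1)); rewrite rmorphN; lra.
by case: eqVneq => h00; apply: (@eqm_int _ 0); lra.
Qed.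

Lemma tri_turn_rot h0 h1 h2 : h0 = 0 \/ h1 = 0 \/ h2 = 0 -> h0 + h1 + h2 = 1 ->
  eqm (tri_turn h0 h1 h2) (tri_turn h1 h2 h0 + 1 / 3).
Proof.
move=> h s; have s' : h1 + h2 + h0 = 1 by lra.
case: h => [h|[h|h]].
- by rewrite tri_turn0 // (tri_turn2 _ _ h); apply: (@eqm_int _ 0); lra.
- rewrite (tri_turn0 h s'); apply: eqm_trans (tri_turn1 h s) _; apply: (@eqm_int _ 0); lra.
- rewrite (tri_turn2 _ _ h); apply: eqm_sym.
  apply: eqm_trans (eqmD (tri_turn1 h s') (eqm_refl _)) _; apply: (@eqm_int _ 1); lra.
Qed.

Lemma eqm_unit_cases (t t' : R) : eqm t t' -> 0 <= t -> t <= 1 -> 0 <= t' -> t' <= 1 ->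
  t = t' \/ (t = 0 /\ t' = 1) \/ (t = 1 /\ t' = 0).
Proof.
move=> /intrP[z zE] t0 t1 t0' t1'.
have z1 : (z <= 1)%R by rewrite -(ler_int R) -zE; lra.
have z2 : (-1 <= z)%R by rewrite -(ler_int R) -zE rmorphN; lra.
have : z = 0 \/ z = 1 \/ z = -1 by lia.
by move=> [zz|[zz|zz]]; move: zE; rewrite zz ?rmorphN => zE; [left|right;right|right;left]; lra.
Qed.

(** A hat function of half-width 1/3 centred at the position of a vertex: it recovers the
    barycentric coordinate of that vertex from the perimeter parameter. It vanishes at both 0 and 1
    for the vertices 1 and 2, so the ambiguity of the parameter at vertex 0 is harmless. *)
Definition tent (c t : R) : R := Num.max 0 (1 - 3 * `|t - c|).

Lemma tentr c t h : 0 <= h -> h <= 1 -> t - c = (1 - h) / 3 -> tent c t = h.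
Proof.
move=> h0 h1 e; rewrite /tent e ger0_norm ?max_r; lra.
Qed.

Lemma tentl c t h : 0 <= h -> h <= 1 -> c - t = (1 - h) / 3 -> tent c t = h.
Proof.
by move=> h0 h1 e; rewrite /tent distrC e ger0_norm ?max_r; lra.
Qed.

Lemma tent_far c t : 1 / 3 <= `|t - c| -> tent c t = 0.
Proof. by move=> h; rewrite /tent max_l //; lra. Qed.

Lemma tri_turn_tent h0 h1 h2 : h0 = 0 \/ h1 = 0 \/ h2 = 0 ->
  0 <= h0 -> 0 <= h1 -> 0 <= h2 -> h0 + h1 + h2 = 1 ->
  exists t, [/\ eqm (tri_turn h0 h1 h2) t, 0 <= t, t <= 1,
    tent (1 / 3) t = h1 & tent (2 / 3) t = h2].
Proof.
move=> [h|[h|h]] p0 p1 p2 s.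
- exists (1 / 3 + h2 / 3); split; first by rewrite tri_turn0 //; exact: eqm_refl.
  + lra.
  + lra.
  + by apply: tentr; lra.
  + by apply: tentl; lra.
- exists (2 / 3 + h0 / 3); split; first exact: tri_turn1.
  + lra.
  + lra.
  + by rewrite h; apply: tent_far; rewrite ger0_norm; lra.
  + by apply: tentr; lra.
- exists (h1 / 3); split; first by rewrite tri_turn2 //; exact: eqm_refl.
  + lra.
  + lra.
  + by apply: tentl; lra.
  + by rewrite h; apply: tent_far; rewrite ler0_norm; lra.
Qed.

Lemma tent01 c : c = 1 / 3 \/ c = 2 / 3 -> tent c 0 = 0 /\ tent c 1 = 0.
Proof.
by move=> c0; split; apply: tent_far; [rewrite ler0_norm | rewrite ger0_norm]; case: c0 => ->; lra.
Qed.

Lemma tri_turn_inj h0 h1 h2 k0 k1 k2 :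
  h0 = 0 \/ h1 = 0 \/ h2 = 0 -> k0 = 0 \/ k1 = 0 \/ k2 = 0 ->
  0 <= h0 -> 0 <= h1 -> 0 <= h2 -> 0 <= k0 -> 0 <= k1 -> 0 <= k2 ->
  h0 + h1 + h2 = 1 -> k0 + k1 + k2 = 1 ->
  eqm (tri_turn h0 h1 h2) (tri_turn k0 k1 k2) -> [/\ h0 = k0, h1 = k1 & h2 = k2].
Proof.
move=> hz kz hp0 hp1 hp2 kp0 kp1 kp2 sh sk e.
have [t [tE t0 t1 h1E h2E]] := tri_turn_tent hz hp0 hp1 hp2 sh.
have [t' [tE' t0' t1' k1E k2E]] := tri_turn_tent kz kp0 kp1 kp2 sk.
have {}e : eqm t t' by apply: eqm_trans tE'; apply: eqm_trans e; exact: eqm_sym.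
have [c10 c11] := tent01 (or_introl (erefl (1 / 3))).
have [c20 c21] := tent01 (or_intror (erefl (2 / 3))).
have [e1 e2] : h1 = k1 /\ h2 = k2.
  rewrite -h1E -h2E -k1E -k2E.
  by case: (eqm_unit_cases e t0 t1 t0' t1') => [->|[[-> ->]|[-> ->]]]; rewrite ?c10 ?c11 ?c20 ?c21.
split=> //; rewrite e1 e2 in sh; clear - sh sk; lra.
Qed.

Lemma tri_turn_surj (t : R) : exists h0 h1 h2, [/\ [/\ 0 <= h0, 0 <= h1 & 0 <= h2],
  h0 + h1 + h2 = 1, h0 = 0 \/ h1 = 0 \/ h2 = 0 & eqm (tri_turn h0 h1 h2) t].
Proof.
pose f := t - (Num.floor t)%:~R.
have f0 : 0 <= f by rewrite subr_ge0 ge_floor // num_real.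
have f1 : f < 1 by have := floorD1_gt t; rewrite /f intrD; lra.
have ft : eqm f t by apply: (@eqm_int _ (- Num.floor t)); rewrite rmorphN.
have [a|a] := leP f (1/3).
  exists (1 - 3 * f), (3 * f), 0; split; [split; lra | lra | auto |].
  by apply: eqm_trans ft; rewrite tri_turn2 //; apply: (@eqm_int _ 0); lra.
have [b|b] := leP f (2/3).
  exists 0, (2 - 3 * f), (3 * f - 1); split; [split; lra | lra | auto |].
  by apply: eqm_trans ft; rewrite tri_turn0 //; [apply: (@eqm_int _ 0)|]; lra.
exists (3 * f - 2), 0, (3 - 3 * f); split; [split; lra | lra | auto |].
apply: eqm_trans ft; have s : 3 * f - 2 + 0 + (3 - 3 * f) = 1 by lra.
by apply: eqm_trans (tri_turn1 erefl s) _; apply: (@eqm_int _ 0); lra.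
Qed.

(** [tri_turn] jumps at vertex 0, but its cosine only sees the length of the shorter way to that
    vertex, and this is a continuous function of the coordinates. *)
Lemma cosT_tri_turn h0 h1 h2 : h0 = 0 \/ h1 = 0 \/ h2 = 0 -> h0 + h1 + h2 = 1 ->
  0 <= h0 -> 0 <= h1 -> 0 <= h2 ->
  cosT (tri_turn h0 h1 h2) = cosT ((h1 + h2 + Num.min h1 h2) / 3).
Proof.
have cos1B (t : R) : cosT (1 - t) = cosT t.
  by rewrite -cosTN; apply: cosT_eqm; apply: (@eqm_int _ (-1)); rewrite rmorphN; lra.
move=> h s hp0 hp1 hp2; case: h => [h|[h|h]].
- rewrite tri_turn0 //; case: leP => le12; last by congr cosT; lra.
  by rewrite -cos1B; congr cosT; lra.
- rewrite (cosT_eqm (tri_turn1 h s)) -cos1B; congr cosT; case: leP; lra.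
- by rewrite tri_turn2 //; congr cosT; case: leP; lra.
Qed.

End TriangleAngle.

Section BaseContinuity.
Context (R : realType) (al eps : int).
Hypothesis eps1 : eps = 1 \/ eps = -1.
Local Notation pt := (point_of_tets R).
Local Notation S := (set_type (simplex3 R)).
Implicit Types u v : pt.

(* In the prism covering LST(1,2), [mu0], [mu1], [mu2] are the barycentric coordinates in the
   triangular cross-section and [base_y] is the height, vertex number i having height i. *)
Definition mu0 u : R := bc u v0 + bc u v3.
Definition mu1 u : R := bc u v1.
Definition mu2 u : R := bc u v2.
Definition mu_min u : R := Num.min (mu0 u) (Num.min (mu1 u) (mu2 u)).
Definition base_r u : R := 1 - 3 * mu_min u.
(** Radial projection from the centre of the cross-section to its perimeter; [base_r] is the size of
    the concentric triangle through the point. At the centre the quotient is 0 by convention and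
    means nothing. *)
Definition base_h (mu : pt -> R) u : R := (mu u - mu_min u) / base_r u.
Definition base_t u : R := tri_turn (base_h mu0 u) (base_h mu1 u) (base_h mu2 u).
Definition base_y u : R := bc u v1 + 2 * bc u v2 + 3 * bc u v3.
(** The deck transformation adds 1/3 to [base_t] and 1 to [base_y], hence the integer [al] here: the
    coefficient of [base_y] is chosen for this. Vertex 1 lands over (al,1). The sign [eps] is the
    orientation, equal to the determinant 2 al - be. *)
Definition base_x u : R := eps%:~R * base_t u + (al%:~R - eps%:~R / 3) * base_y u.

Lemma mu_sum u : mu0 u + mu1 u + mu2 u = 1.
Proof. by rewrite -(bc_sum u) /mu0 /mu1 /mu2; ring. Qed.

Lemma mu_ge0 u : [/\ 0 <= mu0 u, 0 <= mu1 u & 0 <= mu2 u].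
Proof. by rewrite /mu0 /mu1 /mu2 addr_ge0 ?bc_ge0. Qed.

Lemma mu_minE u : [/\ mu_min u <= mu0 u, mu_min u <= mu1 u, mu_min u <= mu2 u &
  mu0 u = mu_min u \/ mu1 u = mu_min u \/ mu2 u = mu_min u].
Proof.
rewrite /mu_min; have [h|h] := leP (mu1 u) (mu2 u); have [k|k] := leP (mu0 u) _; split=> //; auto; lra.
Qed.

Lemma base_r_ge0 u : 0 <= base_r u.
Proof. by have [? ? ? _] := mu_minE u; have := mu_sum u; rewrite /base_r; lra. Qed.

Lemma base_r_le1 u : base_r u <= 1.
Proof.
have [? ? ?] := mu_ge0 u; have : 0 <= mu_min u by rewrite !le_min; apply/and3P; split.
by rewrite /base_r; lra.
Qed.

Lemma base_hE u : base_r u != 0 ->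
  [/\ [/\ 0 <= base_h mu0 u, 0 <= base_h mu1 u & 0 <= base_h mu2 u],
    base_h mu0 u + base_h mu1 u + base_h mu2 u = 1 &
    base_h mu0 u = 0 \/ base_h mu1 u = 0 \/ base_h mu2 u = 0].
Proof.
move=> r0; have [m0 m1 m2 mz] := mu_minE u; have s := mu_sum u; split.
- by split; rewrite divr_ge0 ?base_r_ge0 // subr_ge0.
- rewrite /base_h -!mulrDl; have -> : mu0 u - mu_min u + (mu1 u - mu_min u) + (mu2 u - mu_min u) = base_r u.
    by rewrite /base_r; lra.
  by rewrite divff.
- by case: mz => [|[]] e; [left|right; left|right; right]; rewrite /base_h e subrr mul0r.
Qed.

Lemma mu_of_h u (mu : pt -> R) : (base_r u = 0 -> mu u = mu_min u) ->
  mu u = (1 - base_r u) / 3 + base_r u * base_h mu u.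
Proof.
move=> h; rewrite /base_h; have [r0|r0] := eqVneq (base_r u) 0.
  by rewrite r0 mul0r addr0 h //; move: r0; rewrite /base_r; lra.
by rewrite [base_r u * _]mulrC divfK // /base_r; lra.
Qed.

Lemma mu_of_r0 u : base_r u = 0 -> [/\ mu0 u = mu_min u, mu1 u = mu_min u & mu2 u = mu_min u].
Proof.
by have [? ? ? _] := mu_minE u; have := mu_sum u; rewrite /base_r => ? ?; split; lra.
Qed.

Lemma mu_of_hE u :
  [/\ mu0 u = (1 - base_r u) / 3 + base_r u * base_h mu0 u,
      mu1 u = (1 - base_r u) / 3 + base_r u * base_h mu1 u &
      mu2 u = (1 - base_r u) / 3 + base_r u * base_h mu2 u].
Proof. by split; apply: mu_of_h => /mu_of_r0[]. Qed.

Lemma base_boundary u : mu0 u = 0 \/ mu1 u = 0 \/ mu2 u = 0 ->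
  base_r u = 1 /\ base_t u = tri_turn (mu0 u) (mu1 u) (mu2 u).
Proof.
move=> h; have m0 : mu_min u = 0.
  have [z0 z1 z2] := mu_ge0 u; have [m0 m1 m2 _] := mu_minE u.
  have mz : 0 <= mu_min u by rewrite !le_min; apply/and3P; split.
  by case: h => [|[]] ?; lra.
have r1 : base_r u = 1 by rewrite /base_r m0 mulr0 subr0.
by split=> //; rewrite /base_t /base_h m0 r1 !subr0 !divr1.
Qed.

Lemma base_cosT u : base_r u != 0 -> cosT (base_t u) =
  cosT ((base_h mu1 u + base_h mu2 u + Num.min (base_h mu1 u) (base_h mu2 u)) / 3).
Proof. by move=> /base_hE[[? ? ?] ? ?]; rewrite /base_t cosT_tri_turn. Qed.

Lemma base_cosTB u : base_r u != 0 -> cosT (base_t u - 1 / 3) =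
  cosT ((base_h mu2 u + base_h mu0 u + Num.min (base_h mu2 u) (base_h mu0 u)) / 3).
Proof.
move=> /base_hE[[h0 h1 h2] s z]; rewrite -(@cosT_tri_turn _ (base_h mu1 u)) //; last 2 first.
- by tauto.
- by lra.
apply: cosT_eqm; have := eqmD (tri_turn_rot z s) (eqm_refl (- (1 / 3))).
by rewrite addrK.
Qed.

Lemma base_cosTD u : base_r u != 0 -> cosT (base_t u + 1 / 3) =
  cosT ((base_h mu0 u + base_h mu1 u + Num.min (base_h mu0 u) (base_h mu1 u)) / 3).
Proof.
move=> /base_hE[[h0 h1 h2] s z]; rewrite -(@cosT_tri_turn _ (base_h mu2 u)) //; last 2 first.
- by tauto.
- by lra.
apply: cosT_eqm; apply: eqm_sym; apply: tri_turn_rot; first by tauto.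
lra.
Qed.

Lemma sinT_third : sinT (1 / 3 : R) != 0.
Proof.
rewrite gt_eqF // /sinT sin_gt0_pi //; have := @pi_gt0 R; move: (pi : R) => q q0.
by rewrite -mulr_natr; apply/andP; split; lra.
Qed.

(** The sine changes sign with the direction in which vertex 0 is left, so one distance cannot
    express it. The distances to vertices 1 and 2 do, since cos(t - 1/3) - cos(t + 1/3) = 2 sin(t)
    sin(1/3) in turns. *)
Lemma base_sinT u : base_r u != 0 -> sinT (base_t u) =
  (cosT (base_t u - 1 / 3) - cosT (base_t u + 1 / 3)) / (2 * sinT (1 / 3)).
Proof.
move=> _; have s0 := sinT_third; rewrite !cosTD sinTN cosTN.
by apply/esym/(canLR (mulfK _)); [rewrite mulf_neq0 // pnatr_eq0 | ring].
Qed.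

Let cb j : continuous (fun s : S => bc (0%N, s) j).
Proof. exact: continuous_coord. Qed.

Let cmin (f g : S -> R) : continuous f -> continuous g -> continuous (fun s => Num.min (f s) (g s)).
Proof. by move=> cf cg s; exact: (@continuous_min _ _ f g s (cf s) (cg s)). Qed.

Let cext (f g : S -> R) : f =1 g -> continuous f -> continuous g.
Proof. by move=> /funext ->. Qed.

Let cmu0 : continuous (fun s : S => mu0 (0%N, s)).
Proof. by rewrite /mu0 => s; exact: (cvgD (@cb v0 s) (@cb v3 s)). Qed.

Let cmu_min : continuous (fun s : S => mu_min (0%N, s)).
Proof. exact: (cmin cmu0 (cmin (@cb v1) (@cb v2))). Qed.

Let cr : continuous (fun s : S => base_r (0%N, s)).
Proof. by rewrite /base_r => s; exact: (cvgB (cvg_cst _) (cvgM (cvg_cst _) (@cmu_min s))). Qed.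

Let crcos (mu nu : pt -> R) : continuous (fun s : S => mu (0%N, s)) ->
  continuous (fun s : S => nu (0%N, s)) ->
  continuous (fun s : S => base_r (0%N, s) *
    cosT ((base_h mu (0%N, s) + base_h nu (0%N, s) + Num.min (base_h mu (0%N, s)) (base_h nu (0%N, s))) / 3)).
Proof.
move=> cm cn s.
pose g (w : S) := cosT ((base_h mu (0%N, w) + base_h nu (0%N, w) +
  Num.min (base_h mu (0%N, w)) (base_h nu (0%N, w))) / 3).
apply: (@continuous_fun_norm_bounded _ _ (fun w : S => base_r (0%N, w)) g s 1) => [w||r0].
- exact: cos_max.
- exact: cr.
have ch (f : pt -> R) : continuous (fun s : S => f (0%N, s)) -> {for s, continuous (fun s : S => base_h f (0%N, s))}.
  move=> cf; apply: continuousM; first exact: (cvgB (cf s) (@cmu_min s)).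
  by apply: continuousV => //; exact: cr.
apply: continuous_cosT; apply: continuousM; last exact: cst_continuous.
apply: (cvgD (cvgD (ch _ cm) (ch _ cn))).
exact: (@continuous_min _ _ (fun s => base_h mu (0%N, s)) (fun s => base_h nu (0%N, s)) s (ch _ cm) (ch _ cn)).
Qed.

Let crcosT : continuous (fun s : S => base_r (0%N, s) * cosT (base_t (0%N, s))).
Proof.
have c := crcos (@cb v1 : continuous (fun s : S => mu1 (0%N, s))) (@cb v2 : continuous (fun s : S => mu2 (0%N, s))).
apply: (cext _ c) => s; have [->|r0] := eqVneq (base_r (0%N, s)) 0; first by rewrite !mul0r.
by rewrite base_cosT.
Qed.

Let crsinT : continuous (fun s : S => base_r (0%N, s) * sinT (base_t (0%N, s))).
Proof.
have c1 := crcos (@cb v2 : continuous (fun s : S => mu2 (0%N, s))) cmu0.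
have c2 := crcos cmu0 (@cb v1 : continuous (fun s : S => mu1 (0%N, s))).
have c : continuous (fun s : S =>
    (base_r (0%N, s) * cosT ((base_h mu2 (0%N, s) + base_h mu0 (0%N, s) +
      Num.min (base_h mu2 (0%N, s)) (base_h mu0 (0%N, s))) / 3) -
     base_r (0%N, s) * cosT ((base_h mu0 (0%N, s) + base_h mu1 (0%N, s) +
      Num.min (base_h mu0 (0%N, s)) (base_h mu1 (0%N, s))) / 3)) * (2 * sinT (1 / 3))^-1).
  by move=> s; exact: (cvgM (cvgB (c1 s) (c2 s)) (cvg_cst _)).
apply: (cext _ c) => s; have [->|r0] := eqVneq (base_r (0%N, s)) 0; first by rewrite !(mul0r, subrr).
by rewrite base_sinT // base_cosTB // base_cosTD // mulrA mulrBr.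
Qed.

Lemma base_cont : polar_continuous (fun s : S => base_r (0%N, s))
  (fun s => base_x (0%N, s)) (fun s => base_y (0%N, s)).
Proof.
have cy : continuous (fun s : S => base_y (0%N, s)).
  rewrite /base_y => s; exact: (cvgD (cvgD (@cb v1 s) (cvgM (cvg_cst _) (@cb v2 s))) (cvgM (cvg_cst _) (@cb v3 s))).
pose c : R := al%:~R - eps%:~R / 3.
have cc : continuous (fun s : S => c * base_y (0%N, s)).
  by move=> s; exact: (cvgM (cvg_cst _) (cy s)).
have ecos t : cosT (eps%:~R * t) = cosT t :> R.
  by case: eps1 => ->; rewrite ?mul1r // rmorphN mulN1r cosTN.
have esin t : sinT (eps%:~R * t) = eps%:~R * sinT t :> R.
  by case: eps1 => ->; rewrite ?mul1r // rmorphN !mulN1r sinTN.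
split=> //.
- rewrite (_ : (fun s => _) = (fun s : S => base_r (0%N, s) * cosT (base_t (0%N, s)) * cosT (c * base_y (0%N, s)) -
    eps%:~R * (base_r (0%N, s) * sinT (base_t (0%N, s))) * sinT (c * base_y (0%N, s)))).
    move=> s; apply: (cvgB (cvgM (@crcosT s) _) (cvgM (cvgM (cvg_cst _) (@crsinT s)) _)).
      exact: (continuous_cosT (cc s)).
    exact: (continuous_sinT (cc s)).
  by apply/funext => s; rewrite /base_x cosTD ecos esin; ring.
- rewrite (_ : (fun s => _) = (fun s : S => eps%:~R * (base_r (0%N, s) * sinT (base_t (0%N, s))) * cosT (c * base_y (0%N, s)) +
    base_r (0%N, s) * cosT (base_t (0%N, s)) * sinT (c * base_y (0%N, s)))).
    move=> s; apply: (cvgD (cvgM (cvgM (cvg_cst _) (@crsinT s)) _) (cvgM (@crcosT s) _)).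
      exact: (continuous_cosT (cc s)).
    exact: (continuous_sinT (cc s)).
  by apply/funext => s; rewrite /base_x sinTD ecos esin; ring.
- by move=> s; split; [exact: (continuous_cosT (cy s)) | exact: (continuous_sinT (cy s))].
Qed.

End BaseContinuity.

Section BaseIdentifications.
Context (R : realType) (al eps : int).
Hypothesis eps1 : eps = 1 \/ eps = -1.
Local Notation pt := (point_of_tets R).
Implicit Types u v : pt.

Local Notation be := (2 * al - eps).
Local Notation base_x := (base_x al eps).
Let base_ps : seq pairing := [:: ((0%N, (v2, v0, v1)), (0%N, (v3, v1, v2)))].

Lemma eps_sqr : eps%:~R * eps%:~R = 1 :> R.
Proof. by case: eps1 => ->; rewrite ?rmorphN ?mulrNN mul1r. Qed.

Lemma base_h_mu (mu nu : pt -> R) u v : base_r u = base_r v -> mu u = nu v ->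
  base_h mu u = base_h nu v.
Proof.
move=> rE mE; rewrite /base_h rE mE; congr (_ / _); congr (_ - _).
by move: rE; rewrite /base_r; lra.
Qed.

(* Gluing 012 to 123 rotates the triangle and climbs by one turn of the core. *)
Lemma base_shift u v (k : int) : same_point (@base_r R) base_x (@base_y R) u v ->
  base_y v = base_y u + k%:~R -> base_r u = 0 \/ eqm (base_t v) (base_t u + k%:~R / 3).
Proof.
move=> [rE _ [|xE]] yE; [by left | right].
move: xE => /intrP[z]; rewrite /base_x yE; move: (base_t u) (base_t v) (base_y u) => tu tv Y zE.
apply: (@eqm_int _ (- (eps * z) - eps * al * k)).
have tE : tv - tu = eps%:~R * eps%:~R * (tv - tu) by rewrite eps_sqr mul1r.
have {}zE : eps%:~R * (tv - tu) = - z%:~R - (al%:~R - eps%:~R / 3) * k%:~R by rewrite -zE; ring.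
have kE : k%:~R / 3 = eps%:~R * eps%:~R * (k%:~R / 3) :> R by rewrite eps_sqr mul1r.
by apply/eqP; rewrite -subr_eq0 -addrA opprD addrA tE -mulrA zE kE; apply/eqP; ring.
Qed.

Lemma base_rot0 u v : base_r u = base_r v -> base_r u = 0 \/ eqm (base_t v) (base_t u) ->
  [/\ mu0 v = mu0 u, mu1 v = mu1 u & mu2 v = mu2 u].
Proof.
move=> rE h; have [u0 u1 u2] := mu_of_hE u; have [w0 w1 w2] := mu_of_hE v.
have [r0|r0] := eqVneq (base_r u) 0.
  by rewrite u0 u1 u2 w0 w1 w2 -rE r0 !mul0r.
have r0' : base_r v != 0 by rewrite -rE.
case: h => [/eqP|h]; first by rewrite (negPf r0).
have [[? ? ?] ? ?] := base_hE r0; have [[? ? ?] ? ?] := base_hE r0'.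
have [e0 e1 e2] : [/\ base_h (@mu0 R) v = base_h (@mu0 R) u, base_h (@mu1 R) v = base_h (@mu1 R) u &
  base_h (@mu2 R) v = base_h (@mu2 R) u] by apply: tri_turn_inj => //.
by rewrite u0 u1 u2 w0 w1 w2 -rE e0 e1 e2.
Qed.

Lemma base_rot1 u v : base_r u = base_r v -> base_r u = 0 \/ eqm (base_t v) (base_t u + 1 / 3) ->
  [/\ mu0 v = mu2 u, mu1 v = mu0 u & mu2 v = mu1 u].
Proof.
move=> rE h; have [u0 u1 u2] := mu_of_hE u; have [w0 w1 w2] := mu_of_hE v.
have [r0|r0] := eqVneq (base_r u) 0.
  by rewrite u0 u1 u2 w0 w1 w2 -rE r0 !mul0r.
have r0' : base_r v != 0 by rewrite -rE.
case: h => [/eqP|h]; first by rewrite (negPf r0).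
have [[? ? ?] s z] := base_hE r0; have [[? ? ?] ? ?] := base_hE r0'.
have s' : base_h (@mu2 R) u + base_h (@mu0 R) u + base_h (@mu1 R) u = 1 by clear - eps1 base_ps s; lra.
have z' : base_h (@mu2 R) u = 0 \/ base_h (@mu0 R) u = 0 \/ base_h (@mu1 R) u = 0 by tauto.
have [e0 e1 e2] : [/\ base_h (@mu0 R) v = base_h (@mu2 R) u, base_h (@mu1 R) v = base_h (@mu0 R) u &
  base_h (@mu2 R) v = base_h (@mu1 R) u].
  apply: tri_turn_inj => //; apply: eqm_trans h _; apply: eqm_sym; exact: tri_turn_rot.
by rewrite u0 u1 u2 w0 w1 w2 -rE e0 e1 e2.
Qed.

Lemma base_glue u v : pglued base_ps u v -> same_point (@base_r R) base_x (@base_y R) u v.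
Proof.
move=> [F [G [l0 [l1 [l2 [h uF vG]]]]]]; move: h uF vG; rewrite inE => /eqP[-> ->] [_ uE] [_ vE].
have := uE v0; have := uE v1; have := uE v2; have := uE v3.
rewrite /= !(mulr0, mulr1, addr0, add0r) => u3 u2 u1 u0.
have := vE v0; have := vE v1; have := vE v2; have := vE v3.
rewrite /= !(mulr0, mulr1, addr0, add0r) => w3 w2 w1 w0.
have s := bc_sum u; rewrite u0 u1 u2 u3 in s.
have m0 : mu0 v = mu2 u by rewrite /mu0 /mu2 w0 w3 u2 add0r.
have m1 : mu1 v = mu0 u by rewrite /mu1 /mu0 w1 u0 u3 addr0.
have m2 : mu2 v = mu1 u by rewrite /mu1 /mu2 w2 u1.
have rE : base_r u = base_r v.
  by rewrite /base_r /mu_min m0 m1 m2 [Num.min (mu2 u) _]minC minA.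
have yE : base_y v = base_y u + 1.
  by rewrite /base_y u1 u2 u3 w1 w2 w3; lra.
split=> //; first by rewrite yE; apply: (@eqm_int _ (-1)); rewrite rmorphN; ring.
have [r0|r0] := eqVneq (base_r u) 0; [by left | right].
have [_ hs hz] := base_hE r0.
have tE : eqm (base_t v) (base_t u + 1 / 3).
  rewrite /base_t !(base_h_mu (esym rE) m0, base_h_mu (esym rE) m1, base_h_mu (esym rE) m2).
  apply: tri_turn_rot; first by tauto.
  by clear - eps1 base_ps hs; lra.
have := eqmD (eqmMz eps tE) (eqm_refl ((al%:~R - eps%:~R / 3) * base_y v)).
move=> e; apply: eqm_sym; apply: eqm_trans e _; rewrite /base_x yE.
by apply: (@eqm_int _ al); ring.
Qed.

(** Heights in the tetrahedron lie in [0,3], so after ordering the points their heights differ by k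
    = 0, 1, 2 or 3, and the second is the first one moved by k deck transformations. Each case is a
    chain of k face gluings. *)
Lemma base_inj u v : (u.1 < 1)%N -> (v.1 < 1)%N ->
  same_point (@base_r R) base_x (@base_y R) u v -> pident base_ps u v.
Proof.
have up w w' : w.1 = 0%N -> w'.1 = 0%N -> bc w v3 = 0 -> bc w' v0 = 0 -> bc w' v1 = bc w v0 ->
    bc w' v2 = bc w v1 -> bc w' v3 = bc w v2 -> pident base_ps w w'.
  move=> wt wt' e3 e0' e1' e2' e3'.
  apply: (@pident_step _ (0%N, (v2, v0, v1)) (0%N, (v3, v1, v2)) (bc w v2) (bc w v0) (bc w v1)).
  - by rewrite inE.
  - by split=> //; apply: I4_ind; rewrite /= !(mulr0, mulr1, addr0, add0r).
  - by split=> //; apply: I4_ind; rewrite /= !(mulr0, mulr1, addr0, add0r).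
suff main (a b : pt) (k : nat) : a.1 = 0%N -> b.1 = 0%N ->
    same_point (@base_r R) base_x (@base_y R) a b -> base_y b = base_y a + k%:R -> pident base_ps a b.
  move=> un vn uv; have {}un : u.1 = 0%N by case: (u.1) un.
  have {}vn : v.1 = 0%N by case: (v.1) vn.
  have [_ /intrP[z zE] _] := uv.
  case: z zE => k zE.
    apply: rst_sym; apply: (main _ _ k) => //; first exact: same_point_sym.
    by rewrite -[k%:R]zE; ring.
  apply: (main _ _ k.+1) => //.
  by have -> : k.+1%:R = - (base_y u - base_y v); [rewrite zE NegzE rmorphN opprK | ring].
move=> an bn ab yE; have [rE _ _] := ab.
have bs := @base_shift a b (Posz k) ab yE.
have a0 := bc_ge0 a v0; have a1 := bc_ge0 a v1; have a2 := bc_ge0 a v2; have a3 := bc_ge0 a v3.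
have b0 := bc_ge0 b v0; have b1 := bc_ge0 b v1; have b2 := bc_ge0 b v2; have b3 := bc_ge0 b v3.
have sa := bc_sum a; have sb := bc_sum b.
have k3 : (k <= 3)%N.
  rewrite -(ler_nat R); move: yE; rewrite /base_y.
  by clear - eps1 base_ps a0 a1 a2 a3 b0 b1 b2 b3 sa sb; lra.
case: k k3 yE bs => [|[|[|[|//]]]] _ yE bs.
- rewrite mul0r addr0 in bs; have [m0 m1 m2] := base_rot0 rE bs.
  move: m0 m1 m2 yE; rewrite /mu0 /mu1 /mu2 /base_y => m0 m1 m2 yE.
  have -> : a = b; last exact: rst_refl.
  by apply: pt_ext; [rewrite an bn | apply: I4_ind; clear - eps1 base_ps m0 m1 m2 yE sa sb; lra].
- have [m0 m1 m2] := base_rot1 rE bs.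
  move: m0 m1 m2 yE; rewrite /mu0 /mu1 /mu2 /base_y => m0 m1 m2 yE.
  by apply: up => //; clear - eps1 base_ps m0 m1 m2 yE sa sb a3 b0; lra.
- have bs' : base_r b = 0 \/ eqm (base_t a) (base_t b + 1 / 3).
    case: bs => [r0|tE]; [by left; rewrite -rE | right].
    apply: eqm_sym; apply: eqm_trans (eqmD tE (eqm_refl _)) _.
    by apply: (@eqm_int _ 1); lra.
  have [m0 m1 m2] := base_rot1 (esym rE) bs'.
  move: m0 m1 m2 yE; rewrite /mu0 /mu1 /mu2 /base_y => m0 m1 m2 yE.
  (* The point half way in the chain is the image of [a] under one gluing; it has to lie on the edge
     12, as it is both a target and a source of the gluing. *)
  have [c [cn c0 c1 c2 c3]] : exists c : pt, [/\ c.1 = 0%N, bc c v0 = 0, bc c v1 = bc a v0,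
      bc c v2 = bc a v1 & bc c v3 = 0].
    by apply: pt_exists4 => //; clear - eps1 base_ps m0 m1 m2 yE sa sb a2 a3 b0 b1; lra.
  apply: (rst_trans _ _ _ c); apply: up => //; rewrite ?c0 ?c1 ?c2 ?c3 //;
    by clear - eps1 base_ps m0 m1 m2 yE sa sb a2 a3 b0 b1; lra.
have bs' : base_r a = 0 \/ eqm (base_t b) (base_t a).
  case: bs => [r0|tE]; [by left | right].
  by apply: eqm_trans tE _; apply: (@eqm_int _ 1); lra.
have [m0 m1 m2] := base_rot0 rE bs'.
move: m0 m1 m2 yE; rewrite /mu0 /mu1 /mu2 /base_y => m0 m1 m2 yE.
(* A height difference of 3 is possible only from vertex 0 to vertex 3; the chain passes through the
   vertices 1 and 2. *)
have [c [cn c0 c1 c2 c3]] : exists c : pt, [/\ c.1 = 0%N, bc c v0 = 0, bc c v1 = 1,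
    bc c v2 = 0 & bc c v3 = 0] by apply: pt_exists4 => //; lra.
have [d [dn d0 d1 d2 d3]] : exists d : pt, [/\ d.1 = 0%N, bc d v0 = 0, bc d v1 = 0,
    bc d v2 = 1 & bc d v3 = 0] by apply: pt_exists4 => //; lra.
have {}yE : bc b v3 = bc a v3 + 1 by clear - eps1 base_ps m0 m1 m2 yE; lra.
apply: (rst_trans _ _ _ c); last apply: (rst_trans _ _ _ d); apply: up => //;
  rewrite ?c0 ?c1 ?c2 ?c3 ?d0 ?d1 ?d2 ?d3 //;
  by clear - eps1 base_ps m0 m1 m2 yE sa sb a0 a1 a2 a3 b0 b1 b2 b3; lra.
Qed.

End BaseIdentifications.

Section BaseModel.
Context (R : realType) (al eps : int).
Hypothesis eps1 : eps = 1 \/ eps = -1.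
Local Notation pt := (point_of_tets R).
Implicit Types u v : pt.

Local Notation be := (2 * al - eps).
Local Notation base_x := (base_x al eps).

(** Over a point of the cross-section only the distribution of [mu0] between vertices 0 and 3 is
    free. The height thus runs through an interval of length 3 [mu0], and the two bounds on [z] are
    its ends. *)
Lemma base_lift (r0 h0 h1 h2 z : R) : 0 <= r0 -> r0 <= 1 -> 0 <= h0 -> 0 <= h1 -> 0 <= h2 ->
  h0 + h1 + h2 = 1 -> h0 = 0 \/ h1 = 0 \/ h2 = 0 ->
  (1 - r0) + r0 * (h1 + 2 * h2) <= z ->
  z <= 2 * (1 - r0) + r0 * (3 * h0 + h1 + 2 * h2) ->
  exists u, [/\ u.1 = 0%N, base_r u = r0, base_y u = z &
    r0 = 0 \/ base_t u = tri_turn h0 h1 h2].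
Proof.
move=> r00 r01 p0 p1 p2 s hz z0 z1.
pose w (h : R) := (1 - r0) / 3 + r0 * h.
have wE h : w h = (1 - r0) / 3 + r0 * h by [].
have w0 h : 0 <= h -> 0 <= w h.
  by move=> h_0; apply: addr_ge0; [rewrite divr_ge0 // subr_ge0 | exact: mulr_ge0].
have ws : w h0 + w h1 + w h2 = 1.
  by have -> : w h0 + w h1 + w h2 = 1 - r0 + r0 * (h0 + h1 + h2); [rewrite /w; field | rewrite s; ring].
pose l3 := (z - w h1 - 2 * w h2) / 3.
have l3E : z = w h1 + 2 * w h2 + 3 * l3 by rewrite /l3; field.
have e1 : w h1 + 2 * w h2 <= z.
  by have -> : w h1 + 2 * w h2 = (1 - r0) + r0 * (h1 + 2 * h2); [rewrite /w; field | ].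
have e2 : z <= 3 * w h0 + w h1 + 2 * w h2.
  by have -> : 3 * w h0 + w h1 + 2 * w h2 = 2 * (1 - r0) + r0 * (3 * h0 + h1 + 2 * h2); [rewrite /w; field | ].
have := w0 h0 p0; have := w0 h1 p1; have := w0 h2 p2 => q2 q1 q0.
have [u [un u0 u1 u2 u3]] : exists u : pt, [/\ u.1 = 0%N, bc u v0 = w h0 - l3, bc u v1 = w h1,
    bc u v2 = w h2 & bc u v3 = l3].
  by apply: pt_exists4 => //; clear - eps1 l3E e1 e2 ws; lra.
have m0 : mu0 u = w h0 by rewrite /mu0 u0 u3; ring.
have mm : mu_min u = (1 - r0) / 3.
  have wge h : 0 <= h -> (1 - r0) / 3 <= w h by move=> hh; rewrite /w lerDl mulr_ge0.
  apply/le_anti; rewrite !le_min m0 /mu1 /mu2 u1 u2 !wge // andbT /mu_min m0 /mu1 /mu2 u1 u2 !ge_min.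
  by case: hz => [|[]] ->; rewrite /w mulr0 addr0 lexx ?orbT.
have rE : base_r u = r0 by rewrite /base_r mm; field.
exists u; split=> //; first by rewrite /base_y u1 u2 u3.
have [->|rn] := eqVneq r0 0; [by left | right].
have hE (mu : pt -> R) h : mu u = w h -> base_h mu u = h.
  by move=> e; rewrite /base_h e mm rE /w addrC addKr mulrC mulKf.
by rewrite /base_t (hE _ h0) // (hE _ h1) // (hE _ h2).
Qed.

(** The fibres over a point and its two rotations have lengths 3 mu0, 3 mu1, 3 mu2. Shifted by 0, 1,
    2 they stack without gap to an interval of length 3. The height is first reduced modulo 3
    because three deck transformations make a full rotation. *)
Lemma base_surj (r0 x0 y0 : R) : 0 <= r0 <= 1 -> exists u,
  [/\ (u.1 < 1)%N, base_r u = r0, eqm (base_y u) y0 & r0 = 0 \/ eqm (base_x u) x0].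
Proof.
move=> /andP[r00 r01].
pose t0 : R := eps%:~R * (x0 - (al%:~R - eps%:~R / 3) * y0).
have [h0 [h1 [h2 [[p0 p1 p2] s z tE]]]] := tri_turn_surj t0.
pose c := (1 - r0) + r0 * (h1 + 2 * h2); pose j := Num.floor ((y0 - c) / 3).
pose y1 := y0 - 3 * j%:~R.
have y1c : c <= y1 <= c + 3.
  have := ge_floor ((y0 - c) / 3); have := floorD1_gt ((y0 - c) / 3).
  by rewrite -/j intrD /y1 => ? ?; apply/andP; split; lra.
have x_lift (t : R) (k : nat) : eqm t (t0 - k%:R / 3) ->
    eqm (eps%:~R * t + (al%:~R - eps%:~R / 3) * (y1 - k%:R)) x0.
  move=> te; apply: eqm_trans (eqmD (eqmMz eps te) (eqm_refl _)) _.
  apply: (@eqm_int _ (eps * j - 3 * al * j - al * (Posz k))).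
  rewrite /y1; have -> : eps%:~R * (t0 - k%:R / 3) = x0 - (al%:~R - eps%:~R / 3) * y0 - eps%:~R * (k%:R / 3).
    by rewrite mulrBr /t0 mulrA eps_sqr // mul1r.
  by field.
have suff_lift (k : nat) g0 g1 g2 : 0 <= g0 -> 0 <= g1 -> 0 <= g2 -> g0 + g1 + g2 = 1 ->
    g0 = 0 \/ g1 = 0 \/ g2 = 0 -> eqm (tri_turn g0 g1 g2) (t0 - k%:R / 3) ->
    (1 - r0) + r0 * (g1 + 2 * g2) <= y1 - k%:R ->
    y1 - k%:R <= 2 * (1 - r0) + r0 * (3 * g0 + g1 + 2 * g2) ->
    exists u, [/\ (u.1 < 1)%N, base_r u = r0, eqm (base_y u) y0 & r0 = 0 \/ eqm (base_x u) x0].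
  move=> q0 q1 q2 qs qz te z0 z1.
  have [u [un ru yu tu]] := base_lift r00 r01 q0 q1 q2 qs qz z0 z1.
  exists u; split=> //; first by rewrite un.
    by rewrite yu; apply: (@eqm_int _ (- (3 * j) - (Posz k))); rewrite /y1; ring.
  by case: tu => [|tu]; [left | right; rewrite /base_x yu tu; exact: x_lift].
have rot1 := tri_turn_rot z s.
have z' : h1 = 0 \/ h2 = 0 \/ h0 = 0 by tauto.
have s' : h1 + h2 + h0 = 1 by lra.
have rot2 := tri_turn_rot z' s'.
have back (a b c' d : R) : eqm a (b + c') -> eqm a d -> eqm b (d - c').
  move=> /eqm_sym ab ad; have := eqmD (eqm_trans ab ad) (eqm_refl (- c')).
  by rewrite addrK.
have t1 := back _ _ _ _ rot1 tE.
have t2 := back _ _ _ _ rot2 t1.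
have rs : r0 * h0 + r0 * h1 + r0 * h2 = r0 by rewrite -!mulrDr s mulr1.
have /andP[y1a y1b] := y1c.
have [ya|ya] := leP y1 (2 * (1 - r0) + r0 * (3 * h0 + h1 + 2 * h2)).
  by apply: (suff_lift 0%N h0 h1 h2) => //; rewrite ?mul0r ?subr0.
have [yb|yb] := leP (y1 - 1) (2 * (1 - r0) + r0 * (3 * h1 + h2 + 2 * h0)).
  apply: (suff_lift 1%N h1 h2 h0) => //; clear - eps1 rs ya; lra.
apply: (suff_lift 2%N h2 h0 h1) => //.
- by clear - eps1 s; lra.
- by tauto.
- by apply: eqm_trans t2 _; apply: (@eqm_int _ 0); field.
- by clear - eps1 rs yb; lra.
- by move: y1b; rewrite /c; clear - eps1 rs; lra.
Qed.

Lemma base_X (l0 l1 l2 : R) u : pon_face (0%N, (v0, v3, v2)) l0 l1 l2 u ->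
  [/\ base_r u = 1, eqm (base_x u) (l2 * be%:~R + l1 * (al + be)%:~R) &
      eqm (base_y u) (l2 * 2%:~R + l1 * (1 + 2)%:~R)].
Proof.
move=> [/= un uE]; have := uE v0; have := uE v1; have := uE v2; have := uE v3.
rewrite /= !(mulr0, mulr1, addr0, add0r) => e3 e2 e1 e0.
have s := bc_sum u; rewrite e0 e1 e2 e3 in s.
have [rE tE] : base_r u = 1 /\ base_t u = tri_turn (mu0 u) (mu1 u) (mu2 u).
  by apply: base_boundary; right; left; rewrite /mu1 e1.
have ht : eqm (tri_turn (mu0 u) (mu1 u) (mu2 u)) (2 / 3 + mu0 u / 3).
  by apply: tri_turn1; [rewrite /mu1 e1 | exact: mu_sum].
split=> //.
  rewrite /base_x tE; apply: eqm_trans (eqmD (eqmMz eps ht) (eqm_refl _)) _.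
  rewrite /base_y /mu0 e0 e1 e2 e3 (_ : l0 = 1 - l1 - l2); last by clear - eps1 s; lra.
  by apply: (@eqm_int _ eps); field.
by rewrite /base_y e1 e2 e3; apply: (@eqm_int _ 0); ring.
Qed.

Lemma base_Y (l0 l1 l2 : R) u : pon_face (0%N, (v3, v0, v1)) l0 l1 l2 u ->
  [/\ base_r u = 1, eqm (base_x u) (- (l2 * be%:~R + l1 * (al + be)%:~R)) &
      eqm (base_y u) (- (l2 * 2%:~R + l1 * (1 + 2)%:~R))].
Proof.
move=> [/= un uE]; have := uE v0; have := uE v1; have := uE v2; have := uE v3.
rewrite /= !(mulr0, mulr1, addr0, add0r) => e3 e2 e1 e0.
have s := bc_sum u; rewrite e0 e1 e2 e3 in s.
have [rE tE] : base_r u = 1 /\ base_t u = tri_turn (mu0 u) (mu1 u) (mu2 u).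
  by apply: base_boundary; right; right; rewrite /mu2 e2.
have ht : tri_turn (mu0 u) (mu1 u) (mu2 u) = mu1 u / 3 by rewrite tri_turn2 // /mu2 e2.
have l0E : l0 = 1 - l1 - l2 by clear - eps1 s; lra.
split=> //.
  rewrite /base_x tE ht /base_y /mu1 e1 e2 e3 l0E.
  by apply: (@eqm_int _ (al + be)); field.
by rewrite /base_y e1 e2 e3 l0E; apply: (@eqm_int _ 3); ring.
Qed.

Lemma base_vertex u j : bc u j = 1 -> base_r u = 1.
Proof.
move=> uj; suff /base_boundary[] : mu0 u = 0 \/ mu1 u = 0 \/ mu2 u = 0 by [].
have s := bc_sum u; have h0 := bc_ge0 u v0; have h1 := bc_ge0 u v1.
have h2 := bc_ge0 u v2; have h3 := bc_ge0 u v3; rewrite /mu0 /mu1 /mu2.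
by move: j uj; apply: I4_ind => uj; [right; left|left|right;left|right;left]; lra.
Qed.

(** All six edges lie on the boundary of the prism: 01, 12, 23 become the 1-edge, 02 and 13 the
    2-edge, 03 the 3-edge. *)
Lemma base_edge a b : a != b -> edge_model al 1 be 2 (@base_r R) base_x (@base_y R) 0 a b.
Proof.
have lin (a' b' : 'I_4) (d1 d2 k1 k2 : int) :
    (d1, d2) \in [:: (al, 1); (be, 2); (al + be, 3)] ->
    (forall u, bc u a' + bc u b' = 1 -> exists2 t,
      (mu0 u = 0 \/ mu1 u = 0 \/ mu2 u = 0) /\ eqm (tri_turn (mu0 u) (mu1 u) (mu2 u)) t &
      eps%:~R * t + (al%:~R - eps%:~R / 3) * base_y u = bc u b' * d1%:~R + k1%:~R /\
      base_y u = bc u b' * d2%:~R + k2%:~R) ->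
    edge_model al 1 be 2 (@base_r R) base_x (@base_y R) 0 a' b'.
  move=> dE h; exists d1, d2; split.
  - by move: dE; rewrite !inE => /orP[|/orP[]] /eqP[_ ->].
  - by left; move: dE; rewrite !inE => /orP[|/orP[]] ->; rewrite ?orbT.
  move=> u un uab; have [t [mz te] [xE yE]] := h u uab; have [_ tE] := base_boundary mz.
  split; last by rewrite yE; exact: (@eqm_int _ k2).
  rewrite /base_x tE; apply: eqm_trans (eqmD (eqmMz eps te) (eqm_refl _)) _.
  by rewrite xE; apply: (@eqm_int _ k1).
have z u : [/\ 0 <= bc u v0, 0 <= bc u v1, 0 <= bc u v2 & 0 <= bc u v3].
  by rewrite !bc_ge0.
have e01 : edge_model al 1 be 2 (@base_r R) base_x (@base_y R) 0 v0 v1.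
  apply: (lin _ _ al 1 0 0) => [|u uab]; first by rewrite !inE eqxx ?orbT.
  have s := bc_sum u; have [z0 z1 z2 z3] := z u; have ms := mu_sum u.
  have u2 : bc u v2 = 0 by lra.
  have u3 : bc u v3 = 0 by lra.
  exists (mu1 u / 3); last by rewrite /base_y /mu1 u2 u3; split; field.
  by split; [auto | rewrite tri_turn2 //; exact: eqm_refl].
have e02 : edge_model al 1 be 2 (@base_r R) base_x (@base_y R) 0 v0 v2.
  apply: (lin _ _ be 2 eps 0) => [|u uab]; first by rewrite !inE eqxx ?orbT.
  have s := bc_sum u; have [z0 z1 z2 z3] := z u; have ms := mu_sum u.
  have u1 : bc u v1 = 0 by lra.
  have u3 : bc u v3 = 0 by lra.
  exists (2 / 3 + mu0 u / 3); first by split; [auto | exact: tri_turn1].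
  have u0 : bc u v0 = 1 - bc u v2 by lra.
  by rewrite /base_y /mu0 u0 u1 u3; split; field.
have e03 : edge_model al 1 be 2 (@base_r R) base_x (@base_y R) 0 v0 v3.
  apply: (lin _ _ (al + be) 3 0 0) => [|u uab]; first by rewrite !inE eqxx ?orbT.
  have s := bc_sum u; have [z0 z1 z2 z3] := z u; have ms := mu_sum u.
  have u1 : bc u v1 = 0 by lra.
  have u2 : bc u v2 = 0 by lra.
  exists 0; last by rewrite /base_y u1 u2; split; field.
  by split; [auto | rewrite tri_turn2 // /mu1 u1 mul0r; exact: eqm_refl].
have e12 : edge_model al 1 be 2 (@base_r R) base_x (@base_y R) 0 v1 v2.
  apply: (lin _ _ al 1 al 1) => [|u uab]; first by rewrite !inE eqxx ?orbT.
  have s := bc_sum u; have [z0 z1 z2 z3] := z u; have ms := mu_sum u.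
  have u0 : bc u v0 = 0 by lra.
  have u3 : bc u v3 = 0 by lra.
  have m0 : mu0 u = 0 by rewrite /mu0 u0 u3 addr0.
  exists (1 / 3 + mu2 u / 3); first by split; [auto | rewrite tri_turn0 //; exact: eqm_refl].
  have u1 : bc u v1 = 1 - bc u v2 by lra.
  by rewrite /base_y /mu2 u1 u3; split; field.
have e13 : edge_model al 1 be 2 (@base_r R) base_x (@base_y R) 0 v1 v3.
  apply: (lin _ _ be 2 al 1) => [|u uab]; first by rewrite !inE eqxx ?orbT.
  have s := bc_sum u; have [z0 z1 z2 z3] := z u; have ms := mu_sum u.
  have u0 : bc u v0 = 0 by lra.
  have u2 : bc u v2 = 0 by lra.
  have u1 : bc u v1 = 1 - bc u v3 by lra.
  exists (mu1 u / 3); last by rewrite /base_y /mu1 u1 u2; split; field.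
  by split; [auto | rewrite tri_turn2 //; exact: eqm_refl].
have e23 : edge_model al 1 be 2 (@base_r R) base_x (@base_y R) 0 v2 v3.
  apply: (lin _ _ al 1 (2 * al) 2) => [|u uab]; first by rewrite !inE eqxx ?orbT.
  have s := bc_sum u; have [z0 z1 z2 z3] := z u; have ms := mu_sum u.
  have u0 : bc u v0 = 0 by lra.
  have u1 : bc u v1 = 0 by lra.
  have u2 : bc u v2 = 1 - bc u v3 by lra.
  exists (2 / 3 + mu0 u / 3); first by split; [auto | exact: tri_turn1].
  by rewrite /base_y /mu0 u0 u1 u2; split; field.
by move: a b; apply: I4_ind; apply: I4_ind => // _; apply: edge_model_sym.
Qed.

Lemma base_model : has_model R (layer Moebius) al 1 be 2.
Proof.
exists (@base_r R), base_x, (@base_y R); split=> /=.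
- by case=> // _; exact: base_cont.
- by move=> u _; rewrite base_r_ge0 base_r_le1.
- by split=> // P; rewrite inE => /eqP ->.
- exact: base_glue.
- exact: base_inj.
- exact: base_surj.
- exact: base_X.
- exact: base_Y.
- by move=> u j _; exact: base_vertex.
- by case=> // a b _; exact: base_edge.
Qed.

End BaseModel.

(** * Induction along the Euclidean algorithm *)

Lemma LST_rec_Moebius k : LST_rec k 1 1 = Moebius.
Proof. by case: k. Qed.

(** The slopes must be arbitrary for the induction: a layering with p < q comes from the pair (al,
    be - al), the mirrored case from (al - be, be), and neither changes the determinant up to sign.
    At the bottom, [eps] is 2 al - be up to exchanging the two edges. *)
Lemma LST_rec_model (R : realType) k (p q : nat) (al be : int) :
  (0 < p)%N -> (0 < q)%N -> (p + q <= k)%N -> (p, q) != (1%N, 1%N) ->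
  al * q%:Z - be * p%:Z = 1 \/ al * q%:Z - be * p%:Z = -1 ->
  has_model R (LST_rec k p q) al p be q.
Proof.
elim: k p q al be => [|k IH] p q al be p0 q0; first by lia.
move=> pqk pq1 D /=; case: ifP => [pq|/negbT qp].
  have [[p1 q1]|n11] := eqVneq (p, (q - p)%N) (1%N, 1%N).
    have q2 : q = 2%N by lia.
    rewrite q1 p1 LST_rec_Moebius q2.
    have -> : be = 2 * al - (2 * al - be) by ring.
    by apply: base_model; move: D; rewrite p1 q2; lia.
  have := IH p (q - p)%N al (be - al).
  case: (LST_rec k p (q - p)) => [|n ps X Y] h; first by case: h; lia.
  have {}h : has_model R (Solid n ps X Y) al p (be - al) (q - p)%N.
    apply: h => //; [lia | lia |].
    have -> : (q - p)%N = q%:Z - p%:Z :> int by lia.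
    have -> : al * (q%:Z - p%:Z) - (be - al) * p%:Z = al * q%:Z - be * p%:Z by ring.
    exact: D.
  have [r [x [y M]]] := h; have := @layer_model _ _ _ _ _ _ _ _ _ _ _ _ _ _ _ M.
  have -> : al + (be - al) = be by ring.
  have -> : p%:Z + (q - p)%N = q by lia.
  apply; [lia | lia |].
  have -> : (q - p)%N = q%:Z - p%:Z :> int by lia.
  have -> : al * (q%:Z - p%:Z) - (be - al) * p%:Z = al * q%:Z - be * p%:Z by ring.
  exact: D.
case: ifP => [qp'|]; last first.
  move=> pq'; have pq : p = q by lia.
  move: D; rewrite pq -mulrBl => D.
  have : (`|al - be| * q == 1)%N by case: D => /(congr1 absz); rewrite abszM => ->.
  rewrite muln_eq1 => /andP[_ /eqP q1]; by move: pq1; rewrite pq q1.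
have [[p1 q1]|n11] := eqVneq ((p - q)%N, q) (1%N, 1%N).
  have p2 : p = 2%N by lia.
  rewrite p1 q1 LST_rec_Moebius p2; apply: (@swap_model _ (layer Moebius)).
  have -> : al = 2 * be - (2 * be - al) by ring.
  by apply: base_model; move: D; rewrite p2 q1; lia.
apply: (@swap_model _ (layer (swap_pq (LST_rec k (p - q) q)))).
have := IH (p - q)%N q (al - be) be.
case: (LST_rec k (p - q) q) => [|n ps X Y] h; first by case: h; lia.
have {}h : has_model R (Solid n ps X Y) (al - be) (p - q)%N be q.
  apply: h => //; [lia | lia |].
  have -> : (p - q)%N = p%:Z - q%:Z :> int by lia.
  have -> : (al - be) * q%:Z - be * (p%:Z - q%:Z) = al * q%:Z - be * p%:Z by ring.
  exact: D.
have [r [x [y M]]] := swap_model h; have := @layer_model _ _ _ _ _ _ _ _ _ _ _ _ _ _ _ M.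
have -> : be + (al - be) = al by ring.
have -> : q%:Z + (p - q)%N = p by lia.
apply; [lia | lia |].
have -> : (p - q)%N = p%:Z - q%:Z :> int by lia.
have -> : be * (p%:Z - q%:Z) - (al - be) * q%:Z = - (al * q%:Z - be * p%:Z) by ring.
by case: D => ->; [right | left; rewrite opprK].
Qed.

(** * Closed gluings *)

Definition faces_of (ps : seq pairing) : seq face := flatten [seq [:: pq.1; pq.2] | pq <- ps].

Lemma faces_of_cat ps ps' : faces_of (ps ++ ps') = faces_of ps ++ faces_of ps'.
Proof. by rewrite /faces_of map_cat flatten_cat. Qed.

Definition opposite (t : nat) (f : 'I_4) (F : face) : bool := (F.1 == t) && (f \notin corners F).

Definition all_faces_once (n : nat) (s : seq face) : Prop :=
  (forall F : face, F \in s -> (F.1 < n)%N /\ uniq (corners F)) /\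
  (forall t f, (t < n)%N -> count (opposite t f) s = 1%N).

Definition closed_torus L : Prop :=
  if L is Solid n ps X Y then all_faces_once n (faces_of ps ++ [:: X; Y]) else False.

Lemma all_faces_once_perm n s s' : perm_eq s s' -> all_faces_once n s -> all_faces_once n s'.
Proof.
move=> ss [h1 h2]; split=> [F|t f tn]; first by rewrite -(perm_mem ss); exact: h1.
by rewrite -(permP ss) h2.
Qed.

Lemma count_opposite0 (a : pred nat) s t f : (forall F : face, F \in s -> a F.1) -> ~~ a t ->
  count (opposite t f) s = 0%N.
Proof.
move=> sa at'; apply/eqP; rewrite -leqn0 leqNgt -has_count; apply/hasPn => F Fs.
by rewrite /opposite; case: eqP => //= Ft; move: at'; rewrite -Ft sa.
Qed.

Lemma all_faces_once_swap n s X Y :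
  all_faces_once n (s ++ [:: X; Y]) -> all_faces_once n (s ++ [:: swap01 X; swap01 Y]).
Proof.
have cs F : perm_eq (corners (swap01 F)) (corners F).
  by case: F => t [[a b] c]; rewrite /= -cat1s -[X in perm_eq _ X]cat1s (perm_catCA [:: b] [:: a] [:: c]).
have s1 F : (swap01 F).1 = F.1 by case: F => t [[a b] c].
have os t f F : opposite t f (swap01 F) = opposite t f F.
  by rewrite /opposite s1 (perm_mem (cs F)).
move=> [h1 h2]; split=> [F|t f tn]; last first.
  by rewrite -(h2 t f tn) !count_cat /= !os.
rewrite mem_cat !inE => /orP[Fs|/orP[/eqP ->|/eqP ->]].
- by apply: h1; rewrite mem_cat Fs.
- by rewrite s1 (perm_uniq (cs X)); apply: h1; rewrite mem_cat !inE eqxx orbT.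
- by rewrite s1 (perm_uniq (cs Y)); apply: h1; rewrite mem_cat !inE eqxx !orbT.
Qed.

Lemma all_faces_once_add n m s s' : all_faces_once n s ->
  (forall F : face, F \in s' -> (n <= F.1)%N) ->
  (forall F : face, F \in s' -> (F.1 < n + m)%N /\ uniq (corners F)) ->
  (forall t f, (t < m)%N -> count (opposite (n + t) f) s' = 1%N) ->
  all_faces_once (n + m) (s ++ s').
Proof.
move=> [h1 h2] h0 h1' h2'; split=> [F|t f tnm].
  rewrite mem_cat => /orP[/h1[Fn uF]|/h1' //]; split=> //; exact: ltn_addr.
rewrite count_cat; have [tn|nt] := ltnP t n.
  rewrite (h2 _ _ tn) (@count_opposite0 (fun i => n <= i)%N) ?addn0 // -ltnNge //.
rewrite (@count_opposite0 (fun i => i < n)%N); last 2 first.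
- by move=> F /h1[].
- by rewrite -leqNgt.
by rewrite -(subnKC nt) h2' //; lia.
Qed.

(** The new tetrahedron contributes two glued and two boundary triangles, one opposite each of its
    vertices, while the old boundary triangles become glued ones. *)
Lemma closed_torus_layer n ps X Y : closed_torus (Solid n ps X Y) -> closed_torus (layer (Solid n ps X Y)).
Proof.
move=> h; rewrite /= faces_of_cat -addn1.
apply: (@all_faces_once_perm _ ((faces_of ps ++ [:: X; Y]) ++ [:: (n, (v2, v0, v1)); (n, (v1, v3, v2)); (n, (v0, v3, v2)); (n, (v3, v0, v1))])).
  by apply/permP => a; rewrite !count_cat /=; lia.
apply: all_faces_once_add => //.
- by move=> F; rewrite !inE => /or4P[] /eqP ->.
- by move=> F; rewrite !inE addn1 => /or4P[] /eqP -> /=; split.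
case=> // f _; rewrite addn0 /= /opposite /= eqxx.
by move: f; apply: I4_ind.
Qed.

Lemma closed_torus_base : closed_torus (layer Moebius).
Proof.
split=> [F|[|//] f _]; first by rewrite !inE => /or4P[] /eqP ->.
by move: f; apply: I4_ind.
Qed.

Lemma closed_torus_swap L : closed_torus L -> closed_torus (swap_pq L).
Proof. case: L => // n ps X Y; exact: all_faces_once_swap. Qed.

Lemma LST_rec_closed k (p q : nat) : (0 < p)%N -> (0 < q)%N -> (p + q <= k)%N ->
  coprime p q -> (p, q) != (1%N, 1%N) -> closed_torus (LST_rec k p q).
Proof.
elim: k p q => [|k IH] p q p0 q0; first by lia.
move=> pqk cpq pq1 /=; case: ifP => [pq|/negbT qp].
  have [[q1 p1]|n11] := eqVneq (p, (q - p)%N) (1%N, 1%N).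
    by rewrite p1 q1 LST_rec_Moebius; exact: closed_torus_base.
  have := IH p (q - p)%N p0; case: (LST_rec k p (q - p)) => [|n ps X Y] h.
    exfalso; apply: h => //; try lia.
    by rewrite /coprime -(gcdnDl p) subnKC // ltnW.
  apply: closed_torus_layer; apply: h => //; try lia.
  by rewrite /coprime -(gcdnDl p) subnKC // ltnW.
case: ifP => [qp'|]; last first.
  move=> pq'; have pq : p = q by lia.
  move: pq1 cpq; rewrite pq /coprime gcdnn => + /eqP q1.
  by rewrite q1.
apply: (@closed_torus_swap (layer (swap_pq (LST_rec k (p - q) q)))).
have [[p1 q1]|n11] := eqVneq ((p - q)%N, q) (1%N, 1%N).
  by rewrite p1 q1 LST_rec_Moebius; exact: closed_torus_base.
have cpq' : coprime (p - q) q.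
  by rewrite coprime_sym /coprime -(gcdnDl q) subnKC -/(coprime q p) 1?coprime_sym // ltnW.
have : closed_torus (swap_pq (LST_rec k (p - q) q)).
  by apply: closed_torus_swap; apply: IH => //; lia.
by case: (swap_pq _) => // n ps X Y; exact: closed_torus_layer.
Qed.

Lemma shift_face0 (F : face) : shift_face 0 F = F.
Proof. by case: F. Qed.

Lemma shift0 L : Defs.shift 0 L = L.
Proof.
case: L => //= n ps X Y; rewrite !shift_face0; congr Solid.
by rewrite -[RHS]map_id; apply: eq_map => -[F G]; rewrite !shift_face0.
Qed.

Lemma faces_of_shift n ps : faces_of [seq (shift_face n P.1, shift_face n P.2) | P <- ps] =
  [seq shift_face n F | F <- faces_of ps].
Proof. by rewrite /faces_of map_flatten -!map_comp. Qed.

Lemma closed_union_solid n ps X Y m ps' X' Y' :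
  closed_torus (Solid n ps X Y) -> closed_torus (Solid m ps' X' Y') ->
  closed_gluing (lst_union (Solid n ps X Y) (Solid m ps' X' Y')).
Proof.
move=> h [h1 h2]; suff : all_faces_once (n + m) (faces_of (pairings (lst_union (Solid n ps X Y) (Solid m ps' X' Y')))) by [].
rewrite /= !faces_of_cat faces_of_shift.
apply: (@all_faces_once_perm _ ((faces_of ps ++ [:: X; Y]) ++ [seq shift_face n F | F <- faces_of ps' ++ [:: X'; Y']])).
  by apply/permP => a; rewrite map_cat !count_cat /=; lia.
have cs F : corners (shift_face n F) = corners F by case: F => t [[a b] c].
apply: all_faces_once_add => //.
- by move=> _ /mapP[F _ ->]; exact: leq_addr.
- by move=> _ /mapP[F /h1[Fm uF] ->]; rewrite cs ltn_add2l.
move=> t f tm; rewrite count_map -(h2 t f tm); apply: eq_count => F /=.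
by rewrite /opposite cs /= eqn_add2l.
Qed.

Lemma closed_fold n ps X Y : closed_torus (Solid n ps X Y) ->
  all_faces_once n (faces_of (ps ++ [:: (X, swap01 Y)])).
Proof.
move=> [h1 h2]; have := all_faces_once_swap (conj h1 h2).
move=> [k1 k2]; rewrite faces_of_cat; split=> [F|t f tn].
  rewrite mem_cat !inE => /orP[Fs|/orP[/eqP ->|/eqP ->]].
  - by apply: h1; rewrite mem_cat Fs.
  - by apply: h1; rewrite mem_cat !inE eqxx orbT.
  - by apply: k1; rewrite mem_cat !inE eqxx !orbT.
have := h2 t f tn; have := k2 t f tn; rewrite !count_cat /= !addn0.
have cs F : opposite t f (swap01 F) = opposite t f F.
  by case: F => t' [[a b] c]; rewrite /opposite /= !inE orbCA.
by rewrite !cs.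
Qed.

(** * Recognising the three-sphere *)

Section Normalisation.
Context (R : realType).
Implicit Types z : 'rV[R]_4.

Definition sqnorm z : R := \sum_j z ord0 j ^+ 2.
Definition normalise z : 'rV[R]_4 := (Num.sqrt (sqnorm z))^-1 *: z.

Lemma sqnorm_ge0 z : 0 <= sqnorm z.
Proof. by apply: sumr_ge0 => j _; exact: sqr_ge0. Qed.

Lemma sqnormZ (c : R) z : sqnorm (c *: z) = c ^+ 2 * sqnorm z.
Proof. by rewrite /sqnorm mulr_sumr; apply: eq_bigr => j _; rewrite mxE exprMn. Qed.

Lemma sqnorm_eq0 z : sqnorm z = 0 -> z = 0.
Proof.
move=> /eqP; rewrite psumr_eq0 => [/allP h|j _]; last exact: sqr_ge0.
by apply/rowP => j; have := h j (mem_index_enum _); rewrite sqrf_eq0 => /eqP ->; rewrite mxE.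
Qed.

Lemma normalise_sphere z : z != 0 -> sphere3 R (normalise z).
Proof.
move=> z0; have n0 : 0 < sqnorm z by rewrite lt_neqAle sqnorm_ge0 andbT eq_sym; apply: contra z0 => /eqP/sqnorm_eq0 ->.
have -> : sphere3 R (normalise z) = (sqnorm (normalise z) = 1) by [].
by rewrite sqnormZ exprVn sqr_sqrtr ?sqnorm_ge0 // mulVf // gt_eqF.
Qed.

Lemma normaliseZ (c : R) z : 0 < c -> sphere3 R z -> normalise (c *: z) = z.
Proof.
move=> c0; have -> : sphere3 R z = (sqnorm z = 1) by [].
move=> z1; rewrite /normalise sqnormZ z1 mulr1 sqrtr_sqr gtr0_norm // scalerA mulVf ?scale1r //.
by rewrite gt_eqF.
Qed.

Lemma normalise_eq z z' : z != 0 -> z' != 0 -> normalise z = normalise z' ->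
  exists2 c : R, 0 < c & z = c *: z'.
Proof.
have n0 w : w != 0 -> 0 < Num.sqrt (sqnorm w).
  move=> w0; rewrite sqrtr_gt0 lt_neqAle sqnorm_ge0 andbT eq_sym.
  by apply: contra w0 => /eqP/sqnorm_eq0 ->.
move=> z0 z0' e; exists (Num.sqrt (sqnorm z) / Num.sqrt (sqnorm z')); first by rewrite divr_gt0 ?n0.
by rewrite -scalerA -/(normalise z') -e scalerA mulfV ?scale1r // gt_eqF ?n0.
Qed.

Lemma torus_curve_sphere (a b : int) (t : R) : sphere3 R (torus_curve a b t).
Proof.
rewrite /sphere3 /= !big_ord_recl big_ord0 !mxE /= addr0.
have s2 : (Num.sqrt 2 : R) ^+ 2 = 2 by rewrite sqr_sqrtr.
rewrite !expr_div_n s2; have := cos2Dsin2 (a%:~R * t); have := cos2Dsin2 (b%:~R * t).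
by rewrite /lift /= => h1 h2; lra.
Qed.

End Normalisation.

Section Criterion.
Context (R : realType) (T : gluing).
Local Notation pt := (point_of_tets R).
Local Notation n := (ntets T).

Definition to_pt (u : tets R n) : pt := (nat_of_ord (tag u), tagged u).

Lemma to_pt_exists (w : pt) : (w.1 < n)%N -> exists u, to_pt u = w.
Proof.
case: w => t s /= tn.
by exists (existT (fun=> set_type (simplex3 R)) (Ordinal tn) s).
Qed.

Hypothesis cT : closed_gluing T.

Lemma pglued_range (u v : pt) : pglued (pairings T) u v -> (u.1 < n)%N /\ (v.1 < n)%N.
Proof.
move=> [F [G [l0 [l1 [l2 [h uF vG]]]]]]; have [h1 _] := cT.
have [Fn Gn] : (F.1 < n)%N /\ (G.1 < n)%N.
  by split; [have [] := h1 F | have [] := h1 G] => //;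
    apply/flattenP; exists [:: F; G]; rewrite ?inE ?eqxx ?orbT //;
    apply/mapP; exists (F, G).
by move: F G Fn Gn uF vG {h} => [t [[a b] c]] [t' [[a' b'] c']] /= Fn Gn [-> _] [-> _].
Qed.

(** Closedness keeps both ends of each gluing step inside the index range, so a chain can be pulled
    back step by step along the retraction [g], whose values outside the range are irrelevant. *)
Lemma identified_pident (u v : tets R n) :
  pident (pairings T) (to_pt u) (to_pt v) -> identified u v.
Proof.
have [g gK] : exists g : pt -> tets R n, forall w, (w.1 < n)%N -> to_pt (g w) = w.
  suff /choice[g gK] : forall w : pt, exists u : tets R n, (w.1 < n)%N -> to_pt u = w by exists g.
  move=> w; have [wn|nw] := boolP (w.1 < n)%N; last by exists u => wn; case/negP: nw.
  by have [u' <-] := to_pt_exists wn; exists u'.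
have toK w : g (to_pt w) = w.
  have : to_pt (g (to_pt w)) = to_pt w by apply: gK; exact: ltn_ord.
  move: (g _) => w'; case: w w' => t s [t' s'] e.
  have /= /val_inj tE := congr1 fst e; have /= sE := congr1 snd e.
  by rewrite sE; case: _ / tE {e sE}.
rewrite -{2}(toK u) -{2}(toK v) => h; apply/asboolP; elim: h => {u v} [u v uv|u|u v _ IH|u v w _ IH1 _ IH2].
- apply: rst_step; have [un vn] := pglued_range uv.
  move: uv => [F [G [l0 [l1 [l2 [h uF vG]]]]]]; exists F, G, l0, l1, l2.
  rewrite -(gK _ un) in uF; rewrite -(gK _ vn) in vG.
  by move: F G uF vG {h} (h) => [t [[a b] c]] [t' [[a' b'] c']] uF vG h.
- exact: rst_refl.
- exact: rst_sym.
- exact: rst_trans IH1 IH2.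
Qed.

Lemma pglued_glued (u v : tets R n) : glued u v -> pglued (pairings T) (to_pt u) (to_pt v).
Proof.
move=> [[t [[a b] c]] [[t' [[a' b'] c']] [l0 [l1 [l2 [h uF vG]]]]]].
by exists (t, (a, b, c)), (t', (a', b', c')), l0, l1, l2.
Qed.

Variables (P Q : int) (f : pt -> 'rV[R]_4).
Hypothesis n0 : (0 < n)%N.
Hypothesis f_cont : forall t, (t < n)%N -> forall j, continuous (fun s => f (t, s) ord0 j).
Hypothesis f_neq0 : forall u : pt, (u.1 < n)%N -> f u != 0.
Hypothesis f_glue : forall u v, pglued (pairings T) u v -> f u = f v.
Hypothesis f_inj : forall (u v : pt) (c : R), (u.1 < n)%N -> (v.1 < n)%N -> 0 < c -> f u = c *: f v ->
  pident (pairings T) u v.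
Hypothesis f_surj : forall z : 'rV[R]_4, z != 0 -> exists (u : pt) (c : R), [/\ (u.1 < n)%N, 0 < c & f u = c *: z].
Hypothesis f_vertex : forall (u v : pt) j k, (u.1 < n)%N -> (v.1 < n)%N -> bc u j = 1 -> bc v k = 1 ->
  f u = f v.
Hypothesis f_reverse : forall t (a b : 'I_4), (t < n)%N -> a != b -> exists u v : pt,
  [/\ u.1 = t, v.1 = t, bc u a + bc u b = 1, bc v a + bc v b = 1 & bc u a = bc v b] /\
  forall c : R, 0 < c -> f u <> c *: f v.
Hypothesis f_knot : exists t (a b : 'I_4), [/\ (t < n)%N, a != b,
  forall u : pt, u.1 = t -> bc u a + bc u b = 1 -> exists th (c : R), 0 < c /\ f u = c *: torus_curve P Q th &
  forall th, exists (u : pt) (c : R), [/\ u.1 = t, bc u a + bc u b = 1, 0 < c & f u = c *: torus_curve P Q th]].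

Lemma in_cell2 (t : 'I_n) (a b : 'I_4) (u : tets R n) : a != b ->
  in_cell t [set a; b]%SET u <-> (to_pt u).1 = t /\ bc (to_pt u) a + bc (to_pt u) b = 1.
Proof.
move=> ab; have s4 : \sum_j bc (to_pt u) j = 1 by have [] := set_valP (tagged u).
have sab : \sum_j bc (to_pt u) j = bc (to_pt u) a + bc (to_pt u) b +
    \sum_(j | (j != a) && (j != b)) bc (to_pt u) j.
  by rewrite (bigD1 a) //= (bigD1 b) ?addrA // eq_sym.
split=> [[ut u0]|[ut uab]].
  split; first by rewrite /= ut.
  rewrite -s4 sab big1 ?addr0 // => j /andP[ja jb]; apply: u0.
  by rewrite !inE negb_or ja jb.
split; first exact: val_inj.
move=> j; rewrite !inE negb_or => jab.
have : \sum_(j | (j != a) && (j != b)) bc (to_pt u) j = 0.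
  by apply: (@addrI _ 1); rewrite addr0 -{1}uab -sab.
move/eqP; rewrite psumr_eq0 => [/allP/(_ j (mem_index_enum _))|k _]; last exact: bc_ge0.
by rewrite jab => /eqP.
Qed.

Lemma in_cell1 (t : 'I_n) (a : 'I_4) (u : tets R n) :
  in_cell t [set a]%SET u <-> (to_pt u).1 = t /\ bc (to_pt u) a = 1.
Proof.
have s4 : \sum_j bc (to_pt u) j = 1 by have [] := set_valP (tagged u).
have sab : \sum_j bc (to_pt u) j = bc (to_pt u) a + \sum_(j | j != a) bc (to_pt u) j.
  by rewrite (bigD1 a).
split=> [[ut u0]|[ut uab]].
  split; first by rewrite /= ut.
  by rewrite -s4 sab big1 ?addr0 // => j ja; apply: u0; rewrite !inE.
split; first exact: val_inj.
move=> j; rewrite !inE => jab.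
have : \sum_(j | j != a) bc (to_pt u) j = 0.
  by apply: (@addrI _ 1); rewrite addr0 -{1}uab -sab.
move/eqP; rewrite psumr_eq0 => [/allP/(_ j (mem_index_enum _))|k _]; last exact: bc_ge0.
by rewrite jab => /eqP.
Qed.

(** Points of the sphere are treated as rays, so that the models may use simple unnormalised
    formulas: glued points have equal images, and injectivity is asked for up to a positive
    factor. *)
Lemma sphere_map : exists2 h : underlying_space R T -> set_type (sphere3 R),
  homeomorphism h & forall u, set_val (h (quot u)) = normalise (f (to_pt u)).
Proof.
have tn (u : tets R n) : ((to_pt u).1 < n)%N by exact: ltn_ord.
pose g (u : tets R n) : set_type (sphere3 R) := SigSub (mem_set (normalise_sphere (f_neq0 (tn u)))).
have gE u : set_val (g u) = normalise (f (to_pt u)) by [].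
have ident_f u v : identified u v -> f (to_pt u) = f (to_pt v).
  move/asboolP; elim=> {u v} [u v /pglued_glued/f_glue|u|u v _ <-|u v w _ -> _ ->] //.
have [h hh hE] : exists2 h : underlying_space R T -> set_type (sphere3 R), homeomorphism h &
    forall u, h (quot u) = g u.
  apply: quotient_homeomorphism.
  - by apply: hausdorff_set_type; exact: norm_hausdorff.
  - apply: continuous_comp_initial; apply: continuous_row => j.
    suff ct (t : 'I_n) : continuous (fun s => normalise (f (nat_of_ord t, s)) ord0 j).
      by move=> -[t s] U nU; exact: (ct t s U nU).
    move=> s.
    have fj i := @f_cont _ (ltn_ord t) i s.
    have -> : (fun s => normalise (f (nat_of_ord t, s)) ord0 j) =
        fun s => (Num.sqrt (sqnorm (f (nat_of_ord t, s))))^-1 * f (nat_of_ord t, s) ord0 j.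
      by apply/funext => s'; rewrite mxE.
    have cs : {for s, continuous (fun s : set_type (simplex3 R) => Num.sqrt (sqnorm (f (nat_of_ord t, s))))}.
      apply: (@continuous_comp _ _ _ (fun s => sqnorm (f (nat_of_ord t, s))) (@Num.sqrt R)); last exact: sqrt_continuous.
      have cn : continuous (fun s : set_type (simplex3 R) => sqnorm (f (nat_of_ord t, s))).
        apply: continuous_big => [|i _ s']; first exact: add_continuous.
        exact: (cvgM (@f_cont _ (ltn_ord t) i s') (@f_cont _ (ltn_ord t) i s')).
      exact: cn.
    have ns : Num.sqrt (sqnorm (f (nat_of_ord t, s))) != 0.
      rewrite gt_eqF // sqrtr_gt0 lt_neqAle sqnorm_ge0 andbT eq_sym.
      by apply: contra (@f_neq0 (nat_of_ord t, s) (ltn_ord t)) => /eqP/sqnorm_eq0 ->.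
    exact: (cvgM (cvgV ns cs) (fj j)).
  - move=> z; have z1 := set_valP z.
    have z0 : set_val z != 0.
      apply/eqP => z0; move: z1; rewrite [sphere3 R _](_ : _ = (sqnorm (set_val z) = 1)) // z0.
      by rewrite /sqnorm big1 => [/esym/eqP|j _]; rewrite ?oner_eq0 // mxE expr0n.
    have [w [c [wn c0 wE]]] := f_surj z0; have [u uE] := to_pt_exists wn.
    by exists u; apply: val_inj; rewrite -!set_valE gE uE wE normaliseZ.
  - move=> u v; split=> [/(congr1 (@set_val _ _))|/ident_f e].
      rewrite !gE => /normalise_eq[||c c0 e]; try exact: f_neq0.
      by apply: identified_pident; apply: f_inj e.
    by apply: val_inj; rewrite -!set_valE !gE e.
by exists h => // u; rewrite hE gE.
Qed.

Lemma S3_criterion : [/\ triangulates_S3 R T, one_vertex R T &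
  exists e : set (underlying_space R T), edge e /\ realises e (torus_knot R P Q)].
Proof.
have [h hh hE] := sphere_map.
have tn (u : tets R n) : ((to_pt u).1 < n)%N by exact: ltn_ord.
have quot_f u v : quot u = quot v -> exists2 c : R, 0 < c & f (to_pt u) = c *: f (to_pt v).
  move=> /(congr1 h)/(congr1 (@set_val _ _)); rewrite !hE.
  by apply: normalise_eq; exact: f_neq0.
have f_quot u v : f (to_pt u) = f (to_pt v) -> quot u = quot v.
  move=> e; apply/eqmodP; apply: identified_pident; apply: (@f_inj _ _ 1) => //.
  by rewrite scale1r.
split.
- split; last by exists h.
  split=> // t a b ab rev; have [u [v [[ut vt uab vab uv] neq]]] := f_reverse (ltn_ord t) ab.
  have [u' u'E] : exists u', to_pt u' = u by apply: to_pt_exists; rewrite ut.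
  have [v' v'E] : exists v', to_pt v' = v by apply: to_pt_exists; rewrite vt.
  have : quot u' = quot v'.
    apply: (rev u' v').
    - by apply/in_cell2; rewrite // u'E.
    - by apply/in_cell2; rewrite // v'E.
    - by move: uv; rewrite -u'E -v'E.
  by move=> /quot_f[c c0]; rewrite u'E v'E; exact: neq.
- have [w0 [w0n w0E _ _ _]] := @pt_exists4 R 0 1 0 0 0 ler01 (lexx 0) (lexx 0) (lexx 0) ltac:(by rewrite !addr0).
  have [u0 u0E] : exists u, to_pt u = w0 by apply: to_pt_exists; rewrite w0n.
  exists (quot u0); apply/seteqP; split=> y /=.
    move=> [t [a e]]; have [u ucell] : exists u : tets R n, in_cell t [set a]%SET u.
      have h0 (j : 'I_4) : 0 <= (j == a)%:R :> R by rewrite ler0n.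
      have h1 : (v0 == a)%:R + (v1 == a)%:R + (v2 == a)%:R + (v3 == a)%:R = 1 :> R.
        by move: a {e h0}; apply: I4_ind; rewrite /= ?addr0 ?add0r.
      have [w [wt wE]] := pt_exists t h0 h1.
      have [u uE] : exists u, to_pt u = w by apply: to_pt_exists; rewrite wt.
      by exists u; apply/in_cell1; rewrite uE wE eqxx.
    have : [set y] (quot u) by rewrite -e; exists u.
    move=> /= <-; apply: f_quot; have [ut ua] := (in_cell1 _ _ _).1 ucell.
    by rewrite u0E; apply: f_vertex ua w0E; rewrite ?w0n // tn.
  move=> ->; exists (Ordinal n0), v0; apply/seteqP; split=> [_ [u uc <-]|_ ->] /=.
    apply: f_quot; have [ut ua] := (in_cell1 _ _ _).1 uc.
    by rewrite u0E; apply: f_vertex ua w0E; rewrite ?w0n // tn.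
  by exists u0 => //; apply/in_cell1; rewrite u0E.
have [t [a [b [tn' ab k1 k2]]]] := f_knot.
exists (@quot R T @` in_cell (Ordinal tn') [set a; b]%SET); split; first by exists (Ordinal tn'), a, b.
exists h; split=> //; apply/seteqP; split=> [_ [_ [u uc <-] <-]|z [th zE]] /=.
  have [ut uab] := (in_cell2 _ _ ab).1 uc; have [th [c [c0 e]]] := k1 _ ut uab.
  by exists th; rewrite hE e normaliseZ //; exact: torus_curve_sphere.
have [w [c [wt wab c0 e]]] := k2 th.
have [u uE] : exists u, to_pt u = w by apply: to_pt_exists; rewrite wt.
exists (quot u); first by exists u => //; apply/in_cell2; rewrite // uE.
apply: val_inj; rewrite -!set_valE hE uE e normaliseZ //; exact: torus_curve_sphere.
Qed.

End Criterion.

(** * Polar coordinates and linear curves on the torus *)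

Section Polar.
Context (R : realType).
Implicit Types a b c d r t : R.

Lemma polar_eq r t r' t' : 0 <= r -> 0 <= r' ->
  r * cosT t = r' * cosT t' -> r * sinT t = r' * sinT t' -> r = r' /\ (r = 0 \/ eqm t t').
Proof.
move=> r0 r0' c s; have e : r ^+ 2 = r' ^+ 2.
  rewrite -[LHS]mulr1 -[RHS]mulr1 -{1}(cosT2DsinT2 t) -(cosT2DsinT2 t') !mulrDr -!exprMn c s.
  by [].
have {}e : r = r' by apply/eqP; rewrite -(@eqrXn2 _ 2) // e.
split=> //; have [->|rn] := eqVneq r 0; [by left | right].
by apply: eqmP; apply: (mulfI rn); rewrite ?c ?s e.
Qed.

Lemma polar_exists a b : exists r t, [/\ 0 <= r, a = r * cosT t & b = r * sinT t].
Proof.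
pose r := Num.sqrt (a ^+ 2 + b ^+ 2); have ab0 : 0 <= a ^+ 2 + b ^+ 2 by rewrite addr_ge0 ?sqr_ge0.
have rE : r ^+ 2 = a ^+ 2 + b ^+ 2 by rewrite sqr_sqrtr.
have [r0|r0] := eqVneq r 0.
  move: rE; rewrite r0 expr0n /= => /esym/eqP; rewrite paddr_eq0 ?sqr_ge0 // !sqrf_eq0 => /andP[/eqP -> /eqP ->].
  by exists 0, 0; rewrite !mul0r.
have [|t [ct st]] := @turn_exists R (a / r) (b / r).
  by rewrite !expr_div_n -mulrDl -rE divff // sqrf_eq0.
exists r, t; rewrite ct st mulrC divfK // mulrC divfK //; split=> //; exact: sqrtr_ge0.
Qed.

Definition row4 a b c d : 'rV[R]_4 := \row_j nth 0 [:: a; b; c; d] j.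

Lemma row4_eq a b c d (z : 'rV[R]_4) :
  row4 a b c d = z <-> [/\ a = z ord0 v0, b = z ord0 v1, c = z ord0 v2 & d = z ord0 v3].
Proof.
split=> [<-|[-> -> -> ->]]; first by rewrite !mxE.
by apply/rowP; apply: I4_ind; rewrite mxE.
Qed.

Lemma continuous_row4 (X : topologicalType) (f0 f1 f2 f3 : X -> R) (g : X -> 'rV[R]_4) :
  (forall x, g x = row4 (f0 x) (f1 x) (f2 x) (f3 x)) ->
  continuous f0 -> continuous f1 -> continuous f2 -> continuous f3 ->
  forall j, continuous (fun x => g x ord0 j).
Proof.
move=> gE c0 c1 c2 c3.
have e (j : 'I_4) : (fun x => g x ord0 j) = (fun x => nth 0 [:: f0 x; f1 x; f2 x; f3 x] j).
  by apply/funext => x; rewrite gE mxE.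
by apply: I4_ind; rewrite e.
Qed.

Lemma row4_torus_curve (P Q : int) l :
  row4 (cosT (P%:~R * l)) (sinT (P%:~R * l)) (cosT (Q%:~R * l)) (sinT (Q%:~R * l)) =
  Num.sqrt 2 *: torus_curve P Q (pi *+ 2 * l).
Proof.
have s2 : (Num.sqrt 2 : R) != 0 by rewrite gt_eqF // sqrtr_gt0.
have e (k : int) : k%:~R * (pi *+ 2 * l) = pi *+ 2 * (k%:~R * l) :> R by rewrite mulrCA.
by apply/rowP; apply: I4_ind; rewrite !mxE /= !e [RHS]mulrC divfK.
Qed.

(** Periodicity moves the parameter into [0,1], where it can serve as a barycentric coordinate along
    an edge. *)
Lemma torus_curve_turn (P Q : int) (th : R) : exists l : R, [/\ 0 <= l, l <= 1 &
  torus_curve P Q th = (Num.sqrt 2)^-1 *: row4 (cosT (P%:~R * l)) (sinT (P%:~R * l)) (cosT (Q%:~R * l)) (sinT (Q%:~R * l))].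
Proof.
have p2 : pi *+ 2 != 0 :> R by rewrite gt_eqF // (mulrn_wgt0 _ (@pi_gt0 R)).
pose k := th / (pi *+ 2); exists (k - (Num.floor k)%:~R); split.
- by rewrite subr_ge0 ge_floor.
- by have := floorD1_gt k; rewrite intrD; lra.
have kE (z : int) : eqm (z%:~R * (k - (Num.floor k)%:~R)) (z%:~R * k).
  by apply: eqmMz; apply: (@eqm_int _ (- Num.floor k)); rewrite rmorphN.
rewrite !(cosT_eqm (kE _)) !(sinT_eqm (kE _)) row4_torus_curve scalerA mulVf ?scale1r.
  by rewrite [X in _ = torus_curve _ _ X]mulrC divfK.
by rewrite gt_eqF // sqrtr_gt0.
Qed.

(** A fundamental parallelogram is cut by a diagonal into the triangle of [X] and, up to a lattice
    translation, its image under the central symmetry, which is the triangle of [Y]. *)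
Lemma torus_cover (al p be q : int) (x0 y0 : R) :
  al * q - be * p = 1 \/ al * q - be * p = -1 ->
  exists l0 l1 l2 : R, [/\ 0 <= l0, 0 <= l1, 0 <= l2, l0 + l1 + l2 = 1 &
   (eqm x0 (l2 * be%:~R + l1 * (al + be)%:~R) /\ eqm y0 (l2 * q%:~R + l1 * (p + q)%:~R)) \/
   (eqm x0 (- (l2 * be%:~R + l1 * (al + be)%:~R)) /\ eqm y0 (- (l2 * q%:~R + l1 * (p + q)%:~R)))].
Proof.
move=> D; have [a0 [b0 [xE yE]]] := det_int_ex D x0 y0.
(* Change of basis: (al,p) is (al+be,p+q) minus (be,q), so the coordinates in the latter two are a0
   + b0 and - a0, reduced modulo 1. *)
pose a := (a0 + b0) - (Num.floor (a0 + b0))%:~R; pose b := - a0 - (Num.floor (- a0))%:~R.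
have a_0 : 0 <= a by rewrite subr_ge0 ge_floor.
have b_0 : 0 <= b by rewrite subr_ge0 ge_floor.
have a_1 : a < 1 by have := floorD1_gt (a0 + b0); rewrite /a intrD; lra.
have b_1 : b < 1 by have := floorD1_gt (- a0); rewrite /b intrD; lra.
have [ab|ab] := leP (a + b) 1.
  exists (1 - a - b), a, b; split=> //; [lra|lra|left; split].
    by rewrite xE; apply: (@eqm_int _ (Num.floor (a0 + b0) * (al + be) + Num.floor (- a0) * be)); rewrite /a /b; ring.
  by rewrite yE; apply: (@eqm_int _ (Num.floor (a0 + b0) * (p + q) + Num.floor (- a0) * q)); rewrite /a /b; ring.
exists (a + b - 1), (1 - a), (1 - b); split=> //; [lra|lra|lra|lra|right; split].
  by rewrite xE; apply: (@eqm_int _ ((Num.floor (a0 + b0) + 1) * (al + be) + (Num.floor (- a0) + 1) * be)); rewrite /a /b; ring.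
by rewrite yE; apply: (@eqm_int _ ((Num.floor (a0 + b0) + 1) * (p + q) + (Num.floor (- a0) + 1) * q)); rewrite /a /b; ring.
Qed.

End Polar.

Section EdgePoints.
Context (R : realType).
Local Notation pt := (point_of_tets R).

Lemma edge_points t (a b : 'I_4) (l : R) : a != b -> 0 <= l -> l <= 1 ->
  exists u : pt, [/\ u.1 = t, bc u a = 1 - l & bc u b = l].
Proof.
move=> ab l0 l1.
have [||||u [ut uE]] := @pon_face_exists R (t, (a, b, b)) (1 - l) l 0; [lra|lra|lra|lra|].
exists u; split=> //; rewrite !uE !mul0r addr0 eqxx.
  by rewrite (negPf ab) mulr0 addr0 mulr1.
by rewrite eq_sym (negPf ab) mulr0 add0r mulr1.
Qed.

(** Two mirror points near the midpoint, at distance 1/(2k) with k = |d1| + |d2|: multiplied by a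
    nonzero d1 or by d2, the distance has absolute value in (0, 1/2] and cannot be an integer. *)
Lemma reverse_points t (a b : 'I_4) (d1 d2 : int) : a != b -> d2 != 0 ->
  exists u v : pt, [/\ u.1 = t, v.1 = t, bc u a + bc u b = 1, bc v a + bc v b = 1 & bc u a = bc v b] /\
  [/\ 0 < bc u a, 0 < bc u b, d1 != 0 -> ~ eqm (bc u b * d1%:~R) (bc v b * d1%:~R) &
      ~ eqm (bc u b * d2%:~R) (bc v b * d2%:~R)].
Proof.
move=> ab d20; pose k : R := (`|d1| + `|d2|)%:~R.
have k1 : 1 <= k by rewrite /k -[1]/(1%:~R) ler_int; lia.
have k0 : 0 < k by lra.
pose de := (2 * k)^-1; have dk : de * k = 1 / 2 by rewrite /de invfM -mulrA mulVf ?mulr1 ?div1r ?gt_eqF.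
have de0 : 0 < de by rewrite invr_gt0; lra.
have de1 : de <= 1 / 2 by nra.
have [||u [ut ua ub]] := @edge_points t a b ((1 - de) / 2) ab; [lra|lra|].
have [||v [vt va vb]] := @edge_points t a b ((1 + de) / 2) ab; [lra|lra|].
have nint (d : int) : d != 0 -> (`|d| <= `|d1| + `|d2|)%R -> ~ eqm (bc u b * d%:~R) (bc v b * d%:~R).
  move=> d0 dk' /intrP[z].
  have -> : bc u b * d%:~R - bc v b * d%:~R = - de * d%:~R by rewrite ub vb; field.
  move=> /(congr1 Num.norm); rewrite mulNr normrN normrM -!intr_norm (gtr0_norm de0) => zE.
  have h1 : 0 < (`|z|)%:~R :> R by rewrite -zE mulr_gt0 // ltr0z normr_gt0.
  have h2 : (`|z|)%:~R < 1%:~R :> R.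
    have : de * `|d|%:~R <= de * k by rewrite ler_pM2l // ler_int.
    by rewrite zE dk /=; lra.
  by move: h1 h2; rewrite ltr0z ltr_int; lia.
exists u, v; split; first by split=> //; lra.
split; [lra | lra | move=> d10 | ]; apply: nint => //; lia.
Qed.

End EdgePoints.

Section ModelFacts.
Context (R : realType).
Local Notation pt := (point_of_tets R).
Context (n : nat) (ps : seq pairing) (X Y : face) (al p be q : int) (r x y : pt -> R).
Hypothesis M : solid_model n ps X Y al p be q r x y.
Hypothesis D : al * q - be * p = 1 \/ al * q - be * p = -1.

Lemma model_vertex_eqm (u : pt) j : (u.1 < n)%N -> bc u j = 1 -> eqm (x u) 0 /\ eqm (y u) 0.
Proof.
move=> un uj; have [i ij] : exists i, i != j.
  by have [->|j0] := eqVneq j v0; [exists v1 | exists v0; rewrite eq_sym].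
have [d1 [d2 [_ _ /(_ u erefl)]]] := model_edge M un ij.
have ui : bc u i = 0.
  have s := bc_sum u; have h0 := bc_ge0 u v0; have h1 := bc_ge0 u v1.
  have h2 := bc_ge0 u v2; have h3 := bc_ge0 u v3.
  by move: j i ij uj; apply: I4_ind; apply: I4_ind => // _ uj; lra.
rewrite ui uj add0r !mul1r => /(_ erefl)[xu yu].
by split; [apply: eqm_trans xu _ | apply: eqm_trans yu _]; rewrite /eqm subr0 intr_int.
Qed.

(** Lets a point of radius 1 be replaced by one on a boundary triangle, where the gluing to the
    other side or the fold can act. *)
Lemma model_boundary (u : pt) : r u = 1 -> exists l0 l1 l2 w,
  [/\ [/\ 0 <= l0, 0 <= l1, 0 <= l2 & l0 + l1 + l2 = 1], (w.1 < n)%N, same_point r x y u w &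
    (pon_face X l0 l1 l2 w \/ pon_face Y l0 l1 l2 w)].
Proof.
move=> ru; have [l0 [l1 [l2 [p0 p1 p2 s h]]]] := torus_cover (x u) (y u) D.
have [Xn Yn _] := model_faces M.
exists l0, l1, l2; case: h => -[xu yu].
  have [w wX] := pon_face_exists X p0 p1 p2 s; exists w; have [rw xw yw] := model_X M wX.
  split=> //; first by move: wX; case: (X) Xn => t [[a b] c] /= tn [-> _].
    by split; rewrite ?ru ?rw //; [apply: eqm_trans yu _; exact: eqm_sym | right; apply: eqm_trans xu _; exact: eqm_sym].
  by left.
have [w wX] := pon_face_exists Y p0 p1 p2 s; exists w; have [rw xw yw] := model_Y M wX.
split=> //; first by move: wX; case: (Y) Yn => t [[a b] c] /= tn [-> _].
  by split; rewrite ?ru ?rw //; [apply: eqm_trans yu _; exact: eqm_sym | right; apply: eqm_trans xu _; exact: eqm_sym].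
by right.
Qed.

Lemma model_X_edge t (a b c : 'I_4) : X = (t, (a, b, c)) -> uniq [:: a; b; c] ->
  forall u : pt, u.1 = t -> bc u a + bc u b = 1 ->
  [/\ r u = 1, eqm (x u) ((al + be)%:~R * bc u b) & eqm (y u) ((p + q)%:~R * bc u b)].
Proof.
move=> XE abc u ut uab; have ab : a != b by move: abc; rewrite /= inE negb_or => /and3P[/andP[]].
have uX : pon_face X (bc u a) (bc u b) 0 u.
  rewrite XE; split=> // j; rewrite mul0r addr0.
  have [->|ja] := eqVneq j a; first by rewrite (negPf ab) mulr0 addr0 mulr1.
  have [->|jb] := eqVneq j b; first by rewrite mulr0 add0r mulr1.
  rewrite !mulr0 addr0; have s := bc_sum u; have h0 := bc_ge0 u v0; have h1 := bc_ge0 u v1.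
  have h2 := bc_ge0 u v2; have h3 := bc_ge0 u v3.
  by move: a b j ab ja jb uab {XE abc}; apply: I4_ind; apply: I4_ind => // j ab ja jb uab;
    move: j ja jb; apply: I4_ind => // _ _; lra.
by have [ru xu yu] := model_X M uX; move: xu yu; rewrite !mul0r !add0r ![bc u b * _]mulrC; split.
Qed.

End ModelFacts.

(** * Gluing two solid tori *)

Lemma pon_face_tet (R : realType) F (l0 l1 l2 : R) (u : point_of_tets R) :
  pon_face F l0 l1 l2 u -> u.1 = F.1.
Proof. by case: F => t [[a b] c] []. Qed.

Section Union.
Context (R : realType).
Local Notation pt := (point_of_tets R).
Context (n m : nat) (ps ps' : seq pairing) (X Y X' Y' : face) (al p be q : int).
Context (r x y r1 x1 y1 : pt -> R).
Hypothesis M : solid_model n ps X Y al p be q r x y.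
Hypothesis M1 : solid_model m ps' X' Y' p al q be r1 x1 y1.
Hypothesis D : al * q - be * p = 1 \/ al * q - be * p = -1.
Hypothesis cL : closed_torus (Solid n ps X Y).
Hypothesis cL' : closed_torus (Solid m ps' X' Y').

Let T := lst_union (Solid n ps X Y) (Solid m ps' X' Y').

Let D1 : p * be - q * al = 1 \/ p * be - q * al = -1.
Proof.
have -> : p * be - q * al = - (al * q - be * p) by ring.
by case: D => ->; [right | left; rewrite opprK].
Qed.

Definition shift_pt (u : pt) : pt := ((n + u.1)%N, u.2).
Definition unshift_pt (u : pt) : pt := ((u.1 - n)%N, u.2).

Lemma shift_ptK (u : pt) : unshift_pt (shift_pt u) = u.
Proof. by case: u => t s; rewrite /unshift_pt /= addKn. Qed.

Lemma unshift_ptK (u : pt) : (n <= u.1)%N -> shift_pt (unshift_pt u) = u.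
Proof. by case: u => t s /= nt; rewrite /shift_pt /= subnKC. Qed.

Lemma pon_face_shift F (l0 l1 l2 : R) (u : pt) :
  pon_face F l0 l1 l2 u -> pon_face (shift_face n F) l0 l1 l2 (shift_pt u).
Proof. by case: F => t [[a b] c] [<- uE]. Qed.

Lemma pon_face_unshift F (l0 l1 l2 : R) (u : pt) :
  pon_face (shift_face n F) l0 l1 l2 u -> exists2 w, pon_face F l0 l1 l2 w & u = shift_pt w.
Proof.
case: F => t [[a b] c] [ut uE]; exists (unshift_pt u).
  by split=> //=; rewrite ut addKn.
by rewrite unshift_ptK // ut leq_addr.
Qed.

Lemma pident_left (u v : pt) : pident ps u v -> pident (pairings T) u v.
Proof. by apply: pident_sub => P h; rewrite /= mem_cat h. Qed.

Lemma pident_right (u v : pt) : pident ps' u v -> pident (pairings T) (shift_pt u) (shift_pt v).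
Proof.
elim=> {u v} [u v|u|u v _ IH|u v w _ IH1 _ IH2].
- move=> [F [G [l0 [l1 [l2 [h uF vG]]]]]].
  apply: (@pident_step _ (shift_face n F) (shift_face n G) l0 l1 l2); last 2 first.
  + exact: pon_face_shift.
  + exact: pon_face_shift.
  by rewrite /= !mem_cat; apply/or3P/Or32; apply/mapP; exists (F, G).
- exact: rst_refl.
- exact: rst_sym.
- exact: rst_trans IH1 IH2.
Qed.

Lemma pident_X (l0 l1 l2 : R) (u v : pt) : pon_face X l0 l1 l2 u -> pon_face X' l0 l1 l2 v ->
  pident (pairings T) u (shift_pt v).
Proof.
move=> uX vX; apply: (pident_step _ uX (pon_face_shift vX)).
by rewrite /= !mem_cat !inE eqxx !orbT.
Qed.

Lemma pident_Y (l0 l1 l2 : R) (u v : pt) : pon_face Y l0 l1 l2 u -> pon_face Y' l0 l1 l2 v ->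
  pident (pairings T) u (shift_pt v).
Proof.
move=> uX vX; apply: (pident_step _ uX (pon_face_shift vX)).
by rewrite /= !mem_cat !inE eqxx !orbT.
Qed.

(** The half of the sphere where the first complex coordinate dominates, scaled so that this
    coordinate has modulus 1. In [union_right] the roles are exchanged, in accordance with the
    transposed slopes of the second model. *)
Definition union_left (u : pt) : 'rV[R]_4 :=
  row4 (cosT (y u)) (sinT (y u)) (r u * cosT (x u)) (r u * sinT (x u)).
Definition union_right (u : pt) : 'rV[R]_4 :=
  row4 (r1 u * cosT (x1 u)) (r1 u * sinT (x1 u)) (cosT (y1 u)) (sinT (y1 u)).
Definition union_map (u : pt) : 'rV[R]_4 :=
  if (u.1 < n)%N then union_left u else union_right (unshift_pt u).

Lemma union_map_left u : (u.1 < n)%N -> union_map u = union_left u.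
Proof. by rewrite /union_map => ->. Qed.

Lemma union_map_right u : union_map (shift_pt u) = union_right u.
Proof. by rewrite /union_map shift_ptK /= ltnNge leq_addr. Qed.

Lemma union_split (u : pt) : (u.1 < n + m)%N ->
  (u.1 < n)%N \/ exists2 w : pt, (w.1 < m)%N & u = shift_pt w.
Proof.
move=> un; have [|nu] := ltnP u.1 n; [by left | right].
by exists (unshift_pt u); rewrite ?unshift_ptK //=; lia.
Qed.

Lemma union_left_same u v : same_point r x y u v -> union_left u = union_left v.
Proof.
move=> [rE yE xE]; rewrite /union_left (cosT_eqm yE) (sinT_eqm yE) rE.
by case: xE => [r0|xE]; [rewrite -rE r0 !mul0r | rewrite (cosT_eqm xE) (sinT_eqm xE)].
Qed.

Lemma union_right_same u v : same_point r1 x1 y1 u v -> union_right u = union_right v.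
Proof.
move=> [rE yE xE]; rewrite /union_right (cosT_eqm yE) (sinT_eqm yE) rE.
by case: xE => [r0|xE]; [rewrite -rE r0 !mul0r | rewrite (cosT_eqm xE) (sinT_eqm xE)].
Qed.

Lemma union_boundary u v : r u = 1 -> r1 v = 1 -> eqm (x u) (y1 v) -> eqm (y u) (x1 v) ->
  union_left u = union_right v.
Proof.
move=> ru rv xy yx; rewrite /union_left /union_right ru rv !mul1r.
by rewrite (cosT_eqm xy) (cosT_eqm yx) (sinT_eqm xy) (sinT_eqm yx).
Qed.

Lemma union_glue u v : pglued (pairings T) u v -> union_map u = union_map v.
Proof.
move=> [F [G [l0 [l1 [l2 [h uF vG]]]]]]; move: h; rewrite /= !mem_cat !inE => /or3P[h|h|/orP[]/eqP[FE GE]].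
- have [_ _ /(_ _ h)[Fn Gn]] := model_faces M.
  have uv : pglued ps u v by exists F, G, l0, l1, l2.
  rewrite !union_map_left ?(pon_face_tet uF) ?(pon_face_tet vG) //.
  exact: union_left_same (model_glue M uv).
- move: h => /mapP[[F' G'] h [FE GE]]; rewrite FE in uF; rewrite GE in vG.
  have [u' uF' ->] := pon_face_unshift uF; have [v' vG' ->] := pon_face_unshift vG.
  rewrite !union_map_right; apply: union_right_same; apply: (model_glue M1).
  by exists F', G', l0, l1, l2.
- rewrite FE in uF; rewrite GE in vG.
  have [v' vG' ->] := pon_face_unshift vG; rewrite union_map_right.
  have [Xn _ _] := model_faces M; rewrite union_map_left ?(pon_face_tet uF) //.
  have [ru xu yu] := model_X M uF; have [rv xv yv] := model_X M1 vG'.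
  by apply: union_boundary => //; [apply: eqm_trans xu _ | apply: eqm_trans yu _]; exact: eqm_sym.
- rewrite FE in uF; rewrite GE in vG.
  have [v' vG' ->] := pon_face_unshift vG; rewrite union_map_right.
  have [_ Xn _] := model_faces M; rewrite union_map_left ?(pon_face_tet uF) //.
  have [ru xu yu] := model_Y M uF; have [rv xv yv] := model_Y M1 vG'.
  by apply: union_boundary => //; [apply: eqm_trans xu _ | apply: eqm_trans yu _]; exact: eqm_sym.
Qed.

Lemma circle_polar (c : R) t r' t' : 0 < c -> 0 <= r' -> cosT t = c * (r' * cosT t') ->
  sinT t = c * (r' * sinT t') -> c * r' = 1 /\ eqm t t'.
Proof.
move=> c0 r0; rewrite !mulrA => ce se.
have [||||<- [/eqP|e]] := @polar_eq R 1 t (c * r') t'; rewrite ?mul1r ?mulr_ge0 // 1?ltW //.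
by rewrite oner_eq0.
Qed.

Lemma union_left_inj u v (c : R) : (u.1 < n)%N -> (v.1 < n)%N -> 0 < c ->
  union_left u = c *: union_left v -> c = 1 /\ same_point r x y u v.
Proof.
move=> un vn c0 /row4_eq; rewrite !mxE /= => -[e0 e1 e2 e3].
have /andP[ru _] := model_range M un; have /andP[rv _] := model_range M vn.
have [||c1 ye] := @circle_polar c (y u) 1 (y v) c0 ler01; rewrite ?mul1r //.
rewrite mulr1 in c1; rewrite c1 !mul1r in e2 e3.
by have [rE xE] := polar_eq ru rv e2 e3; split.
Qed.

Lemma union_right_inj u v (c : R) : (u.1 < m)%N -> (v.1 < m)%N -> 0 < c ->
  union_right u = c *: union_right v -> c = 1 /\ same_point r1 x1 y1 u v.
Proof.
move=> un vn c0 /row4_eq; rewrite !mxE /= => -[e2 e3 e0 e1].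
have /andP[ru _] := model_range M1 un; have /andP[rv _] := model_range M1 vn.
have [||c1 ye] := @circle_polar c (y1 u) 1 (y1 v) c0 ler01; rewrite ?mul1r //.
rewrite mulr1 in c1; rewrite c1 !mul1r in e2 e3.
by have [rE xE] := polar_eq ru rv e2 e3; split.
Qed.

(** Comparing moduli gives 1 = c [r1 v] and [r u] = c, so the two radii have product 1; being at
    most 1, both are 1. The chain then crosses through a common boundary triangle, reached on each
    side by injectivity of the model. *)
Lemma union_left_right u v (c : R) : (u.1 < n)%N -> (v.1 < m)%N -> 0 < c ->
  union_left u = c *: union_right v -> pident (pairings T) u (shift_pt v).
Proof.
move=> un vn c0 /row4_eq; rewrite !mxE /= => -[e0 e1 e2 e3].
have /andP[ru ru1] := model_range M un; have /andP[rv rv1] := model_range M1 vn.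
have [cr1 yx] := circle_polar c0 rv e0 e1.
have [rc [r0|xy]] := polar_eq ru (ltW c0) e2 e3; first by move: c0; rewrite -rc r0 ltxx.
have r1v : r1 v = 1.
  apply/le_anti; rewrite rv1 /= -cr1 -rc; have : r u * r1 v <= 1 * r1 v by rewrite ler_wpM2r.
  by rewrite mul1r.
have r_u : r u = 1 by rewrite rc -cr1 r1v mulr1.
have [l0 [l1 [l2 [w [[p0 p1 p2 s] wm sw h]]]]] := model_boundary M1 D1 r1v.
have [_ /eqm_sym yw [r0|/eqm_sym xw]] := sw; first by move: r1v; rewrite r0 => /esym/eqP; rewrite oner_eq0.
case: h => h.
  have [z zX] := pon_face_exists X p0 p1 p2 s; have [Xn _ _] := model_faces M.
  have zn : (z.1 < n)%N by rewrite (pon_face_tet zX).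
  apply: (rst_trans _ _ _ z); last apply: (rst_trans _ _ _ (shift_pt w)).
  - apply: pident_left; apply: (model_inj M) => //.
    have [rz xz yz] := model_X M zX; have [_ xw' yw'] := model_X M1 h.
    split; rewrite ?rz //; [|right].
      by apply: eqm_trans yx _; apply: eqm_trans (eqm_sym xw) _; apply: eqm_trans xw' _; exact: eqm_sym.
    by apply: eqm_trans xy _; apply: eqm_trans (eqm_sym yw) _; apply: eqm_trans yw' _; exact: eqm_sym.
  - exact: pident_X zX h.
  - by apply: pident_right; apply: (model_inj M1) => //; exact: same_point_sym.
have [z zX] := pon_face_exists Y p0 p1 p2 s; have [_ Xn _] := model_faces M.
have zn : (z.1 < n)%N by rewrite (pon_face_tet zX).
apply: (rst_trans _ _ _ z); last apply: (rst_trans _ _ _ (shift_pt w)).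
- apply: pident_left; apply: (model_inj M) => //.
  have [rz xz yz] := model_Y M zX; have [_ xw' yw'] := model_Y M1 h.
  split; rewrite ?rz //; [|right].
    by apply: eqm_trans yx _; apply: eqm_trans (eqm_sym xw) _; apply: eqm_trans xw' _; exact: eqm_sym.
  by apply: eqm_trans xy _; apply: eqm_trans (eqm_sym yw) _; apply: eqm_trans yw' _; exact: eqm_sym.
- exact: pident_Y zX h.
- by apply: pident_right; apply: (model_inj M1) => //; exact: same_point_sym.
Qed.

Lemma union_inj u v (c : R) : (u.1 < n + m)%N -> (v.1 < n + m)%N -> 0 < c ->
  union_map u = c *: union_map v -> pident (pairings T) u v.
Proof.
move=> /union_split[un|[u' un ->]] /union_split[vn|[v' vn ->]] c0;
  rewrite ?union_map_right ?union_map_left // => e.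
- by have [_ suv] := union_left_inj un vn c0 e; apply: pident_left; exact: (model_inj M).
- exact: union_left_right e.
- apply: rst_sym; apply: (@union_left_right _ _ c^-1) => //; first by rewrite invr_gt0.
  by rewrite e scalerA mulVf ?scale1r // gt_eqF.
- by have [_ suv] := union_right_inj un vn c0 e; apply: pident_right; exact: (model_inj M1).
Qed.

Lemma union_neq0 u : (u.1 < n + m)%N -> union_map u != 0.
Proof.
move=> /union_split[un|[w wm ->]]; rewrite ?union_map_right ?union_map_left //.
  apply/eqP => /row4_eq; rewrite !mxE => -[e0 e1 _ _].
  by have := cosT2DsinT2 (y u); rewrite e0 e1 expr0n addr0 => /esym/eqP; rewrite oner_eq0.
apply/eqP => /row4_eq; rewrite !mxE => -[_ _ e0 e1].
by have := cosT2DsinT2 (y1 w); rewrite e0 e1 expr0n addr0 => /esym/eqP; rewrite oner_eq0.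
Qed.

(** Dividing by the larger of the two moduli decides which solid torus is hit and leaves a radius in
    [0,1]. *)
Lemma union_surj (z : 'rV[R]_4) : z != 0 -> exists u c, [/\ (u.1 < n + m)%N, 0 < c & union_map u = c *: z].
Proof.
move=> z0; have [a [s [a0 z0E z1E]]] := polar_exists (z ord0 v0) (z ord0 v1).
have [b [t [b0 z2E z3E]]] := polar_exists (z ord0 v2) (z ord0 v3).
have ab : 0 < a \/ 0 < b.
  have [|an] := ltP 0 a; first by left.
  have [|bn] := ltP 0 b; first by right.
  have a0' : a = 0 by apply/le_anti; rewrite a0 an.
  have b0' : b = 0 by apply/le_anti; rewrite b0 bn.
  exfalso; move/eqP: z0; apply; apply/rowP; apply: I4_ind;
    by rewrite mxE ?z0E ?z1E ?z2E ?z3E ?a0' ?b0' mul0r.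
have [ba|ab'] := leP b a.
  have ap : 0 < a by case: ab => // bp; exact: lt_le_trans ba.
  have h : 0 <= b / a <= 1 by rewrite divr_ge0 //= ler_pdivrMr // mul1r.
  have [u [un ru yu xu]] := model_surj M t s h.
  exists u, a^-1; split; [exact: ltn_addr | by rewrite invr_gt0 |].
  rewrite union_map_left //; apply/row4_eq; rewrite !mxE z0E z1E z2E z3E !mulrA mulVf ?gt_eqF // !mul1r.
  rewrite (cosT_eqm yu) (sinT_eqm yu) ru [_^-1 * _]mulrC; split=> //.
    by case: xu => [->|xu]; [rewrite !mul0r | rewrite (cosT_eqm xu)].
  by case: xu => [->|xu]; [rewrite !mul0r | rewrite (sinT_eqm xu)].
have bp : 0 < b by exact: le_lt_trans ab'.
have h : 0 <= a / b <= 1 by rewrite divr_ge0 //= ler_pdivrMr // mul1r ltW.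
have [u [un ru yu xu]] := model_surj M1 s t h.
exists (shift_pt u), b^-1; split; [by rewrite ltn_add2l | by rewrite invr_gt0 |].
rewrite union_map_right //; apply/row4_eq; rewrite !mxE z0E z1E z2E z3E !mulrA mulVf ?gt_eqF // !mul1r.
rewrite (cosT_eqm yu) (sinT_eqm yu) ru [_^-1 * _]mulrC; split=> //.
  by case: xu => [->|xu]; [rewrite !mul0r | rewrite (cosT_eqm xu)].
by case: xu => [->|xu]; [rewrite !mul0r | rewrite (sinT_eqm xu)].
Qed.

Lemma union_cont t : (t < n + m)%N -> forall j, continuous (fun s => union_map (t, s) ord0 j).
Proof.
move=> tnm; have [tn|nt] := ltnP t n.
  have [cr cc cs cy] := model_cont M tn.
  apply: (@continuous_row4 _ _ (fun s => cosT (y (t, s))) (fun s => sinT (y (t, s)))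
    (fun s => r (t, s) * cosT (x (t, s))) (fun s => r (t, s) * sinT (x (t, s)))) => //.
  - by move=> s; rewrite union_map_left.
  - by move=> s; have [] := cy s.
  - by move=> s; have [] := cy s.
have tm : (t - n < m)%N by lia.
have [cr cc cs cy] := model_cont M1 tm.
apply: (@continuous_row4 _ _ (fun s => r1 ((t - n)%N, s) * cosT (x1 ((t - n)%N, s)))
  (fun s => r1 ((t - n)%N, s) * sinT (x1 ((t - n)%N, s)))
  (fun s => cosT (y1 ((t - n)%N, s))) (fun s => sinT (y1 ((t - n)%N, s)))) => //.
- by move=> s; rewrite /union_map /= ltnNge nt.
- by move=> s; have [] := cy s.
- by move=> s; have [] := cy s.
Qed.

Lemma union_vertex u j : (u.1 < n + m)%N -> bc u j = 1 -> union_map u = row4 1 0 1 0.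
Proof.
move=> /union_split[un|[w wm ->]] uj; rewrite ?union_map_right ?union_map_left //.
  have [xu yu] := model_vertex_eqm M un uj; have ru := model_vertex M un uj.
  by rewrite /union_left ru (cosT_eqm xu) (cosT_eqm yu) (sinT_eqm xu) (sinT_eqm yu) cosT0 sinT0 mulr1 mulr0.
have [xu yu] := model_vertex_eqm M1 wm uj; have ru := model_vertex M1 wm uj.
by rewrite /union_right ru (cosT_eqm xu) (cosT_eqm yu) (sinT_eqm xu) (sinT_eqm yu) cosT0 sinT0 mulr1 mulr0.
Qed.

Lemma union_reverse t (a b : 'I_4) : (t < n + m)%N -> a != b -> exists u v : pt,
  [/\ u.1 = t, v.1 = t, bc u a + bc u b = 1, bc v a + bc v b = 1 & bc u a = bc v b] /\
  forall c : R, 0 < c -> union_map u <> c *: union_map v.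
Proof.
move=> tnm ab; have [tn|nt] := ltnP t n.
  have [d1 [d2 [d20 _ h]]] := model_edge M tn ab.
  have [u [v [[ut vt uab vab uv] [_ _ _ neq]]]] := @reverse_points R t a b d1 d2 ab d20.
  have un : (u.1 < n)%N by rewrite ut.
  have vn : (v.1 < n)%N by rewrite vt.
  exists u, v; split=> // c c0; rewrite !union_map_left // => /(union_left_inj un vn c0)[_ [_ yE _]].
  apply: neq; have [_ yu] := h u ut uab; have [_ yv] := h v vt vab.
  by apply: eqm_trans (eqm_sym yu) _; apply: eqm_trans yE _.
have tm : (t - n < m)%N by lia.
have [d1 [d2 [d20 _ h]]] := model_edge M1 tm ab.
have [u [v [[ut vt uab vab uv] [_ _ _ neq]]]] := @reverse_points R (t - n) a b d1 d2 ab d20.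
have un : (u.1 < m)%N by rewrite ut.
have vn : (v.1 < m)%N by rewrite vt.
exists (shift_pt u), (shift_pt v); split=> [|c c0]; first by split=> //=; rewrite ?ut ?vt subnKC.
rewrite !union_map_right => /(union_right_inj un vn c0)[_ [_ yE _]].
apply: neq; have [_ yu] := h u ut uab; have [_ yv] := h v vt vab.
by apply: eqm_trans (eqm_sym yu) _; apply: eqm_trans yE _.
Qed.

(** The edge from the first to the second corner of [X] is the (p+q)-edge. It has radius 1 and both
    angles are linear in the edge parameter, with slopes p+q and al+be. *)
Lemma union_knot : exists t (a b : 'I_4), [/\ (t < n + m)%N, a != b,
  forall u : pt, u.1 = t -> bc u a + bc u b = 1 -> exists th (c : R),
    0 < c /\ union_map u = c *: torus_curve (p + q) (al + be) th &
  forall th, exists (u : pt) (c : R),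
    [/\ u.1 = t, bc u a + bc u b = 1, 0 < c & union_map u = c *: torus_curve (p + q) (al + be) th]].
Proof.
have s2 : 0 < (Num.sqrt 2 : R) by rewrite sqrtr_gt0.
have [Xn _ _] := model_faces M.
have /(cL.1 X)[_] : X \in faces_of ps ++ [:: X; Y] by rewrite mem_cat !inE eqxx orbT.
case XE : X Xn => [t [[a b] c]] /= tn abc.
have ab : a != b by move: abc; rewrite inE negb_or => /andP[/andP[]].
have edge u : u.1 = t -> bc u a + bc u b = 1 -> union_map u =
    row4 (cosT ((p + q)%:~R * bc u b)) (sinT ((p + q)%:~R * bc u b))
      (cosT ((al + be)%:~R * bc u b)) (sinT ((al + be)%:~R * bc u b)).
  move=> ut uab; have [ru xu yu] := model_X_edge M XE abc ut uab.
  rewrite union_map_left ?ut // /union_left ru !mul1r.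
  by rewrite (cosT_eqm xu) (cosT_eqm yu) (sinT_eqm xu) (sinT_eqm yu).
exists t, a, b; split=> //; first exact: ltn_addr.
  by move=> u ut uab; exists (pi *+ 2 * bc u b), (Num.sqrt 2); rewrite edge // row4_torus_curve.
move=> th; have [l [l0 l1 ->]] := torus_curve_turn (p + q) (al + be) th.
have [u [ut ua ub]] := @edge_points R t a b l ab l0 l1.
exists u, (Num.sqrt 2); have uab : bc u a + bc u b = 1 by rewrite ua ub subrK.
by split=> //; rewrite edge // ub scalerA mulfV ?scale1r // gt_eqF.
Qed.

Lemma union_S3 : [/\ triangulates_S3 R T, one_vertex R T &
  exists e : set (underlying_space R T), edge e /\ realises e (torus_knot R (p + q) (al + be))].
Proof.
have n0 : (0 < n)%N by have [Xn _ _] := model_faces M; exact: leq_ltn_trans Xn.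
apply: (@S3_criterion _ _ (closed_union_solid cL cL') _ _ union_map).
- by rewrite /= addn_gt0 n0.
- exact: union_cont.
- exact: union_neq0.
- exact: union_glue.
- exact: union_inj.
- exact: union_surj.
- by move=> u v j k un vn uj vk; rewrite (union_vertex un uj) (union_vertex vn vk).
- exact: union_reverse.
- exact: union_knot.
Qed.

End Union.

(** * Folding one solid torus *)

Section Ellipses.
Context (R : realType).
Implicit Types r c s A B q : R.

(** The ellipses with semi-axes (1+r)/r and (1-r)/r shrink strictly as r grows. A common point would
    force c^2 <= c'^2 and s^2 <= s'^2; both pairs have sum 1, so equality holds, and then all
    squares vanish. Denominators are cleared, and the ellipse may be the degenerate one at r' =
    1. *)
Lemma ellipse_lt r r' c s c' s' : 0 < r -> r' <= 1 -> c ^+ 2 + s ^+ 2 = 1 -> c' ^+ 2 + s' ^+ 2 = 1 ->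
  r' * (1 + r) * c = r * (1 + r') * c' -> r' * (1 - r) * s = r * (1 - r') * s' -> r < r' -> False.
Proof.
move=> r0 r1 cs cs' ec es rr.
pose al := r' * (1 + r); pose be := r * (1 + r'); pose ga := r' * (1 - r); pose de := r * (1 - r').
have be0 : 0 < be by rewrite /be mulr_gt0 //; lra.
have ab : be < al by rewrite /al /be; lra.
have de0 : 0 <= de by rewrite /de mulr_ge0 //; lra.
have gd : de < ga by rewrite /ga /de; lra.
have e1 : al ^+ 2 * c ^+ 2 = be ^+ 2 * c' ^+ 2 by rewrite -!exprMn; congr (_ ^+ 2).
have e2 : ga ^+ 2 * s ^+ 2 = de ^+ 2 * s' ^+ 2 by rewrite -!exprMn; congr (_ ^+ 2).
have ab2 : be ^+ 2 < al ^+ 2 by rewrite ltr_pXn2r // nnegrE ltW // (lt_trans be0).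
have gd2 : de ^+ 2 < ga ^+ 2 by rewrite ltr_pXn2r // nnegrE // ltW // (le_lt_trans de0).
have be2 : 0 < be ^+ 2 by rewrite exprn_gt0.
move: (sqr_ge0 c) (sqr_ge0 s) (sqr_ge0 c') (sqr_ge0 s') e1 e2 ab2 gd2 be2 (sqr_ge0 de) cs cs'.
move: (al ^+ 2) (be ^+ 2) (ga ^+ 2) (de ^+ 2) (c ^+ 2) (s ^+ 2) (c' ^+ 2) (s' ^+ 2).
clear; move=> a b g d C S C' S' C0 S0 C0' S0' e1 e2 ab gd b0 d0 cs cs'.
have CC : C <= C'.
  rewrite -(ler_pM2l b0) -e1; apply: ler_wpM2r => //; exact: ltW.
have SS : S <= S'.
  have [->//|Sn] := eqVneq S 0.
  have Sp : 0 < S by rewrite lt_neqAle eq_sym Sn.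
  have : d * S < d * S' by rewrite -e2 ltr_pM2r.
  move: d0; rewrite le_eqVlt => /orP[/eqP <-|dp]; first by rewrite !mul0r ltxx.
  by rewrite ltr_pM2l // => /ltW.
have CE : C = C' by lra.
have SE : S = S' by lra.
move: e1 e2; rewrite -CE -SE => e1 e2.
have C_0 : C = 0 by apply/eqP; move/eqP: e1; rewrite -subr_eq0 -mulrBl mulf_eq0 => /orP[|//]; lra.
have S_0 : S = 0 by apply/eqP; move/eqP: e2; rewrite -subr_eq0 -mulrBl mulf_eq0 => /orP[|//]; lra.
lra.
Qed.

Lemma ellipse_inj r r' c s c' s' : 0 < r -> 0 < r' -> r <= 1 -> r' <= 1 ->
  c ^+ 2 + s ^+ 2 = 1 -> c' ^+ 2 + s' ^+ 2 = 1 ->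
  r' * (1 + r) * c = r * (1 + r') * c' -> r' * (1 - r) * s = r * (1 - r') * s' -> r = r'.
Proof.
move=> r0 r0' r1 r1' cs cs' ec es; have [h|h|//] := ltgtP r r'; exfalso.
  exact: ellipse_lt cs cs' ec es h.
exact: (ellipse_lt r0' r1 cs' cs (esym ec) (esym es) h).
Qed.

(** Here q stands for 1/r. The polynomial is the equation of the ellipse with denominators cleared:
    it is at most 0 at q = 1 and at least 0 at the chosen large value, so it has a root. For B = 0
    the root q = 1 may be spurious, as the ellipse degenerates to the segment [-2,2]; that case is
    solved by hand. *)
Lemma ellipse_surj A B : exists q c s, [/\ 1 <= q, c ^+ 2 + s ^+ 2 = 1,
  (q + 1) * c = A & (q - 1) * s = B].
Proof.
have [->|B0] := eqVneq B 0.
  have [A2|A2] := leP `|A| 2.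
    exists 1, (A / 2), (Num.sqrt (1 - (A / 2) ^+ 2)); split=> //; try by field.
    rewrite sqr_sqrtr; first by ring.
    rewrite subr_ge0 -real_normK ?num_real // expr_le1 // normrM [`|2^-1|]ger0_norm //.
    lra.
  have A0 : `|A| != 0 by rewrite gt_eqF //; lra.
  exists (`|A| - 1), (A / `|A|), 0; split.
  - lra.
  - by rewrite expr_div_n real_normK ?num_real // expr0n addr0 divff // sqrf_eq0 -normr_eq0.
  - by rewrite subrK mulrC divfK.
  - by rewrite mulr0.
pose p : {poly R} := ('X ^+ 2 - 1) ^+ 2 - (A ^+ 2)%:P * ('X - 1) ^+ 2 - (B ^+ 2)%:P * ('X + 1) ^+ 2.
have pE q : p.[q] = (q ^+ 2 - 1) ^+ 2 - A ^+ 2 * (q - 1) ^+ 2 - B ^+ 2 * (q + 1) ^+ 2.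
  by rewrite /p !hornerE.
pose a := `|A|; pose b := `|B|.
have aE : A ^+ 2 = a ^+ 2 by rewrite /a real_normK ?num_real.
have bE : B ^+ 2 = b ^+ 2 by rewrite /b real_normK ?num_real.
have [a0 b0] : 0 <= a /\ 0 <= b by rewrite !normr_ge0.
have q1 : 1 <= 1 + 2 * (a + b) by lra.
have h : p.[1] <= 0 <= p.[1 + 2 * (a + b)].
  rewrite !pE aE bE; apply/andP; split.
    have -> : (1 ^+ 2 - 1) ^+ 2 - a ^+ 2 * (1 - 1) ^+ 2 - b ^+ 2 * (1 + 1) ^+ 2 = - (2 * b) ^+ 2 :> R by ring.
    by rewrite oppr_le0 sqr_ge0.
  pose d := 2 * (a + b).
  have -> : ((1 + 2 * (a + b)) ^+ 2 - 1) ^+ 2 - a ^+ 2 * (1 + 2 * (a + b) - 1) ^+ 2 -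
     b ^+ 2 * (1 + 2 * (a + b) + 1) ^+ 2 = d ^+ 2 * ((d + 2) ^+ 2 - a ^+ 2) - b ^+ 2 * (d + 2) ^+ 2.
    by rewrite /d; ring.
  have d0 : 0 <= d by rewrite /d; lra.
  have e1 : 2 * b ^+ 2 <= d ^+ 2 by rewrite /d; nra.
  have e2 : 2 * a ^+ 2 <= (d + 2) ^+ 2 by rewrite /d; nra.
  move: (d ^+ 2) ((d + 2) ^+ 2) (a ^+ 2) (b ^+ 2) (sqr_ge0 d) (sqr_ge0 (d + 2)) (sqr_ge0 a) (sqr_ge0 b) e1 e2.
  by clear; move=> x y u v *; nra.
have [q /andP[q1' _] /rootP] := poly_ivt q1 h; rewrite pE => qE.
have qn : q != 1.
  apply: contra B0 => /eqP q1E; move/eqP: qE; rewrite q1E.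
  have -> : (1 ^+ 2 - 1) ^+ 2 - A ^+ 2 * (1 - 1) ^+ 2 - B ^+ 2 * (1 + 1) ^+ 2 = - (2 * B) ^+ 2 :> R by ring.
  by rewrite oppr_eq0 sqrf_eq0 mulf_eq0 pnatr_eq0.
have qm : q - 1 != 0 by rewrite subr_eq0.
have qp : q + 1 != 0 by rewrite gt_eqF //; lra.
exists q, (A / (q + 1)), (B / (q - 1)); split=> //; last 2 first.
- by rewrite mulrC divfK.
- by rewrite mulrC divfK.
have -> : (A / (q + 1)) ^+ 2 + (B / (q - 1)) ^+ 2 =
    (A ^+ 2 * (q - 1) ^+ 2 + B ^+ 2 * (q + 1) ^+ 2) / (q ^+ 2 - 1) ^+ 2.
  have -> : q ^+ 2 - 1 = (q - 1) * (q + 1) by ring.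
  by field; rewrite qm qp.
have -> : A ^+ 2 * (q - 1) ^+ 2 + B ^+ 2 * (q + 1) ^+ 2 = (q ^+ 2 - 1) ^+ 2.
  by apply/eqP; rewrite -subr_eq0 -oppr_eq0; apply/eqP; rewrite -qE; ring.
rewrite divff // sqrf_eq0 (_ : q ^+ 2 - 1 = (q - 1) * (q + 1)); last by ring.
by rewrite mulf_neq0.
Qed.

(** In complex form, e^(ih) (e^(it) + r e^(-it)): an ellipse with semi-axes 1+r and 1-r, rotated by
    h. *)
Lemma half_turn_sum (r h t : R) :
  cosT (h + t) + r * cosT (h - t) = (1 + r) * cosT t * cosT h - (1 - r) * sinT t * sinT h /\
  sinT (h + t) + r * sinT (h - t) = (1 + r) * cosT t * sinT h + (1 - r) * sinT t * cosT h.
Proof. by rewrite !cosTD !sinTD cosTN sinTN; split; ring. Qed.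

Lemma rotation_inj (h u v u' v' : R) :
  u * cosT h - v * sinT h = u' * cosT h - v' * sinT h ->
  u * sinT h + v * cosT h = u' * sinT h + v' * cosT h -> u = u' /\ v = v'.
Proof.
move=> e1 e2; have h1 := cosT2DsinT2 h; split.
  have E x y : x = (x * cosT h - y * sinT h) * cosT h + (x * sinT h + y * cosT h) * sinT h.
    by rewrite -[LHS]mulr1 -h1; ring.
  by rewrite (E u v) e1 e2 -E.
have E x y : y = (x * sinT h + y * cosT h) * cosT h - (x * cosT h - y * sinT h) * sinT h.
  by rewrite -[LHS]mulr1 -h1; ring.
by rewrite (E u v) e1 e2 -E.
Qed.

(** The Moebius band can be on either side of the union, which decides which circle factor of the
    sphere carries the weight P and which the weight 2. *)
Definition row22 (b : bool) (a0 a1 c0 c1 : R) : 'rV[R]_4 :=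
  if b then row4 a0 a1 c0 c1 else row4 c0 c1 a0 a1.

Lemma row22_scale b (a0 a1 c0 c1 a0' a1' c0' c1' k : R) :
  row22 b a0 a1 c0 c1 = k *: row22 b a0' a1' c0' c1' <->
  [/\ a0 = k * a0', a1 = k * a1', c0 = k * c0' & c1 = k * c1'].
Proof.
case: b; rewrite /row22; split.
- by move=> /row4_eq; rewrite !mxE.
- by move=> h; apply/row4_eq; rewrite !mxE.
- by move=> /row4_eq; rewrite !mxE => -[? ? ? ?].
- by move=> [? ? ? ?]; apply/row4_eq; rewrite !mxE.
Qed.

Lemma row22_exists b (z : 'rV[R]_4) : exists a0 a1 c0 c1, z = row22 b a0 a1 c0 c1.
Proof.
case: b; [exists (z ord0 v0), (z ord0 v1), (z ord0 v2), (z ord0 v3) |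
  exists (z ord0 v2), (z ord0 v3), (z ord0 v0), (z ord0 v1)];
  by apply/esym/row4_eq.
Qed.

End Ellipses.

Lemma swap01K F : swap01 (swap01 F) = F.
Proof. by case: F => t [[a b] c]. Qed.

Section Fold.
Context (R : realType).
Local Notation pt := (point_of_tets R).
Context (n : nat) (ps : seq pairing) (X Y : face) (p q : int) (r x y : pt -> R) (bb : bool).
Hypothesis M : solid_model n ps X Y 1 p 1 q r x y.
Hypothesis D : 1 * q - 1 * p = 1 \/ 1 * q - 1 * p = -1.
Hypothesis cL : closed_torus (Solid n ps X Y).

Let P : int := p + q.
Let T := Gluing n (ps ++ [:: (X, swap01 Y)]).

(* For [|z| = r] this is (w + r e^(2 pi i P x) conj(w), 2 z): it folds the boundary torus
   along the curve in direction (2, P). *)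
Definition fold_map (u : pt) : 'rV[R]_4 :=
  row22 bb (cosT (y u) + r u * cosT (P%:~R * x u - y u)) (sinT (y u) + r u * sinT (P%:~R * x u - y u))
    (2 * r u * cosT (x u)) (2 * r u * sinT (x u)).

(** The boundary pairs exchanged by w -> u^P conj(w) with u fixed. *)
Definition folded (u v : pt) : Prop :=
  [/\ r u = 1, r v = 1, eqm (x u) (x v) & eqm (y v) (P%:~R * x u - y u)].

Lemma fold_map_same u v : same_point r x y u v -> fold_map u = fold_map v.
Proof.
move=> [rE yE [r0|xE]].
  by rewrite /fold_map -rE r0 !mulr0 !mul0r !addr0 (cosT_eqm yE) (sinT_eqm yE).
have e := eqmD (eqmMz P xE) (eqmN yE).
by rewrite /fold_map rE (cosT_eqm yE) (sinT_eqm yE) (cosT_eqm xE) (sinT_eqm xE) (cosT_eqm e) (sinT_eqm e).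
Qed.

Lemma fold_map_folded u v : folded u v -> fold_map u = fold_map v.
Proof.
move=> [ru rv xE yE].
have e : eqm (P%:~R * x v - y v) (y u).
  apply: eqm_trans (eqmD (eqm_sym (eqmMz P xE)) (eqmN yE)) _.
  by apply: (@eqm_int _ 0); ring.
rewrite /fold_map ru rv (cosT_eqm yE) (sinT_eqm yE) (cosT_eqm xE) (sinT_eqm xE) (cosT_eqm e) (sinT_eqm e).
by rewrite !mul1r [cosT (y u) + _]addrC [sinT (y u) + _]addrC.
Qed.

Lemma folded_faces (l0 l1 l2 : R) u v : pon_face X l0 l1 l2 u -> pon_face Y l1 l0 l2 v -> folded u v.
Proof.
move=> uX vY; have [ru xu yu] := model_X M uX; have [rv xv yv] := model_Y M vY.
have s := pon_face_sum uX; have l0E : l0 = 1 - l1 - l2 by lra.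
split=> //.
  apply: eqm_trans xu _; apply: eqm_sym; apply: eqm_trans xv _.
  (* As al = be = 1, the angle is l2 + 2 l1 on [X] and -(l2 + 2 l0) on [Y]; the sum of the
     coordinates being 1, these differ by 2. *)
  by rewrite l0E; apply: (@eqm_int _ (- 2)); ring.
apply: eqm_trans yv _; apply: eqm_sym; apply: eqm_trans (eqmD (eqmMz P xu) (eqmN yu)) _.
by rewrite l0E /P; apply: (@eqm_int _ (p + q)); ring.
Qed.

Lemma folded_sym u v : folded u v -> folded v u.
Proof.
move=> [ru rv xE yE]; split=> //; first exact: eqm_sym.
apply: eqm_sym; apply: eqm_trans (eqmD (eqm_sym (eqmMz P xE)) (eqmN yE)) _.
by apply: (@eqm_int _ 0); ring.
Qed.

Lemma fold_glue (u v : pt) : pglued (pairings T) u v -> fold_map u = fold_map v.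
Proof.
move=> [F [G [l0 [l1 [l2 [h uF vG]]]]]]; move: h; rewrite mem_cat inE => /orP[h|/eqP[FE GE]].
  by apply: fold_map_same; apply: (model_glue M); exists F, G, l0, l1, l2.
rewrite FE in uF; rewrite GE in vG.
by apply: fold_map_folded; apply: folded_faces uF (pon_face_swap01 vG).
Qed.

(** The component 2z gives the angle [x] and the ratio of the radii. Rotated back by half of P [x],
    the other component is a point on one of the nested ellipses, so the radii agree and c = 1. For
    radius below 1 the ellipse determines [y]; at radius 1 it is a segment, the sine is lost, and
    exactly the folded partner appears. *)
Lemma fold_map_inj u v (c : R) : (u.1 < n)%N -> (v.1 < n)%N -> 0 < c ->
  fold_map u = c *: fold_map v -> same_point r x y u v \/ folded u v.
Proof.
move=> un vn c0 /row22_scale[e1 e2 e3 e4].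
have /andP[ru ru1] := model_range M un; have /andP[rv rv1] := model_range M vn.
have [|||rc xE] := @polar_eq R (r u) (x u) (c * r v) (x v) ru.
- by rewrite mulr_ge0 // ltW.
- by apply: (@mulfI _ 2) => //; rewrite !mulrA e3; ring.
- by apply: (@mulfI _ 2) => //; rewrite !mulrA e4; ring.
have [r0|rn] := eqVneq (r u) 0.
  have rv0 : r v = 0 by apply/eqP; move/eqP: rc; rewrite r0 eq_sym mulf_eq0 gt_eqF.
  left; split; [by rewrite r0 rv0 | | by left].
  move: e1 e2; rewrite r0 rv0 !mul0r !addr0 => e1 e2.
  by have [||//] := @circle_polar R c (y u) 1 (y v) c0 ler01; rewrite ?mul1r.
case: xE => [/eqP|xE]; first by rewrite (negPf rn).
have rup : 0 < r u by rewrite lt_neqAle eq_sym rn.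
have rvp : 0 < r v by rewrite -(pmulr_rgt0 _ c0) -rc.
have xE' : eqm (P%:~R * x v - y v) (P%:~R * x u - y v).
  by apply: eqmD; [apply/eqmMz/eqm_sym | exact: eqm_refl].
rewrite (cosT_eqm xE') (sinT_eqm xE') in e1 e2.
pose h := P%:~R * x u / 2; pose a := y u - h; pose b := y v - h.
have yuE : y u = h + a by rewrite /a; ring.
have yuE' : P%:~R * x u - y u = h - a by rewrite /a /h; field.
have yvE : y v = h + b by rewrite /b; ring.
have yvE' : P%:~R * x u - y v = h - b by rewrite /b /h; field.
have [ca sa] := half_turn_sum (r u) h a; have [cb sb] := half_turn_sum (r v) h b.
rewrite yuE' yvE' yuE yvE ca cb in e1; rewrite yuE' yvE' yuE yvE sa sb in e2.
have [ec es] : (1 + r u) * cosT a = c * ((1 + r v) * cosT b) /\ (1 - r u) * sinT a = c * ((1 - r v) * sinT b).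
  by apply: (@rotation_inj _ h); rewrite ?e1 ?e2; ring.
have rE : r u = r v.
  apply: (@ellipse_inj R _ _ (cosT a) (sinT a) (cosT b) (sinT b)); rewrite ?cosT2DsinT2 //.
    by rewrite -mulrA ec rc; ring.
  by rewrite -mulrA es rc; ring.
have c1 : c = 1 by apply: (mulIf rn); rewrite {1}rE -rc mul1r.
rewrite c1 -rE !mul1r in ec es.
have {}ec : cosT a = cosT b by apply: (mulfI _ ec); rewrite gt_eqF //; lra.
have [r1|r1] := eqVneq (r u) 1; last first.
  left; split=> //; last by right.
  have {}es : sinT a = sinT b by apply: (mulfI _ es); rewrite subr_eq0 eq_sym.
  by rewrite yuE yvE; apply: eqmD; [exact: eqm_refl | exact: eqmP].
have : sinT a ^+ 2 == sinT b ^+ 2.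
  by apply/eqP; have := cosT2DsinT2 a; have := cosT2DsinT2 b; rewrite ec; lra.
rewrite eqf_sqr => /orP[/eqP es'|/eqP es'].
  left; split=> //; last by right.
  by rewrite yuE yvE; apply: eqmD; [exact: eqm_refl | exact: eqmP].
right; split=> //; first by rewrite -rE.
rewrite yuE' yvE; apply: eqmD; first exact: eqm_refl.
by apply: eqmP; rewrite ?cosTN ?sinTN // es' opprK.
Qed.

Lemma fold_step (l0 l1 l2 : R) (u v : pt) : pon_face X l0 l1 l2 u -> pon_face Y l1 l0 l2 v ->
  pident (pairings T) u v.
Proof.
move=> uX vY; apply: (pident_step (F := X) (G := swap01 Y)) uX _; first by rewrite mem_cat inE eqxx orbT.
by apply: pon_face_swap01; rewrite swap01K.
Qed.

Lemma pident_fold (u v : pt) : pident ps u v -> pident (pairings T) u v.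
Proof. by apply: pident_sub => A h; rewrite mem_cat h. Qed.

Lemma folded_pident u v : (u.1 < n)%N -> (v.1 < n)%N -> folded u v -> pident (pairings T) u v.
Proof.
move=> un vn uv; have [ru rv _ _] := uv.
have folded_same w z : same_point r x y u w -> folded w z -> same_point r x y z v.
  move=> [rE yE [r0|xE]] [rw rz xw yw]; first by move: ru; rewrite r0 => /esym/eqP; rewrite oner_eq0.
  have [_ _ xuv yuv] := uv; split; [by rewrite rz rv | | right].
    apply: eqm_trans yw _; apply: eqm_sym; apply: eqm_trans yuv _.
    exact: eqmD (eqmMz P xE) (eqmN yE).
  by apply: eqm_trans (eqm_sym xw) _; apply: eqm_trans (eqm_sym xE) _.
have [l0 [l1 [l2 [w [[p0 p1 p2 s] wn sw h]]]]] := model_boundary M D ru.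
have [Xn Yn _] := model_faces M.
have s' : l1 + l0 + l2 = 1 by lra.
have uw : pident (pairings T) u w by apply: pident_fold; apply: (model_inj M).
case: h => h.
  have [z zY] := pon_face_exists Y p1 p0 p2 s'.
  have zn : (z.1 < n)%N by rewrite (pon_face_tet zY).
  apply: (rst_trans _ _ _ w) => //; apply: (rst_trans _ _ _ z); first exact: fold_step h zY.
  by apply: pident_fold; apply: (model_inj M) => //; apply: folded_same sw (folded_faces h zY).
have [z zX] := pon_face_exists X p1 p0 p2 s'.
have zn : (z.1 < n)%N by rewrite (pon_face_tet zX).
apply: (rst_trans _ _ _ w) => //; apply: (rst_trans _ _ _ z).
  by apply: rst_sym; exact: fold_step zX h.
apply: pident_fold; apply: (model_inj M) => //; apply: folded_same sw _.
by apply: folded_sym; exact: folded_faces zX h.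
Qed.

Lemma fold_inj u v (c : R) : (u.1 < n)%N -> (v.1 < n)%N -> 0 < c ->
  fold_map u = c *: fold_map v -> pident (pairings T) u v.
Proof.
move=> un vn c0 /(fold_map_inj un vn c0)[uv|uv]; last exact: folded_pident.
by apply: pident_fold; exact: (model_inj M).
Qed.

Lemma fold_neq0 u : (u.1 < n)%N -> fold_map u != 0.
Proof.
move=> un; have -> : 0 = 0 *: row22 bb 0 0 0 0 :> 'rV[R]_4 by rewrite scale0r.
apply/eqP => /row22_scale; rewrite !mul0r => -[e1 e2 e3 e4].
have r0 : r u = 0.
  have : (2 * r u) ^+ 2 = 0.
    by rewrite -[LHS]mulr1 -[X in _ * X = _](cosT2DsinT2 (x u)) mulrDr -!exprMn e3 e4 expr0n addr0.
  by move/eqP; rewrite sqrf_eq0 mulf_eq0 pnatr_eq0 => /eqP.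
move: e1 e2; rewrite r0 !mul0r !addr0 => e1 e2.
by have := cosT2DsinT2 (y u); rewrite e1 e2 expr0n addr0 => /esym/eqP; rewrite oner_eq0.
Qed.

(** If the component 2z vanishes, the point is on the core. Otherwise its angle prescribes [x], and
    the other component, rotated back by [h] and scaled by 2/b, lies on an ellipse of the family,
    whose parameter [k] is the inverse of the radius sought. *)
Lemma fold_surj (z : 'rV[R]_4) : z != 0 -> exists u c, [/\ (u.1 < n)%N, 0 < c & fold_map u = c *: z].
Proof.
have [a0 [a1 [c0 [c1 ->]]]] := row22_exists bb z => z0.
have [b [t [b_0 c0E c1E]]] := polar_exists c0 c1.
have [a [s [a_0 a0E a1E]]] := polar_exists a0 a1.
have [bE|bn] := eqVneq b 0.
  have an : 0 < a.
    rewrite lt_neqAle a_0 andbT eq_sym; apply: contra z0 => /eqP aE.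
    rewrite -(scale0r (row22 bb 0 0 0 0)); apply/eqP/row22_scale.
    by rewrite c0E c1E a0E a1E aE bE !mul0r.
  have [|u [un ru yu _]] := @model_surj _ _ _ _ _ _ _ _ _ _ _ _ M 0 0 s; first by rewrite lexx ler01.
  exists u, a^-1; split=> //; first by rewrite invr_gt0.
  apply/row22_scale; rewrite ru c0E c1E a0E a1E bE !mulr0 !mul0r !addr0 mulr0 !mulrA mulVf ?gt_eqF // !mul1r.
  by rewrite (cosT_eqm yu) (sinT_eqm yu).
have bp : 0 < b by rewrite lt_neqAle eq_sym bn.
pose h := P%:~R * t / 2; pose U := a0 * cosT h + a1 * sinT h; pose V := a1 * cosT h - a0 * sinT h.
have [k [c [d [k1 cd kc kd]]]] := ellipse_surj (2 * U / b) (2 * V / b).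
have [f [cf sf]] := turn_exists cd.
have k0 : 0 < k by lra.
have hk : 0 <= k^-1 <= 1 by rewrite invr_ge0 ltW //= invf_le1.
have [u [un ru yu xu]] := model_surj M t (h + f) hk.
have {}xu : eqm (x u) t by case: xu => // /eqP; rewrite invr_eq0 gt_eqF.
have e : eqm (P%:~R * x u - y u) (h - f).
  apply: eqm_trans (eqmD (eqmMz P xu) (eqmN yu)) _.
  by apply: (@eqm_int _ 0); rewrite /h; field.
exists u, (2 / (k * b)); split=> //; first by rewrite divr_gt0 // mulr_gt0.
apply/row22_scale; rewrite ru (cosT_eqm yu) (sinT_eqm yu) (cosT_eqm e) (sinT_eqm e) (cosT_eqm xu) (sinT_eqm xu).
have [-> ->] := half_turn_sum k^-1 h f; rewrite cf sf.
have kn : k != 0 by rewrite gt_eqF.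
have cU : (1 + k^-1) * c = 2 / (k * b) * U.
  have -> : (1 + k^-1) * c = (k + 1) * c / k by field.
  by rewrite kc; field; rewrite kn bn.
have dV : (1 - k^-1) * d = 2 / (k * b) * V.
  have -> : (1 - k^-1) * d = (k - 1) * d / k by field.
  by rewrite kd; field; rewrite kn bn.
have h1 := cosT2DsinT2 h.
have a0U : U * cosT h - V * sinT h = a0.
  by rewrite -[RHS]mulr1 -[X in _ = _ * X]h1 /U /V; ring.
have a1U : U * sinT h + V * cosT h = a1.
  by rewrite -[RHS]mulr1 -[X in _ = _ * X]h1 /U /V; ring.
rewrite cU dV; split.
- by rewrite -a0U; ring.
- by rewrite -a1U; ring.
- by rewrite c0E; field; rewrite kn bn.
- by rewrite c1E; field; rewrite kn bn.
Qed.

Lemma fold_cont t : (t < n)%N -> forall j, continuous (fun s => fold_map (t, s) ord0 j).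
Proof.
move=> tn; have pc := model_cont M tn; have [cr cc cs cy] := pc.
have trig g s : (forall w, `|g w| <= 1) -> (r (t, s) != 0 -> {for s, continuous g}) ->
    {for s, continuous (fun w : set_type (simplex3 R) => r (t, w) * g w)}.
  by move=> g1 cg; apply: (@continuous_fun_norm_bounded _ _ (fun w => r (t, w)) g s 1) => //; exact: cr.
have tc s : r (t, s) != 0 -> turn_continuous (fun w => P%:~R * x (t, w) - y (t, w)) s.
  move=> r0; have := polar_combination P (-1) pc r0.
  rewrite (_ : (fun w => _) = (fun w => P%:~R * x (t, w) - y (t, w))) //.
  by apply/funext => w; rewrite rmorphN mulN1r.
have c0 : continuous (fun s => cosT (y (t, s)) + r (t, s) * cosT (P%:~R * x (t, s) - y (t, s))).
  move=> s; have [cys _] := cy s.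
  have c2 := @trig (fun w => cosT (P%:~R * x (t, w) - y (t, w))) s (fun w => cos_max _) (fun r0 => (tc s r0).1).
  exact: (cvgD cys c2).
have c1 : continuous (fun s => sinT (y (t, s)) + r (t, s) * sinT (P%:~R * x (t, s) - y (t, s))).
  move=> s; have [_ cys] := cy s.
  have c2 := @trig (fun w => sinT (P%:~R * x (t, w) - y (t, w))) s (fun w => sin_max _) (fun r0 => (tc s r0).2).
  exact: (cvgD cys c2).
have c2 : continuous (fun s => 2 * r (t, s) * cosT (x (t, s))).
  rewrite (_ : (fun s => _) = fun s => 2 * (r (t, s) * cosT (x (t, s)))).
    by move=> s; exact: (cvgM (cvg_cst _) (cc s)).
  by apply/funext => s; rewrite mulrA.
have c3 : continuous (fun s => 2 * r (t, s) * sinT (x (t, s))).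
  rewrite (_ : (fun s => _) = fun s => 2 * (r (t, s) * sinT (x (t, s)))).
    by move=> s; exact: (cvgM (cvg_cst _) (cs s)).
  by apply/funext => s; rewrite mulrA.
rewrite /fold_map /row22; case: bb.
  exact: (continuous_row4 (fun s => erefl) c0 c1 c2 c3).
exact: (continuous_row4 (fun s => erefl) c2 c3 c0 c1).
Qed.

Lemma fold_vertex u j : (u.1 < n)%N -> bc u j = 1 -> fold_map u = row22 bb 2 0 2 0.
Proof.
move=> un uj; have [xu yu] := model_vertex_eqm M un uj; have ru := model_vertex M un uj.
have e : eqm (P%:~R * x u - y u) 0.
  by have := eqmD (eqmMz P xu) (eqmN yu); rewrite mulr0 oppr0 addr0.
rewrite /fold_map ru (cosT_eqm xu) (cosT_eqm yu) (cosT_eqm e) (sinT_eqm xu) (sinT_eqm yu) (sinT_eqm e).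
by rewrite cosT0 sinT0 !(mulr1, mulr0, mul1r, addr0).
Qed.

(** If mirror points had the same image, either their core angles would agree, against [d2 != 0], or
    they would be folded onto each other and share [x]. The latter needs radius 1, hence a boundary
    slope, whose first component is 1 or 2 up to sign. *)
Lemma fold_reverse t (a b : 'I_4) : (t < n)%N -> a != b -> exists u v : pt,
  [/\ u.1 = t, v.1 = t, bc u a + bc u b = 1, bc v a + bc v b = 1 & bc u a = bc v b] /\
  forall c : R, 0 < c -> fold_map u <> c *: fold_map v.
Proof.
move=> tn ab; have [d1 [d2 [d20 hd h]]] := model_edge M tn ab.
have [u [v [[ut vt uab vab uv] [ua ub neq1 neq2]]]] := @reverse_points R t a b d1 d2 ab d20.
have un : (u.1 < n)%N by rewrite ut.
have vn : (v.1 < n)%N by rewrite vt.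
have [xu yu] := h u ut uab; have [xv yv] := h v vt vab.
exists u, v; split=> // c c0 /(fold_map_inj un vn c0)[[_ yE _]|[ru _ xE _]].
  by apply: neq2; apply: eqm_trans (eqm_sym yu) _; apply: eqm_trans yE _.
case: hd => [hd|hr]; last by have := hr u ut uab ua ub; rewrite ru ltxx.
apply: neq1; last by apply: eqm_trans (eqm_sym xu) _; apply: eqm_trans xE _.
by move: hd; rewrite !inE => /orP[|/orP[|/orP[|/orP[|/orP[]]]]] /eqP[-> _].
Qed.

Let K1 : int := if bb then P else 2.
Let K2 : int := if bb then 2 else P.

(** On the (p+q)-edge with parameter l the angles are x = 2l and y = Pl, so P x - y = y: the edge is
    fixed by the fold, and its image is twice the pair of circle points at angles Pl and 2l. *)
Lemma fold_knot : exists t (a b : 'I_4), [/\ (t < n)%N, a != b,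
  forall u : pt, u.1 = t -> bc u a + bc u b = 1 -> exists th (c : R),
    0 < c /\ fold_map u = c *: torus_curve K1 K2 th &
  forall th, exists (u : pt) (c : R),
    [/\ u.1 = t, bc u a + bc u b = 1, 0 < c & fold_map u = c *: torus_curve K1 K2 th]].
Proof.
have s2 : 0 < (Num.sqrt 2 : R) by rewrite sqrtr_gt0.
have [Xn _ _] := model_faces M.
have /(cL.1 X)[_] : X \in faces_of ps ++ [:: X; Y] by rewrite mem_cat !inE eqxx orbT.
case XE : X Xn => [t [[a b] c]] /= tn abc.
have ab : a != b by move: abc; rewrite inE negb_or => /andP[/andP[]].
have edge u : u.1 = t -> bc u a + bc u b = 1 -> fold_map u =
    2 *: row4 (cosT (K1%:~R * bc u b)) (sinT (K1%:~R * bc u b))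
      (cosT (K2%:~R * bc u b)) (sinT (K2%:~R * bc u b)).
  move=> ut uab; have [ru xu yu] := model_X_edge M XE abc ut uab.
  have -> : row4 (cosT (K1%:~R * bc u b)) (sinT (K1%:~R * bc u b)) (cosT (K2%:~R * bc u b)) (sinT (K2%:~R * bc u b)) =
    row22 bb (cosT (P%:~R * bc u b)) (sinT (P%:~R * bc u b)) (cosT ((1 + 1)%:~R * bc u b)) (sinT ((1 + 1)%:~R * bc u b)).
    by rewrite /K1 /K2; case: bb.
  have e : eqm (P%:~R * x u - y u) (P%:~R * bc u b).
    apply: eqm_trans (eqmD (eqmMz P xu) (eqmN yu)) _.
    by apply: (@eqm_int _ 0); rewrite -/P; ring.
  apply/row22_scale; rewrite ru (cosT_eqm xu) (cosT_eqm yu) (cosT_eqm e) (sinT_eqm xu) (sinT_eqm yu) (sinT_eqm e).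
  by rewrite -/P; split; ring.
exists t, a, b; split=> //.
  move=> u ut uab; exists (pi *+ 2 * bc u b), (2 * Num.sqrt 2).
  by rewrite edge // row4_torus_curve scalerA mulr_gt0.
move=> th; have [l [l0 l1 ->]] := torus_curve_turn K1 K2 th.
have [u [ut ua ub]] := @edge_points R t a b l ab l0 l1.
exists u, (2 * Num.sqrt 2); have uab : bc u a + bc u b = 1 by rewrite ua ub subrK.
by split=> //; rewrite edge // ub scalerA mulfK // gt_eqF.
Qed.

Lemma fold_S3 : [/\ triangulates_S3 R T, one_vertex R T &
  exists e : set (underlying_space R T), edge e /\ realises e (torus_knot R K1 K2)].
Proof.
have n0 : (0 < n)%N by have [Xn _ _] := model_faces M; exact: leq_ltn_trans Xn.
have cT : closed_gluing T := closed_fold cL.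
apply: (@S3_criterion _ _ cT _ _ fold_map).
- exact: n0.
- exact: fold_cont.
- exact: fold_neq0.
- exact: fold_glue.
- exact: fold_inj.
- exact: fold_surj.
- by move=> u v j k un vn uj vk; rewrite (fold_vertex un uj) (fold_vertex vn vk).
- exact: fold_reverse.
- exact: fold_knot.
Qed.

End Fold.

(** * Canonical parameters *)

(** Substituting q = P - p and s = Q - r turns ps - qr into pQ - Pr, a Bezout relation between P and
    Q. *)
Lemma canonical_det P Q p q r s : canonical_parameters P Q p q r s ->
  [/\ (0 < p < P)%N, (0 < r < Q)%N, q = (P - p)%N, s = (Q - r)%N &
    p%:Z * Q%:Z - P%:Z * r%:Z = 1 \/ p%:Z * Q%:Z - P%:Z * r%:Z = -1].
Proof.
move=> [[p0 q0 r0 s0] [pq rs d]]; split; [lia | lia | lia | lia |].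
have -> : p%:Z * Q%:Z - P%:Z * r%:Z = (p * s)%:Z - (q * r)%:Z.
  by rewrite -pq -rs !PoszD !PoszM; ring.
by move: d; move: (_ - _) => z; lia.
Qed.

(** From a Bezout relation a Q = b P + 1, reduce a modulo P and correct b by the same multiple of Q.
    That r is positive uses Q >= 2, since r = 0 would give p Q = 1. *)
Lemma canonical_exists P Q : (2 <= P)%N -> (2 <= Q)%N -> coprime P Q ->
  exists p q r s, canonical_parameters P Q p q r s.
Proof.
move=> hP hQ; rewrite coprime_sym => /coprimeP; case; first by lia.
move=> [a b] /= ab; have {}ab : (a * Q = b * P + 1)%N by lia.
pose k := (a %/ P)%N; pose p := (a %% P)%N.
have aE : a = (k * P + p)%N by exact: divn_eq.
have pP : (p < P)%N by rewrite ltn_mod; lia.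
have e : (p * Q + k * Q * P = b * P + 1)%N by rewrite -ab aE mulnDl; lia.
have kb : (k * Q <= b)%N.
  rewrite leqNgt; apply/negP => lt; have : (b.+1 * P <= k * Q * P)%N by rewrite leq_mul2r lt orbT.
  by rewrite mulSn; lia.
pose r := (b - k * Q)%N.
have pr : (p * Q = r * P + 1)%N.
  have bP : (b * P = r * P + k * Q * P)%N by rewrite -mulnDl subnK.
  by move: e; rewrite bP; lia.
have p0 : (0 < p)%N by move: pr; case: (p) => [|//]; lia.
have r0 : (0 < r)%N by rewrite lt0n; apply/eqP => rE; move: pr; rewrite rE; nia.
have rQ : (r < Q)%N.
  rewrite ltnNge; apply/negP => Qr; have h1 : (Q * P <= r * P)%N by rewrite leq_mul2r Qr orbT.
  have h2 : (p * Q <= P * Q)%N by rewrite leq_mul2r ltnW ?orbT.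
  by rewrite mulnC in h1; lia.
by exists p, (P - p)%N, r, (Q - r)%N; split; split=> //; lia.
Qed.

Lemma dvdz_small (P : nat) (z : int) : (P%:Z %| z)%Z -> `|z| < P%:Z -> z = 0.
Proof.
move=> /dvdzP[k ->]; rewrite normrM => h.
have [->|k0] := eqVneq k 0; first by rewrite mul0r.
have k1 : 1 <= `|k| by rewrite -gtz0_ge1 normr_gt0.
have := ler_wpM2r (normr_ge0 P%:Z) k1; lia.
Qed.

(** If the two determinants agree, P divides (p - p') Q, so p = p' by size; if they are opposite, P
    divides (p + p' - P) Q, so p' = P - p. The second weights follow. *)
Lemma canonical_unique P Q p q r s p' q' r' s' : (2 <= P)%N -> (2 <= Q)%N -> coprime P Q ->
  canonical_parameters P Q p q r s -> canonical_parameters P Q p' q' r' s' ->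
  (p', q', r', s') = (p, q, r, s) \/ (p', q', r', s') = (q, p, s, r).
Proof.
move=> hP hQ cPQ /canonical_det[pP rQ -> -> d] /canonical_det[pP' rQ' -> -> d'].
have dvd (z w : int) : z * Q%:Z = P%:Z * w -> (P%:Z %| z)%Z.
  by move=> e; rewrite -(Gauss_dvdzl z (cPQ : coprimez P Q)) e dvdz_mulr.
have cancel (w w' : int) : P%:Z * w = P%:Z * w' -> w = w' by apply: mulfI; lia.
have [e|e] : p%:Z * Q%:Z - P%:Z * r%:Z = p'%:Z * Q%:Z - P%:Z * r'%:Z \/
    p%:Z * Q%:Z - P%:Z * r%:Z = - (p'%:Z * Q%:Z - P%:Z * r'%:Z) by lia.
  have e' : (p%:Z - p'%:Z) * Q%:Z = P%:Z * (r%:Z - r'%:Z) by rewrite mulrBl mulrBr; lia.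
  have := dvdz_small (dvd _ _ e') _ => z0; have {}z0 : p%:Z - p'%:Z = 0 by apply: z0; lia.
  have w0 : r%:Z - r'%:Z = 0 by apply: cancel; rewrite -e' z0 mul0r mulr0.
  have -> : p' = p by lia.
  have -> : r' = r by lia.
  by left.
have e' : (p%:Z + p'%:Z - P%:Z) * Q%:Z = P%:Z * (r%:Z + r'%:Z - Q%:Z).
  by rewrite !mulrBl !mulrBr !mulrDl !mulrDr; lia.
have := dvdz_small (dvd _ _ e') _ => z0; have {}z0 : p%:Z + p'%:Z - P%:Z = 0 by apply: z0; lia.
have w0 : r%:Z + r'%:Z - Q%:Z = 0 by apply: cancel; rewrite -e' z0 mul0r mulr0.
right; have -> : p' = (P - p)%N by lia.
have -> : r' = (Q - r)%N by lia.
by rewrite !subKn //; lia.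
Qed.

Lemma det_coprime (a b c d : nat) : a%:Z * d%:Z - b%:Z * c%:Z = 1 \/ a%:Z * d%:Z - b%:Z * c%:Z = -1 ->
  coprime a b.
Proof.
move=> D; rewrite /coprime.
have /dvdnP[ka ga] := dvdn_gcdl a b; have /dvdnP[kb gb] := dvdn_gcdr a b.
move: (gcdn a b) ga gb => g ga gb.
have e : (ka%:Z * d%:Z - kb%:Z * c%:Z) * g%:Z = a%:Z * d%:Z - b%:Z * c%:Z.
  by rewrite ga gb !PoszM; ring.
have : (absz (ka%:Z * d%:Z - kb%:Z * c%:Z)%R * g == 1)%N.
  by case: D => D; move: (congr1 absz e); rewrite D abszM => ->.
by rewrite muln_eq1 => /andP[_].
Qed.

Lemma realised_torus_knot (R : realType) (P Q p q r s : nat) : canonical_parameters P Q p q r s ->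
  let T := lst_union (LST p q) (LST r s) in
  [/\ triangulates_S3 R T, one_vertex R T &
      exists e : set (underlying_space R T), edge e /\ realises e (torus_knot R P%:Z Q%:Z)].
Proof.
move=> can; have [[p0 q0 r0 s0] [pq rs _]] := can.
have D : r%:Z * q%:Z - s%:Z * p%:Z = 1 \/ r%:Z * q%:Z - s%:Z * p%:Z = -1.
  have [_ _ qE sE d] := canonical_det can.
  have -> : r%:Z * q%:Z - s%:Z * p%:Z = - (p%:Z * Q%:Z - P%:Z * r%:Z).
    by rewrite -pq -rs !PoszD; ring.
  by case: d => ->; [right | left; rewrite opprK].
have D1 : p%:Z * s%:Z - q%:Z * r%:Z = 1 \/ p%:Z * s%:Z - q%:Z * r%:Z = -1.
  have -> : p%:Z * s%:Z - q%:Z * r%:Z = - (r%:Z * q%:Z - s%:Z * p%:Z) by ring.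
  by case: D => ->; [right | left; rewrite opprK].
have cpq : coprime p q := det_coprime D1.
have crs : coprime r s := det_coprime D.
have m0 (a b : nat) (al be : int) := @LST_rec_model R (a + b) a b al be.
have c0 (a b : nat) := @LST_rec_closed (a + b) a b.
(* Two Moebius bands would have determinant 0. With one on the left, P = 2, and [bb] is false so
   that the weight 2 comes first. *)
have [[p1 q1]|npq] := eqVneq (p, q) (1%N, 1%N).
  have nrs : (r, s) != (1%N, 1%N).
    by apply/eqP => -[rE sE]; move: D; rewrite p1 q1 rE sE; lia.
  have D' : 1 * s%:Z - 1 * r%:Z = 1 \/ 1 * s%:Z - 1 * r%:Z = -1.
    by move: D1; rewrite p1 q1.
  have := m0 r s 1 1 r0 s0 (leqnn _) nrs D'; have := c0 r s r0 s0 (leqnn _) crs nrs.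
  rewrite p1 q1 /LST /= -/(LST_rec (r + s) r s); case: (LST_rec _ r s) => // n ps X Y cL [rr [x [y M]]].
  have -> : lst_union Moebius (Solid n ps X Y) = Gluing n (ps ++ [:: (X, swap01 Y)]).
    by rewrite /lst_union shift0.
  have := @fold_S3 R n ps X Y r s rr x y false M D' cL.
  have -> : P%:Z = 2 by rewrite -pq p1 q1.
  by have -> : Q%:Z = r%:Z + s%:Z by rewrite -rs.
have [[r1 s1]|nrs] := eqVneq (r, s) (1%N, 1%N).
  have D' : 1 * q%:Z - 1 * p%:Z = 1 \/ 1 * q%:Z - 1 * p%:Z = -1.
    by move: D; rewrite r1 s1.
  have := m0 p q 1 1 p0 q0 (leqnn _) npq D'; have := c0 p q p0 q0 (leqnn _) cpq npq.
  rewrite r1 s1 /LST [LST_rec (1 + 1) 1 1]/=; case: (LST_rec _ p q) => // n ps X Y cL [rr [x [y M]]].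
  have -> : lst_union (Solid n ps X Y) Moebius = Gluing n (ps ++ [:: (X, swap01 Y)]).
    by rewrite /lst_union /= addn0.
  have := @fold_S3 R n ps X Y p q rr x y true M D' cL.
  have -> : Q%:Z = 2 by rewrite -rs r1 s1.
  by have -> : P%:Z = p%:Z + q%:Z by rewrite -pq.
(* Each side takes the weights of the other side as its meridional components, so the two boundary
   parametrisations are transposes of each other. *)
have := m0 p q r s p0 q0 (leqnn _) npq D; have := c0 p q p0 q0 (leqnn _) cpq npq.
have := m0 r s p q r0 s0 (leqnn _) nrs D1; have := c0 r s r0 s0 (leqnn _) crs nrs.
rewrite /LST; case: (LST_rec (r + s) r s) => // m ps' X' Y' cL' [rr' [x' [y' M']]].
case: (LST_rec (p + q) p q) => // n ps X Y cL [rr [x [y M]]].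
have := @union_S3 R n m ps ps' X Y X' Y' r p s q rr x y rr' x' y' M M' D cL cL'.
have -> : P%:Z = p%:Z + q%:Z by rewrite -pq.
by have -> : Q%:Z = r%:Z + s%:Z by rewrite -rs.
Qed.

Theorem corollary4p4 (R : realType) (P Q : nat)
    (hP : (2 <= P)%N) (hQ : (2 <= Q)%N) (hPQ : coprime P Q) :
  [/\ exists p q r s, canonical_parameters P Q p q r s,
      forall p q r s p' q' r' s',
        canonical_parameters P Q p q r s -> canonical_parameters P Q p' q' r' s' ->
        (p', q', r', s') = (p, q, r, s) \/ (p', q', r', s') = (q, p, s, r) &
      forall p q r s, canonical_parameters P Q p q r s ->
        let T := lst_union (LST p q) (LST r s) in
        [/\ triangulates_S3 R T, one_vertex R T &
            exists e : set (underlying_space R T),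
              edge e /\ realises e (torus_knot R P%:Z%R Q%:Z%R)]].
Proof.
split; first exact: canonical_exists.
  by move=> p q r s p' q' r' s'; exact: canonical_unique.
by move=> p q r s; exact: realised_torus_knot.
Qed.
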